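(* Let $n\in\mathbb{N}$, $T>0$, $\alpha\in(0,1)$, let $\sigma:AC^\alpha\to\mathbb{R}$, and let $H:[0,T]\times\mathbb{R}^n\times\mathbb{R}^n\to\mathbb{R}$ satisfy: (j) $H$ is continuous; (jj) there is a number $c_*>0$ (fixed) such that $|H(t,x,s)-H(t,x,r)|\le c_*(1+\|x\|)\|s-r\|$ for all $t\in[0,T]$ and $x,s,r\in\mathbb{R}^n$. Then the Cauchy problem $$\partial_t^\alpha\varphi(t,x(\cdot))+H\big(t,x(t),\nabla^\alpha\varphi(t,x(\cdot))\big)=0\quad\forall(t,x(\cdot))\in[0,T)\times AC^\alpha,\qquad \varphi(T,x(\cdot))=\sigma(x(\cdot))\quad\forall x(\cdot)\in AC^\alpha$$ admits at most one viscosity solution $\varphi:[0,T]\times AC^\alpha\to\mathbb{R}$.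
   Context: Function space. $\|\cdot\|$, $\langle\cdot,\cdot\rangle$ are the Euclidean norm and inner product. $AC^\alpha$ is the set of all $x:[0,T]\to\mathbb{R}^n$ of the form $x(\tau)=x(0)+\frac1{\Gamma(\alpha)}\int_0^\tau\frac{f(\xi)}{(\tau-\xi)^{1-\alpha}}\,\mathrm{d}\xi$, $\tau\in[0,T]$, for some measurable essentially bounded $f:[0,T]\to\mathbb{R}^n$. Such functions are continuous; $AC^\alpha$ carries the uniform norm $\|x(\cdot)\|_\infty=\max_{\tau\in[0,T]}\|x(\tau)\|$, and $[0,T]\times AC^\alpha$ the product metric. The Caputo derivative $({}^CD^\alpha x)(\tau)=\frac1{\Gamma(1-\alpha)}\frac{\mathrm{d}}{\mathrm{d}\tau}\int_0^\tau\frac{x(\xi)-x(0)}{(\tau-\xi)^\alpha}\,\mathrm{d}\xi$ exists a.e. and equals $f(\tau)$ a.e. for $f$ in the representation above. $Y(t,x(\cdot))=\{y(\cdot)\in AC^\alpha: y(\tau)=x(\tau)\ \forall\tau\in[0,t]\}$. $ci$-derivatives. $\varphi:[0,T]\times AC^\alpha\to\mathbb{R}$ is $ci$-differentiable of order $\alpha$ at $(t,x(\cdot))\in[0,T)\times AC^\alpha$ if there exist $\partial_t^\alpha\varphi(t,x(\cdot))\in\mathbb{R}$ and $\nabla^\alpha\varphi(t,x(\cdot))\in\mathbb{R}^n$ such that for any $y(\cdot)\in Y(t,x(\cdot))$ and any $\tau\in(t,T)$: $\varphi(\tau,y(\cdot))-\varphi(t,x(\cdot))=\partial_t^\alpha\varphi(t,x(\cdot))(\tau-t)+\int_t^\tau\langle\nabla^\alpha\varphi(t,x(\cdot)),({}^CD^\alpha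 y)(\xi)\rangle\,\mathrm{d}\xi+o(\tau-t)$, where $o:(0,\infty)\to\mathbb{R}$ may depend on $t$ and $y(\cdot)$ and $o(\delta)/\delta\to0$ as $\delta\to0^+$. $\varphi$ is $ci$-smooth of order $\alpha$ if it is continuous, $ci$-differentiable of order $\alpha$ at every point of $[0,T)\times AC^\alpha$, and $\partial_t^\alpha\varphi$, $\nabla^\alpha\varphi$ are continuous on $[0,T)\times AC^\alpha$. Function $a$. $a(\tau\mid t,x(\cdot))=x(\tau)$ for $\tau\in[0,t]$ and $a(\tau\mid t,x(\cdot))=x(0)+\frac1{\Gamma(\alpha)}\int_0^t\frac{({}^CD^\alpha x)(\xi)}{(\tau-\xi)^{1-\alpha}}\,\mathrm{d}\xi$ for $\tau\in(t,T]$. Condition (L) for $\varphi:[0,T]\times AC^\alpha\to\mathbb{R}$: for any compact $X\subset AC^\alpha$ there exists $\Lambda>0$ such that $|\varphi(t,x(\cdot))-\varphi(t,y(\cdot))|\le\Lambda\big(\|a(T\mid t,x(\cdot))-a(T\mid t,y(\cdot))\|+\int_0^T\frac{\|a(\tau\mid t,x(\cdot))-a(\tau\mid t,y(\cdot))\|}{(T-\tau)^{1-\alpha}}\,\mathrm{d}\tau\big)$ for all $t\in[0,T]$, $x(\cdot),y(\cdot)\in X$. Sets $X_k$, $k\in\mathbb{N}$: $X_k=\{x(\cdot)\in AC^\alpha:\|x(0)\|\le k,\ \|({}^CD^\alpha x)(\tau)\|\le kc_*(1+\|x(\tau)\|)\text{ for a.e. }\tau\in[0,T]\}$, with $c_*$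 the number from (jj). Viscosity solution of the Cauchy problem: a continuous functional $\varphi:[0,T]\times AC^\alpha\to\mathbb{R}$ satisfying (L) and the boundary condition $\varphi(T,x(\cdot))=\sigma(x(\cdot))$ for all $x(\cdot)\in AC^\alpha$, such that for any $ci$-smooth of order $\alpha$ functional $\psi:[0,T]\times AC^\alpha\to\mathbb{R}$ and any $k\in\mathbb{N}$: $(V_+)$ if $\varphi-\psi$ attains its minimum on $[0,T]\times X_k$ at some $(t,x(\cdot))\in[0,T)\times X_k$, then $\partial_t^\alpha\psi(t,x(\cdot))+H(t,x(t),\nabla^\alpha\psi(t,x(\cdot)))\le0$; $(V_-)$ if $\varphi-\psi$ attains its maximum on $[0,T]\times X_k$ at some $(t,x(\cdot))\in[0,T)\times X_k$, then $\partial_t^\alpha\psi(t,x(\cdot))+H(t,x(t),\nabla^\alpha\psi(t,x(\cdot)))\ge0$. *)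

(* Defs.v *)
From HB Require Import structures.
From mathcomp Require Import all_boot all_order all_algebra.
From mathcomp Require Import all_classical all_reals all_analysis.
From mathcomp Require Import ring.

Set Implicit Arguments.
Unset Strict Implicit.
Unset Printing Implicit Defensive.

Import Order.TTheory GRing.Theory Num.Theory.
Import numFieldNormedType.Exports.

Local Open Scope classical_set_scope.
Local Open Scope ring_scope.

Section euclidean.
Context {R : realType} {n : nat}.
Implicit Types u v w : 'rV[R]_n.

(* The library norm `|u| on 'rV[R]_n is the maximum norm, hence the explicit
   Euclidean norm.  Both induce the library topology of 'rV[R]_n. *)
Definition dotv u v : R := \sum_(i < n) u 0 i * v 0 i.

Definition enorm u : R := Num.sqrt (dotv u u).

Lemma dotvv_ge0 u : 0 <= dotv u u.
Proof. by apply: sumr_ge0 => i _; rewrite -expr2 sqr_ge0. Qed.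

Lemma enorm_ge0 u : 0 <= enorm u.
Proof. exact: sqrtr_ge0. Qed.

Lemma enorm0 : enorm 0 = 0.
Proof. by rewrite /enorm /dotv big1 ?sqrtr0// => i _; rewrite mxE mul0r. Qed.

Lemma enormN u : enorm (- u) = enorm u.
Proof.
rewrite /enorm /dotv; congr Num.sqrt.
by apply: eq_bigr => i _; rewrite mxE mulrNN.
Qed.

Lemma dotv_lin (a b : R) u v :
  dotv (a *: u + b *: v) (a *: u + b *: v) =
  a ^+ 2 * dotv u u + (a * b * dotv u v) *+ 2 + b ^+ 2 * dotv v v.
Proof.
rewrite /dotv !mulr_sumr -sumrMnl -!big_split /=.
by apply: eq_bigr => i _; rewrite !mxE; ring.
Qed.

Lemma dotv_cauchy_schwarz u v : dotv u v <= enorm u * enorm v.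
Proof.
have [u0|u0] := eqVneq (enorm u) 0; last have [v0|v0] := eqVneq (enorm v) 0.
- rewrite u0 mul0r; suff -> : dotv u v = 0 by [].
  move/eqP: u0; rewrite sqrtr_eq0 => u0.
  have /eqP := le_anti (introT andP (conj u0 (dotvv_ge0 u))).
  rewrite psumr_eq0; last by move=> i _; rewrite -expr2 sqr_ge0.
  move/allP => h; rewrite /dotv big1// => i _.
  by have := h i (mem_index_enum _); rewrite /= mulf_eq0 orbb => /eqP->; rewrite mul0r.
- rewrite v0 mulr0; suff -> : dotv u v = 0 by [].
  move/eqP: v0; rewrite sqrtr_eq0 => v0.
  have /eqP := le_anti (introT andP (conj v0 (dotvv_ge0 v))).
  rewrite psumr_eq0; last by move=> i _; rewrite -expr2 sqr_ge0.
  move/allP => h; rewrite /dotv big1// => i _.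
  by have := h i (mem_index_enum _); rewrite /= mulf_eq0 orbb => /eqP->; rewrite mulr0.
- have up : 0 < enorm u by rewrite lt_neqAle eq_sym u0 enorm_ge0.
  have vp : 0 < enorm v by rewrite lt_neqAle eq_sym v0 enorm_ge0.
  have := dotvv_ge0 (enorm v *: u + (- enorm u) *: v).
  rewrite dotv_lin sqrrN -(sqr_sqrtr (dotvv_ge0 u)) -(sqr_sqrtr (dotvv_ge0 v)).
  rewrite -/(enorm u) -/(enorm v) mulrN mulNr.
  set a := enorm u in up *; set b := enorm v in vp *; set d := dotv u v.
  have -> : b ^+ 2 * a ^+ 2 + (- (b * a * d)) *+ 2 + a ^+ 2 * b ^+ 2 =
            ((b * a) * (a * b - d)) *+ 2.
    by ring.
  by rewrite pmulrn_lge0// pmulr_rge0 ?mulr_gt0// subr_ge0.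
Qed.

Lemma enormD u v : enorm (u + v) <= enorm u + enorm v.
Proof.
rewrite -[leRHS]ger0_norm ?addr_ge0 ?enorm_ge0// -sqrtr_sqr ler_wsqrtr//.
have := dotv_lin 1 1 u v; rewrite !scale1r => ->.
rewrite expr1n !mul1r sqrrD !sqr_sqrtr ?dotvv_ge0//.
by rewrite lerD2r lerD2l lerMn2r dotv_cauchy_schwarz orbT.
Qed.

End euclidean.

Section fractional_calculus.
Context {R : realType} {n : nat}.
Local Notation mu := (@lebesgue_measure R).

Definition Gamma (a : R) : R :=
  \int[mu]_(s in `]0, +oo[) (s `^ (a - 1) * expR (- s)).

Definition vintegral (D : set R) (g : R -> 'rV[R]_n) : 'rV[R]_n :=
  \row_i \int[mu]_(xi in D) g xi 0 i.

(* At the singularity tau = xi the integrand takes the value 0, because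
   0 `^ p = 0 for p != 0 and 0^-1 = 0; this affects a null set only. *)
Definition frac_integral (alpha s tau : R) (f : R -> 'rV[R]_n) : 'rV[R]_n :=
  (Gamma alpha)^-1 *:
    vintegral `[0, s] (fun xi => ((tau - xi) `^ (1 - alpha))^-1 *: f xi).

(* Where the derivative does not exist, derive1 has an irrelevant default value;
   for the functions under consideration this is a null set of tau. *)
Definition caputo (alpha : R) (x : R -> 'rV[R]_n) (tau : R) : 'rV[R]_n :=
  (Gamma (1 - alpha))^-1 *:
    derive1 (fun s => vintegral `[0, s]
       (fun xi => ((s - xi) `^ alpha)^-1 *: (x xi - x 0))) tau.

Definition ess_bounded_measurable (T : R) (f : R -> 'rV[R]_n) : Prop :=
  (forall i, measurable_fun `[0, T] (fun xi => f xi 0 i)) /\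
  exists M : R, {ae mu, forall xi, xi \in `[0, T] -> enorm (f xi) <= M}.

End fractional_calculus.

(* Functions on [0, T] are represented by functions on R vanishing outside
   [0, T], so that Leibniz equality is equality on [0, T]. *)
Record ACa (R : realType) (n : nat) (T alpha : R) := MkACa {
  ACa_val :> R -> 'rV[R]_n ;
  ACa_repr : exists2 f : R -> 'rV[R]_n, ess_bounded_measurable T f &
    forall tau, tau \in `[0, T] ->
      ACa_val tau = ACa_val 0 + frac_integral alpha tau tau f ;
  ACa_out : forall tau, tau \notin `[0, T] -> ACa_val tau = 0
}.

Section uniform_metric.
Context {R : realType} {n : nat} {T alpha : R}.
Local Notation AC := (ACa n T alpha).
Implicit Types x y z : AC.

HB.instance Definition _ := gen_eqMixin AC.
HB.instance Definition _ := gen_choiceMixin AC.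

(* The uniform distance; it is finite since elements of AC^alpha are bounded. *)
Definition unif_dist x y : \bar R :=
  ereal_sup [set (enorm (x tau - y tau))%:E | tau in `[0, T]].

Definition unif_ball x (e : R) : set AC := [set y | (unif_dist x y < e%:E)%E].

Lemma unif_ball_center x (e : R) : 0 < e -> unif_ball x e x.
Proof.
move=> e0; apply: (@le_lt_trans _ _ 0%E); last by rewrite lte_fin.
by apply: ge_ereal_sup => _ [t _ <-]; rewrite subrr enorm0.
Qed.

Lemma unif_ball_sym x y (e : R) : unif_ball x e y -> unif_ball y e x.
Proof.
suff -> : unif_ball y e x = unif_ball x e y by [].
rewrite /unif_ball /= /unif_dist; congr (ereal_sup _ < _)%E.
by apply: eq_imagel => t _ /=; congr (_%:E); rewrite -[RHS]enormN opprB.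
Qed.

Lemma unif_ball_triangle x y z (e1 e2 : R) :
  unif_ball x e1 y -> unif_ball y e2 z -> unif_ball x (e1 + e2) z.
Proof.
rewrite /unif_ball /= => xy yz; have [T0|T0] := leP 0 T; last first.
  suff -> : unif_dist x z = -oo%E by rewrite ltNyr.
  apply/eqP; rewrite -leeNy_eq; apply: ge_ereal_sup => _ [t tI <-].
  move: tI; rewrite /= in_itv /= => /andP[t0 tT].
  by have := le_lt_trans (le_trans t0 tT) T0; rewrite ltxx.
have ge u v : (0 <= unif_dist u v)%E.
  apply: (@le_trans _ _ (enorm (u 0 - v 0))%:E); first by rewrite lee_fin enorm_ge0.
  by apply: ereal_sup_ubound; exists 0 => //=; rewrite in_itv /= lexx T0.
apply: (@le_lt_trans _ _ (unif_dist x y + unif_dist y z)%E); last first.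
  by rewrite EFinD lteD.
apply: ge_ereal_sup => _ [t tT <-].
apply: (@le_trans _ _ ((enorm (x t - y t))%:E + (enorm (y t - z t))%:E)%E).
  by rewrite -EFinD lee_fin -(subrK (y t) (x t)) -addrA (le_trans (enormD _ _))// subrK.
by apply: leeD; apply: ereal_sup_ubound; exists t.
Qed.

Let ent : set_system (AC * AC) := entourage_ unif_ball.

HB.instance Definition _ := hasNbhs.Build AC (nbhs_ ent).
HB.instance Definition _ := @Nbhs_isPseudoMetric.Build R AC
  ent erefl unif_ball unif_ball_center unif_ball_sym unif_ball_triangle erefl.

End uniform_metric.

Section path_dependent_HJ.
Context {R : realType} {n : nat} {T alpha : R}.
Local Notation mu := (@lebesgue_measure R).
Local Notation V := 'rV[R]_n.
Local Notation AC := (ACa n T alpha).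

(* A functional on [0, T] x AC^alpha (or on [0, T[ x AC^alpha) is a function of
   type R -> AC -> _; its values for other times are never used. *)

Definition continuous_upto {W : topologicalType} (I : set R)
    (phi : R -> AC -> W) : Prop :=
  {within I `*` [set: AC], continuous (fun p : R * AC => phi p.1 p.2)}.

Definition Y (t : R) (x : AC) : set AC :=
  [set y | forall tau, tau \in `[0, t] -> y tau = x tau].

(* p and q are the ci-derivatives of order alpha of phi at (t, x); they are
   unique when 0 <= t < T. *)
Definition is_ci_derivative (phi : R -> AC -> R) (t : R) (x : AC)
    (p : R) (q : V) : Prop :=
  forall y, Y t x y ->
    exists2 o : R -> R, o delta / delta @[delta --> 0^'+] --> 0 &
      forall tau, tau \in `]t, T[ ->
        phi tau y - phi t x =
          p * (tau - t)
          + \int[mu]_(xi in `[t, tau]) dotv q (caputo alpha y xi)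
          + o (tau - t).

Definition ci_smooth (psi : R -> AC -> R) (dpsi : R -> AC -> R)
    (gpsi : R -> AC -> V) : Prop :=
  [/\ continuous_upto `[0, T] psi,
      forall t x, t \in `[0, T[ ->
        is_ci_derivative psi t x (dpsi t x) (gpsi t x),
      continuous_upto `[0, T[ dpsi &
      continuous_upto `[0, T[ gpsi].

Definition afun (t : R) (x : AC) (tau : R) : V :=
  if tau <= t then x tau
  else x 0 + frac_integral alpha t tau (caputo alpha x).

Definition condL (phi : R -> AC -> R) : Prop :=
  forall X : set AC, compact X ->
    exists2 Lambda : R, 0 < Lambda &
      forall t x y, t \in `[0, T] -> X x -> X y ->
        `|phi t x - phi t y| <= Lambda *
          (enorm (afun t x T - afun t y T)
           + \int[mu]_(tau in `[0, T])
               (enorm (afun t x tau - afun t y tau) / (T - tau) `^ (1 - alpha))).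

Definition Xset (c : R) (k : nat) : set AC :=
  [set x | enorm (x 0) <= k%:R /\
    {ae mu, forall tau, tau \in `[0, T] ->
      enorm (caputo alpha x tau) <= k%:R * c * (1 + enorm (x tau))}].

Definition attains_min (f : R -> AC -> R) (X : set AC) (t : R) (x : AC) : Prop :=
  [/\ t \in `[0, T], X x &
      forall s y, s \in `[0, T] -> X y -> f t x <= f s y].

Definition attains_max (f : R -> AC -> R) (X : set AC) (t : R) (x : AC) : Prop :=
  [/\ t \in `[0, T], X x &
      forall s y, s \in `[0, T] -> X y -> f s y <= f t x].

(* The index k ranges over the positive integers. *)
Definition viscosity_solution (c : R) (H : R -> V -> V -> R) (sigma : AC -> R)
    (phi : R -> AC -> R) : Prop :=
  [/\ continuous_upto `[0, T] phi,
      condL phi,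
      forall x, phi T x = sigma x &
      forall psi dpsi gpsi, ci_smooth psi dpsi gpsi ->
      forall k, (0 < k)%N ->
      forall t x, t \in `[0, T[ ->
        (attains_min (fun s y => phi s y - psi s y) (Xset c k) t x ->
           dpsi t x + H t (x t) (gpsi t x) <= 0) /\
        (attains_max (fun s y => phi s y - psi s y) (Xset c k) t x ->
           0 <= dpsi t x + H t (x t) (gpsi t x))].

End path_dependent_HJ.

(* Main.v *)
From HB Require Import structures.
Require Import Defs.
From mathcomp Require Import all_boot all_order all_algebra.
From mathcomp Require Import all_classical all_reals all_analysis.
From mathcomp Require Import measurable_realfun simple_functions lebesgue_integral_definition.
From mathcomp Require Import ring lra.

(** Uniqueness follows from a comparison principle: if two viscosity solutions phi1 and phi2 share
    their terminal values, then phi1 <= phi2; exchanging the two gives equality. The proof doubles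
    the variables, with a penalty modelled on condition (L).

    Suppose that phi1 exceeds phi2 at (t0, x0). The path x0 lies in some X_k, which is compact
    ([compact_Xset]) and stable under stopping, that is, under continuing a path after a time t
    with zero fractional derivative ([stop_Xset]). Over times t, tau and paths x, y in X_k, maximise
      phi1 (t, x) - phi2 (tau, y) - L nu (x_t - y_tau) - (t - tau)^2 / rho - lam (T - t),
    where x_t and y_tau are the stopped paths and nu is the norm on the right-hand side of (L), with
    each absolute value |r| smoothed to sqrt (e^2 + r^2). The coefficient L of the penalty is
    fixed, and this is the main point: take L = Lambda + 1, where Lambda is the constant of (L) for
    phi2 on X_k. Condition (L) says that phi2 is Lipschitz with constant Lambda for nu. So at a
    maximum the penalty exceeds, by nu (x_t - y_tau), what moving from x_t to y_tau can bring, and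
    nu (x_t - y_tau) tends to zero with e and rho ([doubling_concentration]). As the paths of X_k
    are equi-Hoelder, smallness of this weighted L^1 norm makes x_t and y_tau uniformly close
    ([pairing_small]). Equality at time T keeps the maximum away from T.

    With one point frozen, the penalty is a ci-smooth functional of the other one
    ([ci_smooth_test]). Indeed, extending a path from t to tau with density f adds to the stopped
    path the fractional integral of f over [t, tau], and by Fubini the first variation of the
    penalty is the integral of f against a function [slope] of time, obtained by applying the
    adjoint of the fractional integral to a function bounded by one. These slopes are bounded
    and equicontinuous in time away from T, uniformly over all such functions ([slope_unif]).
    Therefore the two test gradients stay in a fixed bounded set and become close to each other
    together with t and tau. Subtracting the two viscosity inequalities and using the uniform
    continuity of H on compact sets contradicts lam > 0 ([comparison]).

    Two facts about fractional integrals support this. First, stopping is Lipschitz in the uniform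
    norm: a homographic substitution in the Beta integral ([integral_moebius]) shows that a
    function with zero fractional derivative after t is there an average of its past, with a kernel
    of mass at most one ([kconv_upto_le]). Second, X_k is compact. Its paths are bounded by a
    Gronwall estimate ([Xset_bound]), hence have uniformly bounded densities and are equi-Hoelder.
    Along an ultrafilter on X_k the paths converge uniformly, and the densities f converge as set
    functions A |-> int_A f; the limit set function is dominated by the Lebesgue measure and so has
    a bounded density ([bounded_density]), which is the Caputo derivative of the limit path
    ([frac_inversion]) and satisfies the constraint of X_k by convexity. *)

Set Implicit Arguments.
Unset Strict Implicit.
Unset Printing Implicit Defensive.

Import Order.TTheory GRing.Theory Num.Theory.
Import numFieldNormedType.Exports.

Local Open Scope classical_set_scope.
Local Open Scope ring_scope.

(** * Integrals up to null sets *)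

Section integral_ae.
Context d (T : measurableType d) (R : realType).
Variable mu : {measure set T -> \bar R}.
Import HBNNSimple.
Local Open Scope ereal_scope.

Let nnintegral (f : T -> \bar R) := ereal_sup [set sintegral mu h
  | h in [set h : {nnsfun T >-> R} | forall x, (h x)%:E <= f x]].

(** The integral of a nonnegative function is a supremum over the simple functions below it;
    cutting such a simple function off on a null set changes neither its integral nor its
    membership below a function modified on that set. No measurability is involved. This
    matters because the Caputo derivative is known only almost everywhere, and nothing says
    that it is measurable. *)
Lemma le_nnintegral_ae (f g : T -> \bar R) (N : set T) :
  (forall x, 0 <= g x) -> measurable N -> mu N = 0 ->
  (forall x, ~ N x -> f x <= g x) -> nnintegral f <= nnintegral g.
Proof.
move=> g0 mN N0 fg; apply: ge_ereal_sup => _ [h /= hf <-].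
have mCN : measurable (~` N) by exact: measurableC.
apply: ereal_sup_ubound; exists (proj_nnsfun h mCN) => /=.
  move=> x; rewrite mindicE; have [xN|xN] := boolP (x \in ~` N).
    by rewrite mulr1; apply: (le_trans (hf x)); apply: fg; move: xN; rewrite inE.
  by rewrite mulr0.
rewrite -!integralT_nnsfun; apply: ge0_ae_eq_integral => //.
- exact/measurable_EFinP.
- exact/measurable_EFinP.
- by move=> x _; rewrite lee_fin; exact: fun_ge0.
- by move=> x _; rewrite lee_fin; exact: fun_ge0.
exists N; split => // x /= /not_implyP[_ hx]; apply: contrapT => xN; apply: hx.
by rewrite mindicE mem_set// mulr1.
Qed.

Lemma nnintegral_ae (f g : T -> \bar R) (N : set T) :
  (forall x, 0 <= f x) -> (forall x, 0 <= g x) -> measurable N -> mu N = 0 ->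
  (forall x, ~ N x -> f x = g x) -> nnintegral f = nnintegral g.
Proof.
move=> f0 g0 mN N0 fg; apply/eqP; rewrite eq_le.
by rewrite !(@le_nnintegral_ae _ _ N)// => x xN; rewrite fg.
Qed.

Lemma integral_ae (D E : set T) (f g : T -> \bar R) (N : set T) :
  measurable N -> mu N = 0 ->
  (forall x, ~ N x -> (f \_ D) x = (g \_ E) x) ->
  \int[mu]_(x in D) f x = \int[mu]_(x in E) g x.
Proof.
move=> mN N0 fg; rewrite /integral.
by congr (_ - _); apply: (@nnintegral_ae _ _ N) => // x xN;
  rewrite ?funeposE ?funenegE fg.
Qed.

Lemma ge0_le_integral_gen (D : set T) (f g : T -> \bar R) :
  (forall x, D x -> 0 <= f x) -> (forall x, D x -> f x <= g x) ->
  \int[mu]_(x in D) f x <= \int[mu]_(x in D) g x.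
Proof.
move=> f0 fg; have g0 x : D x -> 0 <= g x by move=> Dx; rewrite (le_trans (f0 _ Dx))// fg.
rewrite ge0_integralE// ge0_integralE//; apply: (@le_nnintegral_ae _ _ set0) => //.
  by move=> x; rewrite patchE; case: ifPn => // /set_mem; exact: g0.
by move=> x _; rewrite !patchE; case: ifPn => // /set_mem; exact: fg.
Qed.

End integral_ae.

Section lebesgue_basic.
Context {R : realType}.
Local Notation mu := (@lebesgue_measure R).

Lemma integral_off2 (D E : set R) (f g : R -> \bar R) (c d : R) :
  (forall x, x != c -> x != d -> (f \_ D) x = (g \_ E) x) ->
  (\int[mu]_(x in D) f x = \int[mu]_(x in E) g x)%E.
Proof.
move=> fg; apply: (@integral_ae _ (measurableTypeR R) R mu D E f g [set c; d]).
- by apply: measurableU; exact: measurable_set1.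
- apply: countable_lebesgue_measure0; apply: finite_set_countable; exact: finite_set2.
- by move=> x /not_orP[/eqP xc /eqP xd]; exact: fg.
Qed.

Lemma ge0_integral_refl (g : R -> \bar R) (tau : R) :
  measurable_fun setT g -> (forall x, 0 <= g x)%E ->
  (\int[mu]_s g (tau - s)%R = \int[mu]_s g s)%E.
Proof.
move=> mg g0.
have mphi : measurable_fun [set: measurableTypeR R]
    (fun s : measurableTypeR R => (tau - s : measurableTypeR R)).
  have : measurable_fun [set: R] (fun s : R => tau - s).
    by apply: measurable_funB => //; exact: measurable_id.
  exact.
pose nu : {measure set (measurableTypeR R) -> \bar R} :=
  measure_function_pushforward__canonical__measure_function_Measure mu mphi.
have muE (A : set (measurableTypeR R)) : measurable A -> mu A = nu A.
  move=> mA; apply: lebesgue_measure_unique => //.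
  move=> X /ocitvP[->|[[x y] /= xy ->]]; first by rewrite !measure0.
  rewrite /nu/= /pushforward.
  have -> : (fun s : R => tau - s) @^-1` `]x, y]%classic = `[tau - y, tau - x[%classic.
    by apply/seteqP; split => s; rewrite /preimage/= !in_itv/= => /andP[? ?]; apply/andP; split; lra.
  rewrite !lebesgue_measure_itv/= !lte_fin xy ltrD2l ltrN2 xy -!EFinB; congr EFin; lra.
rewrite [RHS](@eq_measure_integral _ _ _ _ nu).
  by rewrite ge0_integral_pushforward// preimage_setT.
by move=> A mA _; exact: muE.
Qed.

Lemma ge0_integral_shift (g : R -> \bar R) (r : R) :
  measurable_fun setT g -> (forall x, 0 <= g x)%E ->
  (\int[mu]_s g (s - r)%R = \int[mu]_s g s)%E.
Proof.
move=> mg g0; rewrite -[RHS](ge0_integral_refl (- r)) //.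
rewrite -[LHS](@ge0_integral_refl _ 0)//.
  by apply: eq_integral => s _; congr g; rewrite sub0r addrC.
by apply: measurableT_comp => //; apply: measurable_funB.
Qed.

End lebesgue_basic.

(** * Change of variables *)

Section substitution.
Context {R : realType}.
Local Notation mu := (@lebesgue_measure R).

(** On each compact interval the change of variables is classical; monotone convergence
    along an exhaustion then covers integrands that blow up at the end points, as the power
    kernels do. *)
Lemma ge0_substitution (F f G : R -> R) (a b : nat -> R) (A B : set R) :
  (forall n, a n < b n) ->
  {homo a : m n / (m <= n)%N >-> n <= m} -> {homo b : m n / (m <= n)%N >-> m <= n} ->
  A = \bigcup_n `[a n, b n]%classic -> B = \bigcup_n `[F (a n), F (b n)]%classic ->
  open A ->
  (forall x y, A x -> A y -> x < y -> F x < F y) ->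
  (forall x, A x -> is_derive x 1 F (f x)) ->
  (forall x, A x -> {for x, continuous f}) ->
  (forall x, A x -> 0 <= f x) ->
  (forall x, A x -> {for F x, continuous G}) ->
  (forall x, A x -> 0 <= G (F x)) ->
  (\int[mu]_(x in B) (G x)%:E = \int[mu]_(x in A) (G (F x) * f x)%:E)%E.
Proof.
move=> ab na nb AE BE oA Fi dF cf f0 cG G0.
have aA n x : x \in `[a n, b n] -> A x by move=> xn; rewrite AE; exists n.
have dFE x : A x -> (F^`())%classic x = f x.
  by move=> Ax; rewrite derive1E; have [] := dF _ Ax.
have cF' x : A x -> {for x, continuous (F^`())%classic}.
  move=> Ax; have := cf _ Ax.
  rewrite /prop_for /continuous_at dFE//; apply: cvg_trans.
  apply: near_eq_cvg; have : nbhs x A by exact: open_nbhs_nbhs.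
  by apply: filterS => y Ay; rewrite dFE.
have cFx x : A x -> {for x, continuous F}.
  by move=> Ax; apply/differentiable_continuous/derivable1_diffP; have [] := dF _ Ax.
have Fim n x : x \in `[F (a n), F (b n)] -> exists2 z, A z & F z = x.
  move=> xF; have FF : F (a n) <= F (b n).
    by apply/ltW/Fi => //; apply: (aA n); rewrite in_itv/= lexx ltW.
  have FC : {within `[a n, b n], continuous F}.
    apply: continuous_in_subspaceT => z /set_mem zab; apply: cFx; exact: (aA n).
  have [|z zab <-] := IVT (ltW (ab n)) FC (v := x); last by exists z => //; exact: (aA n).
  by rewrite (min_idPl FF) (max_idPr FF); move: xF; rewrite in_itv/=.
have step n : (\int[mu]_(x in `[F (a n), F (b n)]) (G x)%:E =
   \int[mu]_(x in `[a n, b n]) (G (F x) * f x)%:E)%E.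
  have An : A (a n) by apply: (aA n); rewrite in_itv/= lexx ltW.
  have Bn : A (b n) by apply: (aA n); rewrite in_itv/= lexx ltW.
  rewrite (@integration_by_substitution_increasing _ F G _ _ (ltW (ab n))).
  - apply: eq_integral => x; rewrite inE/= => xab; rewrite [in LHS]/= -dFE//; exact: (aA n).
  - by move=> x y xab yab; apply: Fi; apply: (aA n).
  - move=> x xab; apply: cF'; apply: (aA n); exact: subset_itv_oo_cc.
  - by apply/cvg_ex; exists ((F^`())%classic (a n)); apply/cvg_at_right_filter/cF'.
  - by apply/cvg_ex; exists ((F^`())%classic (b n)); apply/cvg_at_left_filter/cF'.
  - split.
    + move=> x xab; have [|//] := dF x _; apply: (aA n); exact: subset_itv_oo_cc.
    + by apply/cvg_at_right_filter/cFx.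
    + by apply/cvg_at_left_filter/cFx.
  - apply: continuous_in_subspaceT => x /set_mem /Fim[z Az <-]; exact: cG.
have nA : nondecreasing_seq (fun n => `[a n, b n]%classic : set R).
  move=> m n mn; apply/subsetPset => x /=; rewrite !in_itv/= => /andP[ax xb].
  by rewrite (le_trans (na _ _ mn)) ?(le_trans xb)// nb.
have nB : nondecreasing_seq (fun n => `[F (a n), F (b n)]%classic : set R).
  have hom x y : A x -> A y -> x <= y -> F x <= F y.
    by move=> Ax Ay; rewrite le_eqVlt => /predU1P[->//|xy]; exact/ltW/Fi.
  move=> m n mn; apply/subsetPset => x /=; rewrite !in_itv/= => /andP[ax xb].
  rewrite (le_trans _ ax) ?(le_trans xb)//; apply: hom; rewrite ?na ?nb//.
  - by apply: (aA m); rewrite in_itv/= lexx ltW.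
  - by apply: (aA n); rewrite in_itv/= lexx ltW.
  - by apply: (aA n); rewrite in_itv/= lexx ltW.
  - by apply: (aA m); rewrite in_itv/= lexx ltW.
have cvA : (\int[mu]_(x in `[a n, b n]) (G (F x) * f x)%:E @[n --> \oo] -->
    \int[mu]_(x in A) (G (F x) * f x)%:E)%E.
  rewrite AE; apply: ge0_nondecreasing_set_cvg_integral => //.
  - move=> n; apply/measurable_EFinP; apply: subspace_continuous_measurable_fun => //.
    apply: continuous_in_subspaceT => x /set_mem xn; have Ax := aA n x xn.
    by apply: continuousM; [apply: continuous_comp; [exact: cFx|exact: cG]|exact: cf].
  - by move=> n x xn; have Ax := aA n x xn; rewrite lee_fin mulr_ge0 ?G0 ?f0.
have cvB : (\int[mu]_(x in `[F (a n), F (b n)]) (G x)%:E @[n --> \oo] -->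
    \int[mu]_(x in B) (G x)%:E)%E.
  rewrite BE; apply: ge0_nondecreasing_set_cvg_integral => //.
  - move=> n; apply/measurable_EFinP; apply: subspace_continuous_measurable_fun => //.
    by apply: continuous_in_subspaceT => x /set_mem /Fim[z Az <-]; exact: cG.
  - by move=> n x /Fim[z Az <-]; rewrite lee_fin G0.
rewrite -(cvg_lim _ cvA)// -(cvg_lim _ cvB)//.
by congr (limn _); apply/funext => n; exact: step.
Qed.

Lemma itvoo_bigcup (c d : R) : c < d ->
  `]c, d[%classic = \bigcup_n `[c + (d - c) / n.+3%:R, d - (d - c) / n.+3%:R]%classic.
Proof.
move=> cd; have dc : 0 < d - c by rewrite subr_gt0.
apply/seteqP; split => [x /=|x [n _]] /=; rewrite !in_itv/=.
  move=> /andP[cx xd]; pose e := Num.min (x - c) (d - x).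
  have e0 : 0 < e by rewrite lt_min !subr_gt0 cx.
  have [n nP] : exists n : nat, (d - c) / n.+3%:R <= e.
    have /archi_boundP := ltW (divr_gt0 dc e0).
    set n := Num.bound _ => nP; exists n.
    rewrite ler_pdivrMr// mulrC -ler_pdivrMr// (le_trans (ltW nP))// ler_nat.
    by rewrite -addn3 leq_addr.
  exists n => //=; rewrite in_itv/=.
  move: nP; rewrite le_min; move: (_ / _) => q /andP[n1 n2].
  by apply/andP; split; lra.
have : 0 < (d - c) / n.+3%:R by rewrite divr_gt0.
move: (_ / _) => q q0 /andP[cx xd]; apply/andP; split; lra.
Qed.

Lemma itvoo_exhaust (c d : R) : c < d ->
 [/\ forall n, c + (d - c) / n.+3%:R < d - (d - c) / n.+3%:R,
   {homo (fun n => c + (d - c) / n.+3%:R) : m n / (m <= n)%N >-> n <= m} &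
   {homo (fun n => d - (d - c) / n.+3%:R) : m n / (m <= n)%N >-> m <= n} ].
Proof.
move=> cd; have dc : 0 < d - c by rewrite subr_gt0.
split.
- move=> n; suff : (d - c) / n.+3%:R < (d - c) / 2 by move: (_ / _.+3%:R) => q; lra.
  by rewrite ltr_pM2l// ltf_pV2 ?posrE// ltr_nat.
- by move=> m n mn; rewrite lerD2l ler_pM2l// lef_pV2 ?posrE// ler_nat.
- by move=> m n mn; rewrite lerD2l lerN2 ler_pM2l// lef_pV2 ?posrE// ler_nat.
Qed.

Lemma ge0_substitution_oo (F f G : R -> R) (c d c' d' : R) :
  c < d -> 
  (forall x y, c < x -> y < d -> x < y -> F x < F y) ->
  (forall x, c < x < d -> c' < F x < d') ->
  F x @[x --> c^'+] --> c' -> F x @[x --> d^'-] --> d' ->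
  (forall x, c < x < d -> is_derive x 1 F (f x)) ->
  (forall x, c < x < d -> {for x, continuous f}) ->
  (forall x, c < x < d -> 0 <= f x) ->
  (forall x, c' < x < d' -> {for x, continuous G}) ->
  (forall x, c' < x < d' -> 0 <= G x) ->
  (\int[mu]_(x in `]c', d'[) (G x)%:E = \int[mu]_(x in `]c, d[) (G (F x) * f x)%:E)%E.
Proof.
move=> cd Fi Fr Fc Fd dF cf f0 cG G0.
have [ab na nb] := itvoo_exhaust cd.
have dc : 0 < d - c by rewrite subr_gt0.
have AP x : `]c, d[%classic x -> c < x < d by rewrite /= in_itv.
have sub n x : x \in `[c + (d - c) / n.+3%:R, d - (d - c) / n.+3%:R] -> c < x < d.
  move=> xn; apply/AP; rewrite itvoo_bigcup//; by exists n.
pose a n := c + (d - c) / n.+3%:R; pose b n := d - (d - c) / n.+3%:R.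
have aP n : c < a n < d by apply: (sub n); rewrite in_itv/= lexx ltW// ab.
have bP n : c < b n < d by apply: (sub n); rewrite in_itv/= lexx ltW// ab.
apply: (@ge0_substitution F f G a b) => //.
- exact: itvoo_bigcup.
- apply/seteqP; split => [y|y [n _]] /=; rewrite !in_itv/= => /andP[cy yd].
    have [r1 [/andP[c1 d1] F1]] : exists x, c < x < d /\ F x < y.
      (* F takes values below y near c, by its limit there; similarly above y near d *)
      have /= := cvgr_lt _ Fc _ cy.
      move=> [e /= e0 h]; pose z := c + Num.min (e / 2) ((d - c) / 2).
      have m0 : 0 < Num.min (e / 2) ((d - c) / 2) by rewrite lt_min !divr_gt0.
      have m1 : Num.min (e / 2) ((d - c) / 2) <= e / 2 by rewrite ge_min lexx.
      have m2 : Num.min (e / 2) ((d - c) / 2) <= (d - c) / 2 by rewrite ge_min lexx orbT.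
      exists z; split; first by apply/andP; split; rewrite /z; lra.
      apply: h; last by rewrite /z; lra.
      rewrite /z /ball_/= opprD addrA subrr sub0r normrN gtr0_norm//; lra.
    have [r2 [/andP[c2 d2] F2]] : exists x, c < x < d /\ y < F x.
      have /= := cvgr_gt _ Fd _ yd.
      move=> [e /= e0 h]; pose z := d - Num.min (e / 2) ((d - c) / 2).
      have m0 : 0 < Num.min (e / 2) ((d - c) / 2) by rewrite lt_min !divr_gt0.
      have m1 : Num.min (e / 2) ((d - c) / 2) <= e / 2 by rewrite ge_min lexx.
      have m2 : Num.min (e / 2) ((d - c) / 2) <= (d - c) / 2 by rewrite ge_min lexx orbT.
      exists z; split; first by apply/andP; split; rewrite /z; lra.
      apply: h; last by rewrite /z; lra.
      rewrite /z /ball_/= opprB addrC subrK gtr0_norm//; lra.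
    have [n1 _ /= n1P] : (\bigcup_n `[a n, b n]%classic) r1.
      by rewrite -itvoo_bigcup//= in_itv/= c1.
    have [n2 _ /= n2P] : (\bigcup_n `[a n, b n]%classic) r2.
      by rewrite -itvoo_bigcup//= in_itv/= c2.
    exists (maxn n1 n2) => //=; rewrite in_itv/=.
    move: n1P n2P; rewrite !in_itv/= => /andP[a1 b1] /andP[a2 b2].
    have mono x z : c < x < d -> c < z < d -> x <= z -> F x <= F z.
      move=> /andP[? ?] /andP[? ?]; rewrite le_eqVlt => /predU1P[->//|xz].
      exact/ltW/Fi.
    apply/andP; split.
      apply: (le_trans _ (ltW F1)); apply: mono => //; first by rewrite c1.
      by apply: le_trans a1; rewrite na// leq_maxl.
    apply: (le_trans (ltW F2)); apply: mono => //; first by rewrite c2.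
    by apply: (le_trans b2); rewrite nb// leq_maxr.
  have := Fr (a n) (aP n); have := Fr (b n) (bP n).
  by move=> /andP[_ ?] /andP[? _]; apply/andP; split; lra.
- by move=> x y /AP/andP[? _] /AP/andP[_ ?]; exact: Fi.
- by move=> x /AP/Fr; exact: cG.
- by move=> x /AP/Fr; exact: G0.
Qed.

End substitution.

(** * Power kernels *)

Section kernel.
Context {R : realType}.
Local Notation mu := (@lebesgue_measure R).
Implicit Types (a b u : R).

(** The Riemann-Liouville kernel, extended by zero so that a convolution over [0, tau]
    becomes an integral over the whole of [0, T]. *)
Definition ker a u : R := if 0 < u then u `^ (a - 1) else 0.

Definition kerprim a u : R := if 0 < u then u `^ a / a else 0.

Lemma ker_ge0 a u : 0 <= ker a u.
Proof. by rewrite /ker; case: ifP => // _; exact: powR_ge0. Qed.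

Lemma ker_le0 a u : u <= 0 -> ker a u = 0.
Proof. by rewrite leNgt /ker => /negbTE ->. Qed.

Lemma ker_gt0 a u : 0 < u -> ker a u = u `^ (a - 1).
Proof. by rewrite /ker => ->. Qed.

Lemma measurable_ker a : measurable_fun setT (ker a).
Proof.
by apply: measurable_fun_ifT => //; apply: measurable_fun_ltr.
Qed.

Lemma kerprim_ge0 a u : 0 < a -> 0 <= kerprim a u.
Proof.
by move=> a0; rewrite /kerprim; case: ifP => // _; rewrite divr_ge0 ?powR_ge0// ltW.
Qed.

Lemma kerprim_le0 a u : u <= 0 -> kerprim a u = 0.
Proof. by rewrite leNgt /kerprim => /negbTE ->. Qed.

Lemma kerprim_ge a u : 0 < a -> 0 <= u -> kerprim a u = u `^ a / a.
Proof.
move=> a0; rewrite le_eqVlt /kerprim => /predU1P[<-|->//].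
by rewrite ltxx powR0 ?mul0r// gt_eqF.
Qed.

Lemma le_kerprim a : 0 < a -> {homo kerprim a : u v / u <= v}.
Proof.
move=> a0 u v uv; have [u0|u0] := leP u 0; first by rewrite (kerprim_le0 _ u0) kerprim_ge0.
have v0 := lt_le_trans u0 uv.
rewrite (kerprim_ge _ (ltW u0))// (kerprim_ge _ (ltW v0))// ler_pM2r ?invr_gt0//.
by rewrite ge0_ler_powR// ?nnegrE ltW.
Qed.

Lemma is_derive_powR_div a u : 0 < a -> 0 < u ->
  is_derive u 1 (fun v => v `^ a / a) (u `^ (a - 1)).
Proof.
move=> a0 u0; have := is_derive1_powR a u0 => h.
have := @is_deriveZ _ _ _ _ a^-1 _ _ _ h.
rewrite /GRing.scale/= mulrA mulVf ?gt_eqF// mul1r.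
by congr (is_derive _ _ _ _); apply/funext => v /=; rewrite mulrC.
Qed.

Lemma continuous_powR_pos a u : 0 < u -> {for u, continuous (fun v : R => v `^ a)}.
Proof.
move=> u0; apply/differentiable_continuous/derivable1_diffP.
by have [] := is_derive1_powR a u0.
Qed.

Lemma kerprim_small a (e : R) : 0 < a -> 0 < e ->
  exists2 dl : R, 0 < dl & forall u, u < dl -> kerprim a u < e.
Proof.
move=> a0 e0; have ea : 0 < e * a by rewrite mulr_gt0.
have /cvgrPdist_lt/(_ _ ea)[dl /= dl0 h] := @powR_cvg0 R _ a0.
exists dl => // u ud; have [u0|u0] := leP u 0; first by rewrite kerprim_le0.
rewrite kerprim_ge ?ltW// ltr_pdivrMr//.
have := h u; rewrite /ball_/= !sub0r !normrN !gtr0_norm// ?powR_gt0//; exact.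
Qed.

Lemma kerprim_small_mul a (Q e : R) : 0 < a -> 0 <= Q -> 0 < e ->
  exists2 dl : R, 0 < dl & forall u, u < dl -> Q * kerprim a u <= e.
Proof.
move=> a0 Q0 e0; have Q1 : 0 < Q + 1 by rewrite ltr_wpDl.
have [dl dl0 h] := kerprim_small a0 (divr_gt0 e0 Q1).
exists dl => // u /h; rewrite ltr_pdivlMr// => /ltW; apply: le_trans.
by rewrite mulrC ler_wpM2l ?kerprim_ge0// lerDl.
Qed.

Lemma ger_ratio (e q : R) : 0 <= e -> 0 <= q -> e * (q / (q + 1)) <= e.
Proof. by move=> e0 q0; rewrite ler_piMr// ler_pdivrMr ?ltr_wpDl// mul1r lerDl. Qed.

(** Concavity of u^a in disguise: each of u and v is at most u + v, and the power a - 1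
    reverses the order. *)
Lemma kerprim_subadd a u v : 0 < a <= 1 -> 0 <= u -> 0 <= v ->
  kerprim a (u + v) <= kerprim a u + kerprim a v.
Proof.
move=> /andP[a0 a1]; rewrite le_eqVlt => /predU1P[<-|u0].
  by rewrite add0r lerDr kerprim_ge0.
rewrite le_eqVlt => /predU1P[<-|v0]; first by rewrite addr0 lerDl kerprim_ge0.
have uv0 : 0 < u + v by rewrite addr_gt0.
rewrite (kerprim_ge _ (ltW u0))// (kerprim_ge _ (ltW v0))// (kerprim_ge _ (ltW uv0))//.
rewrite -mulrDl ler_pM2r ?invr_gt0//.
have h (x : R) : 0 < x -> x <= u + v -> x * (u + v) `^ (a - 1) <= x `^ a.
  move=> x0 xuv; rewrite -(mulr_powRB1 (ltW x0) a0) ler_pM2l//.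
  rewrite -(opprB 1 a) !powRN lef_pV2 ?posrE ?powR_gt0//.
  by rewrite ge0_ler_powR ?nnegrE ?subr_ge0// ltW.
rewrite -(mulr_powRB1 (ltW uv0) a0) mulrDl; apply: lerD.
  by apply: h => //; rewrite lerDl ltW.
by apply: h => //; rewrite lerDr ltW.
Qed.

(** This is the source of all moduli of continuity below: fractional integrals of bounded
    functions are Hoelder continuous with modulus [kerprim]. *)
Lemma kerprim_hoelder a u v : 0 < a <= 1 ->
  `|kerprim a u - kerprim a v| <= kerprim a `|u - v|.
Proof.
move=> a01; wlog uv : u v / u <= v.
  move=> h; have [/h//|/ltW/h] := leP u v.
  by rewrite distrC [`|v - u|]distrC.
have a0 : 0 < a by case/andP: a01.
rewrite distrC ger0_norm ?subr_ge0 ?le_kerprim// distrC ger0_norm ?subr_ge0//.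
have [u0|/ltW u0] := leP u 0.
  rewrite (kerprim_le0 _ u0) subr0 le_kerprim//; lra.
rewrite lerBlDl -{1}(subrK u v) addrC kerprim_subadd// subr_ge0//.
Qed.

Lemma continuous_kerprim a : 0 < a <= 1 -> continuous (kerprim a).
Proof.
move=> a01 u; have a0 : 0 < a by case/andP: a01.
apply/cvgrPdist_lt => e e0; have [dl dl0 h] := kerprim_small a0 e0.
exists dl => //= v /= uv; apply: le_lt_trans (kerprim_hoelder _ _ a01) _.
exact: h.
Qed.

(** Substitute v = u^a / a, which turns the integrand into the constant one. *)
Lemma integral_ker a (c d : R) : 0 < a <= 1 -> c <= d ->
  (\int[mu]_(u in `[c, d]) (ker a u)%:E = (kerprim a d - kerprim a c)%:E)%E.
Proof.
move=> a01; have a0 : 0 < a by case/andP: a01.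
rewrite le_eqVlt => /predU1P[->|cd].
  by rewrite set_itv1 integral_set1 subrr.
have [d0|d0] := leP d 0.
  rewrite !kerprim_le0 ?subrr//; last by lra.
  apply: integral0_eq => x /=; rewrite in_itv/= => /andP[_ xd].
  by rewrite ker_le0// (le_trans xd).
pose c' := Num.max c 0.
have c'd : c' < d by rewrite gt_max cd d0.
have c'0 : 0 <= c' by rewrite le_max lexx orbT.
have -> : kerprim a c = kerprim a c'.
  by rewrite /c'; have [c0|//] := leP c 0; rewrite !kerprim_le0.
have cpos x : c' < x < d -> 0 < x by move=> /andP[c'x _]; exact: le_lt_trans c'x.
transitivity (\int[mu]_(u in `]c', d[) (1%R * u `^ (a - 1))%:E)%E.
  apply: (@integral_off2 _ _ _ _ _ c d) => x xc xd.
  rewrite !patchE; have [xI|xI] := boolP (x \in `]c', d[%classic).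
    rewrite mem_set; last first.
      move: xI; rewrite inE/= !in_itv/= => /andP[h1 /ltW->]; rewrite andbT.
      by move: h1; rewrite gt_max => /andP[/ltW].
    rewrite mul1r ker_gt0//; apply: cpos.
    by move: xI; rewrite inE/= in_itv/=.
  case: ifPn => // xJ; rewrite ker_le0// leNgt; apply/negP => x0.
  move/negP: xI; apply; move: xJ; rewrite !inE/= !in_itv/= => /andP[cx xd'].
  by rewrite gt_max x0 !lt_neqAle cx xd' (eq_sym c) xc xd.
transitivity (\int[mu]_(x in `]kerprim a c', kerprim a d[) (1%R)%:E)%E; last first.
  rewrite integral_cst//= mul1e.
  rewrite lebesgue_measure_itv/= lte_fin ifT ?EFinB//.
  rewrite (kerprim_ge _ c'0)// (kerprim_ge _ (ltW d0))// ltr_pM2r ?invr_gt0//.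
  by rewrite gt0_ltr_powR// ?nnegrE ltW.
apply/esym; apply: (@ge0_substitution_oo _ (fun u => u `^ a / a) (fun u => u `^ (a - 1)) (cst 1)) => //.
- move=> x y c'x yd xy; rewrite ltr_pM2r ?invr_gt0//.
  by rewrite gt0_ltr_powR// nnegrE; lra.
- move=> x /andP[c'x xd]; rewrite (kerprim_ge _ c'0)// (kerprim_ge _ (ltW d0))//.
  rewrite !ltr_pM2r ?invr_gt0//.
  by rewrite !gt0_ltr_powR// ?nnegrE; lra.
- have := @continuous_kerprim a a01 c' => /cvg_at_right_filter.
  apply: cvg_trans; apply: near_eq_cvg; near=> x.
  by rewrite -/(kerprim a x) kerprim_ge// (le_trans c'0)//; near: x; exact: nbhs_right_ge.
- have := @continuous_kerprim a a01 d => /cvg_at_left_filter.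
  apply: cvg_trans; apply: near_eq_cvg; near=> x.
  rewrite -/(kerprim a x) kerprim_ge// (le_trans c'0)//; apply: ltW; near: x; exact: nbhs_left_gt.
- by move=> x /cpos x0; exact: is_derive_powR_div.
- by move=> x /cpos x0; exact: continuous_powR_pos.
- by move=> x _; exact: powR_ge0.
- by move=> x _; exact: cst_continuous.
Unshelve. all: by end_near. Qed.

Lemma integral_ker_refl a (tau c d : R) : 0 < a <= 1 -> c <= d ->
  (\int[mu]_(s in `[c, d]) (ker a (tau - s))%:E =
   (kerprim a (tau - c) - kerprim a (tau - d))%:E)%E.
Proof.
move=> a01 cd; have cd' : tau - d <= tau - c by rewrite lerD2l lerN2.
rewrite -(integral_ker a01 cd').
rewrite [RHS]integral_mkcond -(@ge0_integral_refl _ _ tau).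
- rewrite integral_mkcond; apply: eq_integral => s _; rewrite !patchE.
  have -> : (tau - s \in `[tau - d, tau - c]%classic) = (s \in `[c, d]%classic).
    by apply/idP/idP; rewrite !inE/= !in_itv/= => /andP[? ?]; apply/andP; split; lra.
  by [].
- apply/(measurable_restrictT (fun x => (ker a x)%:E)) => //.
  apply/measurable_EFinP; apply: (measurable_funS measurableT) => //.
  exact: measurable_ker.
- by move=> x; rewrite patchE; case: ifP => // _; rewrite lee_fin ker_ge0.
Qed.

Lemma integral_ker_shift a (s c d : R) : 0 < a <= 1 -> c <= d ->
  (\int[mu]_(xi in `[c, d]) (ker a (xi - s))%:E =
   (kerprim a (d - s) - kerprim a (c - s))%:E)%E.
Proof.
move=> a01 cd; have cd' : c - s <= d - s by rewrite lerD2r.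
rewrite -(integral_ker a01 cd').
rewrite [RHS]integral_mkcond -(@ge0_integral_shift _ _ s).
- rewrite integral_mkcond; apply: eq_integral => x _; rewrite !patchE.
  have -> : (x - s \in `[c - s, d - s]%classic) = (x \in `[c, d]%classic).
    by apply/idP/idP; rewrite !inE/= !in_itv/= => /andP[? ?]; apply/andP; split; lra.
  by [].
- apply/(measurable_restrictT (fun x => (ker a x)%:E)) => //.
  apply/measurable_EFinP; apply: (measurable_funS measurableT) => //.
  exact: measurable_ker.
- by move=> x; rewrite patchE; case: ifP => // _; rewrite lee_fin ker_ge0.
Qed.

End kernel.

(** * Beta and Gamma integrals *)

Section beta.
Context {R : realType}.
Local Notation mu := (@lebesgue_measure R).
Implicit Types (a b u : R).

Lemma measurable_ker_comp d (X : measurableType d) a (D : set X) (f : X -> R) :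
  measurable_fun D f -> measurable_fun D (fun x => ker a (f x)).
Proof. by move=> mf; apply: measurableT_comp => //; exact: measurable_ker. Qed.

Lemma measurable_ker_refl a (D : set R) (t : R) :
  measurable_fun D (fun s => ker a (t - s)).
Proof. by apply: measurable_ker_comp; apply: measurable_funB. Qed.

Lemma measurable_ker_shift a (D : set R) (r : R) :
  measurable_fun D (fun s => ker a (s - r)).
Proof. by apply: measurable_ker_comp; apply: measurable_funB. Qed.

Lemma integral_zero_outside (D : set R) (f : R -> \bar R) :
  (forall x, ~ D x -> f x = 0%E) -> (\int[mu]_(x in D) f x = \int[mu]_x f x)%E.
Proof.
move=> f0; rewrite integral_mkcond; apply: eq_integral => x _.
rewrite patchE; case: ifPn => // /negP xD; rewrite f0// => Dx; apply: xD.
exact/mem_set.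
Qed.

Lemma powRB1E a u : 0 < u -> u `^ (a - 1) = u `^ a / u.
Proof. by move=> u0; rewrite powRB ?(gt_eqF u0) ?implybT// powRr1// ltW. Qed.

Lemma powR_le2 b u : 0 < b <= 1 -> 2^-1 <= u <= 1 -> u `^ (b - 1) <= 2.
Proof.
move=> /andP[b0 b1] /andP[u2 u1]; have u0 : 0 < u by apply: lt_le_trans u2.
rewrite -(opprB 1 b) powRN -[leRHS]invrK lef_pV2 ?posrE ?powR_gt0//.
apply: (le_trans u2); apply: ger1_powR; first by rewrite u0.
by rewrite lerBlDr lerDl ltW.
Qed.

Lemma powR_ge1 b u : b <= 1 -> 0 < u <= 1 -> 1 <= u `^ (b - 1).
Proof.
move=> b1 u01; rewrite -[leLHS](powRr0 u); apply: ger_powR => //.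
by rewrite subr_le0.
Qed.

Definition betaE a b : \bar R :=
  \int[mu]_(v in `]0%R, 1%R[) (v `^ (a - 1) * (1 - v) `^ (b - 1))%:E.

Definition beta a b : R := fine (betaE a b).

Lemma continuous_beta_fun a b (v : R) : 0 < v < 1 ->
  {for v, continuous (fun v : R => v `^ (a - 1) * (1 - v) `^ (b - 1))}.
Proof.
move=> /andP[v0 v1]; apply: continuousM; first exact: continuous_powR_pos.
apply: (@continuous_comp _ _ _ (fun v : R => 1 - v) (fun v : R => v `^ (b - 1))).
  by apply: continuousB; [exact: cst_continuous|exact: cvg_id].
by apply: continuous_powR_pos; rewrite subr_gt0.
Qed.

Lemma measurable_beta_fun a b (D : set R) : measurable D ->
  measurable_fun D (fun v : R => v `^ (a - 1) * (1 - v) `^ (b - 1)).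
Proof.
move=> mD; apply: measurable_funM.
  by apply: (measurable_funS measurableT) => //; exact: measurable_powR.
apply: (@measurableT_comp _ _ _ _ _ _ (fun v : R => v `^ (b - 1))).
  exact: measurable_powR.
by apply: measurable_funB.
Qed.

(** On each half of the interval one of the two factors is at most two, so the integrand is
    dominated by a sum of two integrable kernels. *)
Lemma betaE_fin a b : 0 < a <= 1 -> 0 < b <= 1 -> betaE a b \is a fin_num.
Proof.
move=> a01 b01; rewrite ge0_fin_numE; last first.
  by apply: integral_ge0 => v _; rewrite lee_fin mulr_ge0// powR_ge0.
apply: (@le_lt_trans _ _
  (\int[mu]_(v in `[0%R, 1%R]) ((2 * ker a v)%:E + (2 * ker b (1 - v))%:E))%E).
  apply: (@le_trans _ _
    (\int[mu]_(v in `]0%R, 1%R[) ((2 * ker a v)%:E + (2 * ker b (1 - v))%:E))%E).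
    apply: ge0_le_integral => //.
    - by move=> v _; rewrite lee_fin mulr_ge0// powR_ge0.
    - by apply/measurable_EFinP; exact: measurable_beta_fun.
    - apply: emeasurable_funD; apply/measurable_EFinP; apply: measurable_funM => //.
        by apply: (measurable_funS measurableT) => //; exact: measurable_ker.
      exact: measurable_ker_refl.
    move=> v /=; rewrite in_itv/= => /andP[v0 v1]; rewrite lee_fin.
    have v1' : 0 < 1 - v by rewrite subr_gt0.
    rewrite !ker_gt0//.
    have [vh|vh] := leP v 2^-1.
      have : (1 - v) `^ (b - 1) <= 2 by apply: powR_le2 => //; apply/andP; split; lra.
      have := powR_ge0 v (a - 1); have := powR_ge0 (1 - v) (b - 1).
      move: (v `^ _) ((1 - v) `^ _) => x y; nra.
    have : v `^ (a - 1) <= 2 by apply: powR_le2 => //; apply/andP; split; lra.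
    have := powR_ge0 v (a - 1); have := powR_ge0 (1 - v) (b - 1).
    move: (v `^ _) ((1 - v) `^ _) => x y; nra.
  apply: ge0_subset_integral => //.
  - apply: emeasurable_funD; apply/measurable_EFinP; apply: measurable_funM => //.
      by apply: (measurable_funS measurableT) => //; exact: measurable_ker.
    exact: measurable_ker_refl.
  - by move=> v _; rewrite -EFinD lee_fin addr_ge0// mulr_ge0// ker_ge0.
  - exact: subset_itv_oo_cc.
rewrite ge0_integralD//.
- under eq_integral do rewrite EFinM.
  rewrite ge0_integralZl//.
  + under [X in (_ + X)%E]eq_integral do rewrite EFinM.
    rewrite ge0_integralZl//.
    * by rewrite integral_ker// integral_ker_refl// -!EFinM -EFinD ltry.
    * by apply/measurable_EFinP; exact: measurable_ker_refl.
    * by move=> x _; rewrite lee_fin ker_ge0.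
  + by apply/measurable_EFinP; apply: (measurable_funS measurableT) => //; exact: measurable_ker.
  + by move=> x _; rewrite lee_fin ker_ge0.
- by move=> x _; rewrite lee_fin mulr_ge0// ker_ge0.
- apply/measurable_EFinP; apply: measurable_funM => //.
  by apply: (measurable_funS measurableT) => //; exact: measurable_ker.
- by move=> x _; rewrite lee_fin mulr_ge0// ker_ge0.
- by apply/measurable_EFinP; apply: measurable_funM => //; exact: measurable_ker_refl.
Qed.

Lemma EFin_beta a b : 0 < a <= 1 -> 0 < b <= 1 -> (beta a b)%:E = betaE a b.
Proof. by move=> *; rewrite fineK// betaE_fin. Qed.

Lemma beta_gt0 a b : 0 < a <= 1 -> 0 < b <= 1 -> 0 < beta a b.
Proof.
move=> a01 b01; apply: (@lt_le_trans _ _ 1) => //; rewrite -lee_fin EFin_beta//.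
have -> : 1%:E = (\int[mu]_(v in `]0%R, 1%R[) (cst 1%:E v))%E :> \bar R.
  by rewrite integral_cst//= mul1e lebesgue_measure_itv/= lte_fin ltr01 sube0.
apply: ge0_le_integral => //.
- by apply/measurable_EFinP; exact: measurable_beta_fun.
- move=> v /=; rewrite in_itv/= => /andP[v0 v1]; rewrite lee_fin.
  rewrite -[leLHS]mulr1; apply: ler_pM => //; apply: powR_ge1.
  + by case/andP: a01.
  + by rewrite v0 ltW.
  + by case/andP: b01.
  + by apply/andP; split; lra.
Qed.

(** Substitute s = L v in the Beta integral. *)
Lemma beta_scale a b (L : R) : 0 < a <= 1 -> 0 < b <= 1 -> 0 < L ->
  (\int[mu]_s (ker b (L - s) * ker a s)%:E = (L `^ (a + b - 1) * beta a b)%:E)%E.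
Proof.
move=> a01 b01 L0; rewrite EFinM EFin_beta// -ge0_integralZl//; first last.
- by rewrite lee_fin powR_ge0.
- by move=> v _; rewrite lee_fin mulr_ge0// powR_ge0.
- by apply/measurable_EFinP; exact: measurable_beta_fun.
transitivity (\int[mu]_(s in `]0%R, L[) (s `^ (a - 1) * (L - s) `^ (b - 1))%:E)%E.
  rewrite -(@integral_zero_outside `]0, L[).
    apply: eq_integral => s; rewrite inE/= in_itv/= => /andP[s0 sL].
    by rewrite !ker_gt0 ?subr_gt0// mulrC.
  move=> s /=; rewrite in_itv/= => /negP; rewrite negb_and -!leNgt => /orP[s0|sL].
    by rewrite (ker_le0 _ s0) mulr0.
  by rewrite (@ker_le0 _ _ (L - s)) ?mul0r// subr_le0.
apply: etrans.
  apply: (@ge0_substitution_oo _ (fun v => L * v) (cst L) _ 0 1 0 L) => //; first last.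
  - by move=> x _; rewrite mulr_ge0// powR_ge0.
  - move=> x /andP[x0 xL]; apply: continuousM; first exact: continuous_powR_pos.
    apply: (@continuous_comp _ _ _ (fun v : R => L - v) (fun v : R => v `^ (b - 1))).
      by apply: continuousB; [exact: cst_continuous|exact: cvg_id].
    by apply: continuous_powR_pos; rewrite subr_gt0.
  - by move=> x _; rewrite ltW.
  - by move=> x _; exact: cst_continuous.
  - move=> x _; have := @is_deriveZ _ _ _ _ L _ _ _ (is_derive_id x (1 : R)).
    by rewrite /GRing.scale/= mulr1.
  - have : {for 1, continuous (fun v : R => L * v)}.
      by apply: continuousM; [exact: cst_continuous|exact: cvg_id].
    by rewrite /prop_for /continuous_at mulr1 => /cvg_at_left_filter.
  - have : {for 0, continuous (fun v : R => L * v)}.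
      by apply: continuousM; [exact: cst_continuous|exact: cvg_id].
    by rewrite /prop_for /continuous_at mulr0 => /cvg_at_right_filter.
  - by move=> x /andP[x0 x1]; rewrite mulr_gt0//= -[ltRHS]mulr1 ltr_pM2l.
  - by move=> x y _ _ xy; rewrite ltr_pM2l.
apply: eq_integral => v; rewrite inE/= in_itv/= => /andP[v0 v1]; rewrite -EFinM; congr EFin.
have -> : L - L * v = L * (1 - v) by ring.
have v1' : 0 < 1 - v by rewrite subr_gt0.
rewrite !powRM ?(ltW L0) ?(ltW v0) ?(ltW v1')//.
have -> : a + b - 1 = (a - 1) + (b - 1) + 1 by ring.
rewrite (@powRD _ L (a - 1 + (b - 1)) 1) ?(gt_eqF L0) ?implybT//.
rewrite (@powRD _ L (a - 1) (b - 1)) ?(gt_eqF L0) ?implybT// (powRr1 (ltW L0)).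
ring.
Qed.

(** The semigroup law of the kernels: convolving powers of order a - 1 and b - 1 gives one
    of order a + b - 1, by scaling to the Beta integral. *)
Lemma integral_ker_ker a b (c d r t : R) : 0 < a <= 1 -> 0 < b <= 1 ->
  c <= r -> t <= d ->
  (\int[mu]_(s in `[c, d]) (ker b (t - s) * ker a (s - r))%:E =
   (ker (a + b) (t - r) * beta a b)%:E)%E.
Proof.
move=> a01 b01 cr td; rewrite integral_zero_outside; last first.
  move=> s /=; rewrite in_itv/= => /negP; rewrite negb_and -!ltNge => /orP[sc|ds].
    by rewrite (@ker_le0 _ _ (s - r)) ?mulr0//; lra.
  by rewrite ker_le0 ?mul0r//; lra.
have [rt|tr] := ltP r t; last first.
  rewrite ker_le0 ?subr_le0// mul0r integral0_eq// => s _.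
  have [sr|rs] := leP s r; first by rewrite (@ker_le0 _ _ (s - r)) ?mulr0// subr_le0.
  by rewrite ker_le0 ?mul0r//; lra.
have tr0 : 0 < t - r by rewrite subr_gt0.
rewrite (ker_gt0 _ tr0) -(beta_scale a01 b01 tr0).
rewrite -[RHS](@ge0_integral_shift _ _ r).
- by apply: eq_integral => s _; congr (_ * _)%:E; congr ker; ring.
- apply/measurable_EFinP; apply: measurable_funM; last exact: measurable_ker.
  exact: measurable_ker_refl.
- by move=> s; rewrite lee_fin mulr_ge0// ker_ge0.
Qed.

(** The homography v = (s - r) (xi - t) / ((t - r) (xi - s)) maps [r, t] onto [0, 1] and
    turns the integrand into the Beta integrand, up to a factor that does not depend on s.
    In words: the mass which the kernel of order a at a point r before t puts on a later
    time xi is recovered from what it puts on the interval up to t. *)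
Lemma integral_moebius a (c d r t xi : R) : 0 < a < 1 -> c <= r -> r < t -> t <= d ->
  t < xi ->
  (\int[mu]_(s in `[c, d]) ((ker (1 - a) (t - s) * ker 0 (xi - s)) * ker a (s - r))%:E =
   (beta a (1 - a) * ((xi - t) `^ a)^-1 * (xi - r) `^ (a - 1))%:E)%E.
Proof.
move=> /andP[a0 a1] cr rt td txi.
have a01 : 0 < a <= 1 by rewrite a0 ltW.
have b01 : 0 < 1 - a <= 1 by apply/andP; split; lra.
have rxi := lt_trans rt txi.
rewrite integral_zero_outside; last first.
  move=> s /=; rewrite in_itv/= => /negP; rewrite negb_and -!ltNge => /orP[sc|ds].
    by rewrite (@ker_le0 _ _ (s - r)) ?mulr0//; lra.
  by rewrite ker_le0 ?mul0r//; lra.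
pose K := (xi - r) `^ (1 - a) * (xi - t) `^ a.
have K0 : 0 < K by rewrite mulr_gt0// powR_gt0// subr_gt0.
suff : (K%:E * \int[mu]_s ((ker (1 - a) (t - s) * ker 0 (xi - s)) * ker a (s - r))%:E =
        (beta a (1 - a))%:E)%E.
  set I := (\int[_]__ _)%E => KI.
  have -> : I = (K^-1%:E * (K%:E * I))%E.
    by rewrite muleA -EFinM mulVf ?gt_eqF// mul1e.
  rewrite KI -EFinM; congr EFin; rewrite /K -(opprB 1 a) powRN; field.
  by rewrite !gt_eqF ?powR_gt0// subr_gt0.
have meas (D : set R) : measurable_fun D (fun s => ker (1 - a) (t - s) * ker 0 (xi - s) * ker a (s - r)).
  apply: measurable_funM; last exact: measurable_ker_shift.
  by apply: measurable_funM; exact: measurable_ker_refl.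
have ge0 s : 0 <= ker (1 - a) (t - s) * ker 0 (xi - s) * ker a (s - r).
  by rewrite !mulr_ge0 ?ker_ge0.
rewrite -ge0_integralZl//; first last.
- by rewrite lee_fin ltW.
- by move=> s _; rewrite lee_fin.
- by apply/measurable_EFinP; exact: meas.
rewrite EFin_beta// /betaE; apply/esym.
(* the homography in the form k / (xi - s) - q, which is easy to differentiate *)
pose k := (xi - t) * (xi - r) / (t - r); pose q := (xi - t) / (t - r).
have tr0 : 0 < t - r by rewrite subr_gt0.
have FE s : s < xi -> k * (xi - s)^-1 - q = (s - r) * (xi - t) / ((t - r) * (xi - s)).
  by move=> sxi; rewrite /k /q; field; rewrite !gt_eqF//; lra.
have Fc s : s < xi -> {for s, continuous (fun s : R => k * (xi - s)^-1 - q)}.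
  move=> sxi; apply: continuousB; last exact: cst_continuous.
  apply: continuousM; first exact: cst_continuous.
  apply: continuousV; first by rewrite gt_eqF//; lra.
  by apply: continuousB; [exact: cst_continuous|exact: cvg_id].
have hD s : r < s < t -> is_derive s 1 (fun s => k * (xi - s)^-1 - q) (k * (xi - s) ^- 2).
  move=> /andP[rs st].
  have h1 : is_derive s (1 : R) (cst xi - id) (-1 : R).
    by apply: is_derive_eq; rewrite sub0r.
  have sxi : xi - s != 0 by rewrite gt_eqF//; lra.
  have n0 : (cst xi - id : R -> R) s != 0 by exact: sxi.
  have h2 := @is_deriveZ _ _ _ _ k _ _ _ (is_deriveV n0 h1).
  have h3 := is_deriveB h2 (is_derive_cst q s (1 : R)).
  have h4 : is_derive s (1 : R) (fun s => k * (xi - s)^-1 - q)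
      (k * (- (xi - s) ^- 2 * -1) - 0) by exact: h3.
  apply: (is_derive_eq h4); ring.
apply: etrans.
  apply: (@ge0_substitution_oo _ (fun s => k * (xi - s)^-1 - q)
    (fun s => k * (xi - s) ^- 2) (fun v => v `^ (a - 1) * (1 - v) `^ (1 - a - 1))
    r t 0 1 rt _ _ _ _ hD); first last.
  - by move=> v _; rewrite mulr_ge0// powR_ge0.
  - by move=> v v01; exact: continuous_beta_fun.
  - move=> s /andP[rs st]; rewrite mulr_ge0 ?invr_ge0 ?sqr_ge0// /k divr_ge0 ?mulr_ge0//; lra.
  - move=> s /andP[rs st]; apply: continuousM; first exact: cst_continuous.
    apply: continuousV; first by rewrite gt_eqF// exprn_gt0; lra.
    by apply: continuousM; apply: continuousB; [exact: cst_continuous|exact: cvg_id|exact: cst_continuous|exact: cvg_id].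
  - have := Fc t txi.
    rewrite /prop_for /continuous_at FE// divff => [/cvg_at_left_filter//|].
    by rewrite gt_eqF// mulr_gt0; lra.
  - have := Fc r rxi.
    by rewrite /prop_for /continuous_at FE// subrr !mul0r => /cvg_at_right_filter.
  - move=> s /andP[rs st]; rewrite FE; last by lra.
    rewrite divr_gt0 ?mulr_gt0 ?subr_gt0//; last by lra.
    rewrite ltr_pdivrMr; last by rewrite mulr_gt0; lra.
    rewrite mul1r -subr_gt0.
    have -> : (t - r) * (xi - s) - (s - r) * (xi - t) = (xi - r) * (t - s) by ring.
    by rewrite !mulr_gt0 ?subr_gt0.
  - move=> x y rx yt xy; rewrite ltrD2r ltr_pM2l; last first.
      by rewrite /k divr_gt0 ?mulr_gt0//; lra.
    by rewrite ltf_pV2 ?posrE; lra.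
rewrite -(@integral_zero_outside `]r, t[); last first.
  move=> s /=; rewrite in_itv/= => /negP; rewrite negb_and -!leNgt => /orP[sc|ds].
    by rewrite (@ker_le0 _ _ (s - r)) ?mulr0 ?mule0//; lra.
  by rewrite ker_le0 ?mul0r ?mule0//; lra.
apply: eq_integral => s; rewrite inE/= in_itv/= => /andP[rs st].
rewrite -EFinM; congr EFin.
rewrite FE; last by lra.
have x1 : 0 < s - r by lra.
have x2 : 0 < xi - t by lra.
have x3 : 0 < t - r by lra.
have x4 : 0 < xi - s by lra.
have x5 : 0 < xi - r by lra.
have x6 : 0 < t - s by lra.
rewrite !ker_gt0//.
have -> : 1 - (s - r) * (xi - t) / ((t - r) * (xi - s)) =
          (xi - r) * (t - s) / ((t - r) * (xi - s)).
  by field; rewrite !gt_eqF.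
have -> : 1 - a - 1 = - a by ring.
rewrite sub0r powR_inv1 ?(ltW x4)//.
rewrite /K /k; move: x1 x2 x3 x4 x5 x6.
move: (s - r) (xi - t) (t - r) (xi - s) (xi - r) (t - s) => x1 x2 x3 x4 x5 x6 h1 h2 h3 h4 h5 h6.
have pV (x : R) : 0 < x -> (x^-1) `^ a = (x `^ a)^-1.
  by move=> x0; rewrite -powR_inv1 ?ltW// -powRrM mulN1r powRN.
have pM (x y : R) : 0 < x -> 0 < y -> (x * y) `^ a = x `^ a * y `^ a.
  by move=> ? ?; rewrite powRM// ltW.
rewrite powRB1E ?divr_gt0 ?mulr_gt0// !powRN !pM ?invr_gt0 ?mulr_gt0// pV ?mulr_gt0// pM//.
have -> : x5 `^ (1 - a) = x5 / x5 `^ a.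
  by rewrite powRB ?(gt_eqF h5) ?implybT// powRr1// ltW.
rewrite (powRB1E _ h1).
by field; rewrite !gt_eqF ?powR_gt0.
Qed.

End beta.

Section gamma.
Context {R : realType}.
Local Notation mu := (@lebesgue_measure R).
Implicit Types (a : R).

Let GammaE a : \bar R := (\int[mu]_s (ker a s * expR (- s))%:E)%E.

Lemma Gamma_fine a : Gamma a = fine (GammaE a).
Proof.
rewrite /Gamma /Rintegral /GammaE -(@integral_zero_outside _ `]0, +oo[).
  congr fine; apply: eq_integral => s; rewrite inE/= in_itv/= andbT => s0.
  by rewrite ker_gt0.
move=> s /=; rewrite in_itv/= andbT => /negP; rewrite -leNgt => s0.
by rewrite ker_le0// mul0r.
Qed.

(** The kernel of order one is the indicator of the positive half-line, so this is Gamma (1)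
    = 1. *)
Lemma integral_expN : (\int[mu]_s (ker 1 s * expR (- s))%:E = 1)%E.
Proof.
rewrite -(@integral_zero_outside _ `]0, +oo[); last first.
  move=> s /=; rewrite in_itv/= andbT => /negP; rewrite -leNgt => s0.
  by rewrite ker_le0// mul0r.
transitivity (\int[mu]_(s in `[0%R, +oo[) (expR (- s))%:E)%E.
  apply: (@integral_off2 _ _ _ _ _ 0 0) => x x0 _; rewrite !patchE.
  have -> : (x \in `]0, +oo[%classic) = (x \in `[0, +oo[%classic).
    by apply/idP/idP; rewrite !inE/= !in_itv/= !andbT lt_neqAle eq_sym x0.
  case: ifPn => //; rewrite inE/= in_itv/= andbT => x0'.
  by rewrite ker_gt0 ?lt_neqAle 1?eq_sym ?x0// subrr powRr0 mul1r.
rewrite (@ge0_continuous_FTC2y _ _ (fun s => - expR (- s)) 0 0).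
- by rewrite oppr0 expR0 -EFinB opprK add0r.
- by move=> x _; exact: expR_ge0.
- apply: continuous_subspaceT => x.
  by apply: continuous_comp; [exact: continuousN|exact: continuous_expR].
- rewrite -oppr0; apply: cvgN.
  exact: cvgr_expR.
- by move=> x _; apply: ex_derive.
- rewrite oppr0 expR0.
  have : {for 0, continuous (fun s : R => - expR (- s))}.
    apply: continuousN; apply: continuous_comp; [exact: continuousN|exact: continuous_expR].
  by rewrite /prop_for /continuous_at oppr0 expR0 => /cvg_at_right_filter.
- move=> x _; rewrite derive1E.
  have [_ //] : is_derive x (1 : R) (fun s : R => - expR (- s)) (expR (- x)).
  by apply: is_derive_eq; rewrite /GRing.scale/= mulrN1 opprK.
Qed.

(** Tonelli in the product of the two Laplace-type integrals: after the shift t -> t - s the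
    inner integral is the convolution of two kernels whose orders add up to one, hence
    constant, and what remains is Gamma (1). *)
Lemma GammaE_mul a : 0 < a < 1 -> (GammaE a * GammaE (1 - a) = (beta a (1 - a))%:E)%E.
Proof.
move=> /andP[a0 a1].
have a01 : 0 < a <= 1 by rewrite a0 ltW.
have b01 : 0 < 1 - a <= 1 by apply/andP; split; lra.
pose h (p : R * R) := (ker a p.1 * ker (1 - a) (p.2 - p.1) * expR (- p.2))%:E.
have mexp : measurable_fun [set: R] (fun s : R => expR (- s)).
  by apply: measurableT_comp.
have mh : measurable_fun setT h.
  apply/measurable_EFinP; apply: measurable_funM; last first.
    by apply: (@measurableT_comp _ _ _ _ _ _ (fun s : R => expR (- s))).
  apply: measurable_funM; apply: measurable_ker_comp => //.
  exact: measurable_funB.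
have h0 p : (0 <= h p)%E by rewrite lee_fin !mulr_ge0 ?ker_ge0 ?expR_ge0.
transitivity (\int[mu]_s \int[mu]_t h (s, t))%E.
  rewrite /GammaE -ge0_integralZr//; first last.
  - by apply: integral_ge0 => s _; rewrite lee_fin mulr_ge0 ?ker_ge0 ?expR_ge0.
  - by move=> s _; rewrite lee_fin mulr_ge0 ?ker_ge0 ?expR_ge0.
  - by apply/measurable_EFinP; apply: measurable_funM => //; exact: measurable_ker.
  apply: eq_integral => s _.
  rewrite -(@ge0_integral_shift _ _ s); first last.
  - by move=> x; rewrite lee_fin mulr_ge0 ?ker_ge0 ?expR_ge0.
  - by apply/measurable_EFinP; apply: measurable_funM => //; exact: measurable_ker.
  rewrite -ge0_integralZl//; first last.
  - by rewrite lee_fin mulr_ge0 ?ker_ge0 ?expR_ge0.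
  - by move=> x _; rewrite lee_fin mulr_ge0 ?ker_ge0 ?expR_ge0.
  - apply/measurable_EFinP; apply: measurable_funM => //; first exact: measurable_ker_shift.
    by apply: (@measurableT_comp _ _ _ _ _ _ (fun s : R => expR (- s))) => //; exact: measurable_funB.
  apply: eq_integral => t _; rewrite /h/= -EFinM; congr EFin.
  have -> : - t = - s + (- (t - s)) by ring.
  by rewrite expRD; ring.
rewrite (@fubini_tonelli _ _ _ _ _ mu mu h)//.
transitivity (\int[mu]_t ((beta a (1 - a))%:E * (ker 1 t * expR (- t))%:E))%E.
  apply: eq_integral => t _; have [t0|t0] := leP t 0.
    rewrite integral0_eq; first by rewrite ker_le0// mul0r mule0.
    move=> s _; rewrite /h/=; have [s0|s0] := leP s 0; first by rewrite ker_le0// !mul0r.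
    by rewrite (@ker_le0 _ _ (t - s)) ?mulr0 ?mul0r//; lra.
  transitivity (\int[mu]_s ((expR (- t))%:E * (ker (1 - a) (t - s) * ker a s)%:E))%E.
    by apply: eq_integral => s _; rewrite /h/= -EFinM; congr EFin; ring.
  rewrite ge0_integralZl//; first last.
  - by move=> s _; rewrite lee_fin mulr_ge0 ?ker_ge0.
  - by apply/measurable_EFinP; apply: measurable_funM; [exact: measurable_ker_refl|exact: measurable_ker].
  rewrite beta_scale// -!EFinM; congr EFin.
  have -> : a + (1 - a) = 1 by ring.
  by rewrite (ker_gt0 _ t0); ring.
rewrite ge0_integralZl ?integral_expN ?mule1//.
- by apply/measurable_EFinP; apply: measurable_funM => //; exact: measurable_ker.
- by move=> s _; rewrite lee_fin mulr_ge0 ?ker_ge0 ?expR_ge0.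
- by rewrite lee_fin ltW// beta_gt0.
Qed.

Let GammaE_ge0 a : (0 <= GammaE a)%E.
Proof. by apply: integral_ge0 => s _; rewrite lee_fin mulr_ge0 ?ker_ge0 ?expR_ge0. Qed.

(** Only the product is computed; it is finite and positive, which excludes that one factor
    vanishes or is infinite. The constants of the Caputo derivative and of the fractional
    integral then cancel. *)
Lemma Gamma_mul a : 0 < a < 1 ->
  [/\ 0 < Gamma a, 0 < Gamma (1 - a) & Gamma a * Gamma (1 - a) = beta a (1 - a)].
Proof.
move=> a01; have := GammaE_mul a01; rewrite !Gamma_fine.
have b0 : 0 < beta a (1 - a).
  by case/andP: a01 => a0 a1; apply: beta_gt0; apply/andP; split; lra.
have := GammaE_ge0 a; have := GammaE_ge0 (1 - a).
case: (GammaE a) => [x| |//]; case: (GammaE (1 - a)) => [y| |//]; rewrite ?lee_fin.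
- move=> y0 x0 /= -[xy]; rewrite xy; split => //.
  + rewrite lt_neqAle x0 andbT eq_sym; apply/eqP => x00.
    by move: b0; rewrite -xy x00 mul0r ltxx.
  + rewrite lt_neqAle y0 andbT eq_sym; apply/eqP => x00.
    by move: b0; rewrite -xy x00 mulr0 ltxx.
- move=> _; rewrite le_eqVlt => /predU1P[<-|x0].
    by rewrite mul0e => -[xy]; move: b0; rewrite -xy ltxx.
  by rewrite gt0_muley.
- move=> + _; rewrite le_eqVlt => /predU1P[<-|x0].
    by rewrite mule0 => -[xy]; move: b0; rewrite -xy ltxx.
  by rewrite gt0_mulye.
- by rewrite mulyy.
Qed.

Lemma Gamma_gt0 a : 0 < a < 1 -> 0 < Gamma a.
Proof. by case/Gamma_mul. Qed.

End gamma.

(** * Bounded measurable functions *)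

Section bounded_measurable.
Context {R : realType}.
Local Notation mu := (@lebesgue_measure R).
Implicit Types (f g k : R -> R) (D : set R).

Definition bm (M : R) f := measurable_fun setT f /\ forall s, `|f s| <= M.

Lemma bm_ge0 M f : bm M f -> 0 <= M.
Proof. by move=> [_ /(_ 0)]; exact: le_trans. Qed.

Lemma bm_measurable M f D : bm M f -> measurable_fun D f.
Proof. by move=> [mf _]; apply: measurable_funTS. Qed.

Lemma ge0_integrable D k : measurable D -> measurable_fun D k ->
  (forall s, D s -> 0 <= k s) -> (\int[mu]_(s in D) (k s)%:E < +oo)%E ->
  mu.-integrable D (fun s => (k s)%:E).
Proof.
move=> mD mk k0 kfin; apply/integrableP; split; first exact/measurable_EFinP.
apply: le_lt_trans kfin; rewrite le_eqVlt; apply/orP; left; apply/eqP.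
by apply: eq_integral => s; rewrite inE => Ds; rewrite /= ger0_norm ?k0.
Qed.

Lemma integrable_scale D k (c : R) : measurable D -> mu.-integrable D (fun s => (k s)%:E) ->
  mu.-integrable D (fun s => (c * k s)%:E).
Proof.
by move=> mD ik; apply: (@eq_integrable _ _ _ mu D mD (fun s => c%:E * (k s)%:E)%E) => //;
  exact: integrableZl.
Qed.

Lemma integrable_add D f g : measurable D -> mu.-integrable D (fun s => (f s)%:E) ->
  mu.-integrable D (fun s => (g s)%:E) -> mu.-integrable D (fun s => (f s + g s)%:E).
Proof.
by move=> mD ff fg; apply: (@eq_integrable _ _ _ mu D mD (fun s => (f s)%:E + (g s)%:E)%E) => //;
  exact: integrableD.
Qed.

Lemma integrable_sub D f g : measurable D -> mu.-integrable D (fun s => (f s)%:E) ->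
  mu.-integrable D (fun s => (g s)%:E) -> mu.-integrable D (fun s => (f s - g s)%:E).
Proof.
by move=> mD ff fg; apply: (@eq_integrable _ _ _ mu D mD (fun s => (f s)%:E - (g s)%:E)%E) => //;
  exact: integrableB.
Qed.

Lemma le_Rintegral_norm D f g : measurable D -> mu.-integrable D (fun s => (f s)%:E) ->
  mu.-integrable D (fun s => (g s)%:E) -> (forall s, D s -> `|f s| <= g s) ->
  `|\int[mu]_(s in D) f s| <= \int[mu]_(s in D) g s.
Proof.
move=> mD ff fg h; apply: (le_trans (@le_normr_Rintegral _ _ _ mu D f mD ff)).
by apply: le_Rintegral => //; exact: (integrable_norm ff).
Qed.

Lemma integrable_bmM M k f D : measurable D ->
  mu.-integrable D (fun s => (k s)%:E) -> bm M f ->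
  mu.-integrable D (fun s => (k s * f s)%:E).
Proof.
move=> mD ik bf; have M0 := bm_ge0 bf.
have mk : measurable_fun D k by apply/measurable_EFinP; exact: measurable_int ik.
have iMk : mu.-integrable D (fun s => M%:E * (k s)%:E)%E by exact: integrableZl.
apply: (le_integrable _ _ _ iMk) => //.
  by apply/measurable_EFinP; apply: measurable_funM => //; exact: bm_measurable bf.
move=> s Ds; rewrite -EFinM /= lee_fin !normrM mulrC ler_wpM2r//.
by rewrite (ger0_norm M0); case: bf.
Qed.

Lemma integrable_bm M f (a b : R) : bm M f ->
  mu.-integrable `[a, b] (fun s => (f s)%:E).
Proof.
move=> bf; have : mu.-integrable `[a, b] (fun s => (1 * f s)%:E).
  apply: (integrable_bmM _ _ bf) => //.
  apply: (@ge0_integrable _ (fun=> 1)) => //.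
  by rewrite integral_cst//= mul1e lebesgue_measure_itv/=; case: ifP => // _; rewrite -EFinD ltry.
by apply: eq_integrable => // s _; rewrite mul1r.
Qed.

Lemma le_Rintegral_bmM M k f D : measurable D ->
  mu.-integrable D (fun s => (k s)%:E) -> (forall s, D s -> 0 <= k s) -> bm M f ->
  `|\int[mu]_(s in D) (k s * f s)| <= M * \int[mu]_(s in D) k s.
Proof.
move=> mD ik k0 bf; rewrite -RintegralZl//; apply: le_Rintegral_norm => //.
- exact: integrable_bmM bf.
- exact: integrable_scale.
- move=> s Ds; rewrite normrM mulrC (ger0_norm (k0 _ Ds)) ler_wpM2r ?k0//.
  by case: bf.
Qed.

(** Comparison of two kernels integrated against the same bounded function; the dominating
    kernel q is chosen to have an explicit integral. *)
Lemma Rintegral_dist_le M p p' q f D : measurable D ->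
  mu.-integrable D (fun s => (p s)%:E) -> mu.-integrable D (fun s => (p' s)%:E) ->
  mu.-integrable D (fun s => (q s)%:E) -> bm M f ->
  (forall s, D s -> `|p' s - p s| <= q s) ->
  `|\int[mu]_(s in D) (p' s * f s) - \int[mu]_(s in D) (p s * f s)| <= M * \int[mu]_(s in D) q s.
Proof.
move=> mD ip ip' iq bf pq.
have i1 := integrable_bmM mD ip bf; have i2 := integrable_bmM mD ip' bf.
rewrite -RintegralB// -RintegralZl//; apply: le_Rintegral_norm => //.
- exact: integrable_sub.
- exact: integrable_scale.
by move=> s Ds; rewrite -mulrBl normrM mulrC; apply: ler_pM => //; [case: bf|exact: pq].
Qed.

Lemma Rintegral_fin D f : measurable D -> mu.-integrable D (fun s => (f s)%:E) ->
  ((\int[mu]_(s in D) f s)%:E = \int[mu]_(s in D) (f s)%:E)%E.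
Proof. by move=> mD ifD; rewrite /Rintegral fineK// integrable_fin_num. Qed.

Lemma integrable_ker_refl a (tau c d : R) : 0 < a <= 1 ->
  mu.-integrable `[c, d] (fun s => (ker a (tau - s))%:E).
Proof.
move=> a01; apply: ge0_integrable => //.
- exact: measurable_ker_refl.
- by move=> s _; exact: ker_ge0.
have [cd|dc] := leP c d; first by rewrite integral_ker_refl// ltry.
by rewrite set_itv_ge ?integral_set0// bnd_simp -ltNge.
Qed.

Lemma integrable_ker_shift a (r c d : R) : 0 < a <= 1 ->
  mu.-integrable `[c, d] (fun s => (ker a (s - r))%:E).
Proof.
move=> a01; apply: ge0_integrable => //.
- exact: measurable_ker_shift.
- by move=> s _; exact: ker_ge0.
have [cd|dc] := leP c d; first by rewrite integral_ker_shift// ltry.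
by rewrite set_itv_ge ?integral_set0// bnd_simp -ltNge.
Qed.

Lemma Rintegral_ker_refl a (tau c d : R) : 0 < a <= 1 -> c <= d ->
  \int[mu]_(s in `[c, d]) ker a (tau - s) = kerprim a (tau - c) - kerprim a (tau - d).
Proof. by move=> a01 cd; rewrite /Rintegral integral_ker_refl. Qed.

Lemma bmM M N f g : bm M f -> bm N g -> bm (M * N) (fun s => f s * g s).
Proof.
move=> [mf Mf] [mg Ng]; split; first exact: measurable_funM.
by move=> s; rewrite normrM ler_pM.
Qed.

Lemma bmZ M f c : bm M f -> bm (`|c| * M) (fun s => c * f s).
Proof.
move=> [mf Mf]; split; first by apply: measurable_funM => //; exact: measurable_cst.
by move=> s; rewrite normrM ler_wpM2l.
Qed.

Lemma bmD M N f g : bm M f -> bm N g -> bm (M + N) (fun s => f s + g s).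
Proof.
move=> [mf Mf] [mg Ng]; split; first exact: measurable_funD.
by move=> s; rewrite (le_trans (ler_normD _ _))// lerD.
Qed.

Lemma bmB M N f g : bm M f -> bm N g -> bm (M + N) (fun s => f s - g s).
Proof.
move=> [mf Mf] [mg Ng]; split; first exact: measurable_funB.
by move=> s; rewrite (le_trans (ler_normB _ _))// lerD.
Qed.

Lemma bm_cst c : bm `|c| (cst c : R -> R).
Proof. by split. Qed.

Lemma bm_cst1 : bm 1 (fun _ : R => 1 : R).
Proof. by have := bm_cst 1; rewrite normr1. Qed.

Lemma bm_indic D : measurable D -> bm 1 (\1_D : R -> R).
Proof.
move=> mD; split=> [|s]; first exact: measurable_indic.
by rewrite indicE; case: (_ \in _); rewrite ?normr1 ?normr0.
Qed.

Lemma bm_patch M f D : measurable D -> 0 <= M -> measurable_fun D f ->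
  (forall s, D s -> `|f s| <= M) -> bm M (f \_ D).
Proof.
move=> mD M0 mf fM; split; first exact/(measurable_restrictT f).
by move=> s; rewrite patchE; case: ifPn => [/set_mem/fM//|_]; rewrite normr0.
Qed.

Lemma Rintegral_indic_le D E k : measurable D -> measurable E -> (forall s, 0 <= k s) ->
  mu.-integrable D (fun s => (k s * \1_E s)%:E) -> mu.-integrable E (fun s => (k s)%:E) ->
  \int[mu]_(s in D) (k s * \1_E s) <= \int[mu]_(s in E) k s.
Proof.
move=> mD mE k0 iD iE; rewrite -lee_fin !Rintegral_fin//.
rewrite integral_mkcond [leRHS]integral_mkcond; apply: ge0_le_integral_gen => //.
  by move=> x _; rewrite patchE; case: ifP => // _; rewrite lee_fin mulr_ge0// indicE ler0n.
move=> x _; rewrite !patchE indicE.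
by have [_|_] := boolP (x \in E); rewrite ?mulr1 ?mulr0; case: ifP => // _; rewrite lee_fin.
Qed.

(** The density of a path stopped at time t: stopping keeps the fractional derivative before
    t and replaces it by zero after t. *)
Definition upto {V : nmodType} (t : R) (f : R -> V) : R -> V := fun s => if s < t then f s else 0.

Lemma bm_upto M t f : bm M f -> bm M (upto t f).
Proof.
move=> bf; have M0 := bm_ge0 bf; case: bf => mf Mf; split.
  apply: measurable_fun_ifT => //; exact: measurable_fun_ltr.
by move=> s; rewrite /upto; case: ifP => // _; rewrite normr0.
Qed.

Lemma upto_upto {V : nmodType} t t' (f : R -> V) : t <= t' -> upto t' (upto t f) = upto t f.
Proof.
move=> tt'; apply/funext => s; rewrite /upto; case: (ltP s t) => st; last by case: ifP.
by rewrite (lt_le_trans st tt').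
Qed.

End bounded_measurable.

(** * Fractional integrals *)

Section fubini.
Context {R : realType}.
Local Notation mu := (@lebesgue_measure R).

Lemma Rintegral_fubini (D : set R) (h : R * R -> R) : measurable D ->
  measurable_fun setT h ->
  (forall x, D x -> mu.-integrable D (fun y => (h (x, y))%:E)) ->
  (forall y, D y -> mu.-integrable D (fun x => (h (x, y))%:E)) ->
  (\int[mu]_(x in D) \int[mu]_(y in D) (`|h (x, y)|)%:E < +oo)%E ->
  \int[mu]_(x in D) \int[mu]_(y in D) h (x, y) =
  \int[mu]_(y in D) \int[mu]_(x in D) h (x, y).
Proof.
move=> mD mh hx hy hfin.
pose H (p : R * R) : \bar R := (h p * (\1_D p.1 * \1_D p.2))%:E.
have mH : measurable_fun setT H.
  apply/measurable_EFinP; apply: measurable_funM => //; apply: measurable_funM.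
    apply: (@measurableT_comp _ _ _ _ _ _ (\1_D : R -> R)) => //.
  apply: (@measurableT_comp _ _ _ _ _ _ (\1_D : R -> R)) => //.
have HxE x : (\int[mu]_y H (x, y) = if x \in D then \int[mu]_(y in D) (h (x, y))%:E else 0)%E.
  case: ifPn => xD.
    rewrite [RHS]integral_mkcond; apply: eq_integral => y _; rewrite /H patchE/= !indicE xD mul1r.
    by case: ifPn => _; rewrite ?mulr1 ?mulr0.
  by rewrite integral0_eq// => y _; rewrite /H/= !indicE (negbTE xD) mul0r mulr0.
have HyE y : (\int[mu]_x H (x, y) = if y \in D then \int[mu]_(x in D) (h (x, y))%:E else 0)%E.
  case: ifPn => yD.
    rewrite [RHS]integral_mkcond; apply: eq_integral => x _; rewrite /H patchE/= !indicE yD mulr1.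
    by case: ifPn => _; rewrite ?mulr1 ?mulr0.
  by rewrite integral0_eq// => x _; rewrite /H/= !indicE (negbTE yD) !mulr0.
have iH : (mu \x mu)%E.-integrable setT H.
  apply/integrable12ltyP => //; apply: le_lt_trans hfin.
  rewrite [leRHS]integral_mkcond le_eqVlt; apply/orP; left; apply/eqP.
  apply: eq_integral => x _; rewrite patchE; case: ifPn => xD.
    rewrite [RHS]integral_mkcond; apply: eq_integral => y _; rewrite /H patchE/= !indicE xD mul1r.
    by case: ifPn => _; rewrite ?mulr1 ?mulr0 ?normr0.
  by rewrite integral0_eq// => y _; rewrite /H/= !indicE (negbTE xD) mul0r mulr0 normr0.
have := Fubini iH.
under eq_integral => x _ do rewrite HxE.
under [in RHS]eq_integral => y _ do rewrite HyE.
rewrite /Rintegral => HH.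
transitivity (fine (\int[mu]_x (if x \in D then \int[mu]_(y in D) (h (x, y))%:E else 0))%E).
  congr fine; rewrite integral_mkcond; apply: eq_integral => x _; rewrite patchE.
  by case: ifPn => // xD; rewrite fineK//; apply: integrable_fin_num => //; exact/hx/set_mem.
rewrite HH; congr fine; rewrite [RHS]integral_mkcond; apply: eq_integral => y _; rewrite patchE.
by case: ifPn => // yD; rewrite fineK//; apply: integrable_fin_num => //; exact/hy/set_mem.
Qed.

End fubini.

Section convolution.
Context {R : realType}.
Variable T : R.
Local Notation mu := (@lebesgue_measure R).
Local Notation D := `[0, T]%classic.
Implicit Types (f g k p : R -> R).

(** The fractional integral of order a, without the factor 1 / Gamma (a); for a = 1 it is
    the primitive. *)
Definition kconv (a : R) f (tau : R) : R := \int[mu]_(s in D) (ker a (tau - s) * f s).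

Lemma integrable_kconv a M f tau : 0 < a <= 1 -> bm M f ->
  mu.-integrable D (fun s => (ker a (tau - s) * f s)%:E).
Proof. by move=> a01 bf; apply: (integrable_bmM _ _ bf) => //; exact: integrable_ker_refl. Qed.

Lemma kconvB a M N f g tau : 0 < a <= 1 -> bm M f -> bm N g ->
  kconv a (fun s => f s - g s) tau = kconv a f tau - kconv a g tau.
Proof.
move=> a01 bf bg; rewrite /kconv -RintegralB//.
- by apply: eq_Rintegral => s _; rewrite mulrBr.
- exact: (integrable_kconv _ a01 bf).
- exact: (integrable_kconv _ a01 bg).
Qed.

Lemma kconv_le a M f tau : 0 < a <= 1 -> 0 <= T -> bm M f ->
  `|kconv a f tau| <= M * (kerprim a tau - kerprim a (tau - T)).
Proof.
move=> a01 T0 bf; apply: (le_trans (le_Rintegral_bmM _ _ _ bf)) => //.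
- exact: integrable_ker_refl.
- by move=> s _; exact: ker_ge0.
by rewrite Rintegral_ker_refl// subr0.
Qed.

(** Fubini for the product of a weight p, a bounded g and a fractional integral. It is used
    with three weights: a kernel (semigroup law), the kernel of the Moebius formula (maximum
    principle) and the weight of condition (L) (first variation). *)
Lemma kconv_fubini a M N f g p : 0 < a <= 1 -> 0 <= T -> bm M f -> bm N g ->
  measurable_fun setT p -> (forall s, 0 <= p s) -> mu.-integrable D (fun s => (p s)%:E) ->
  (forall r, D r -> (\int[mu]_(s in D) (p s * ker a (s - r))%:E < +oo)%E) ->
  \int[mu]_(s in D) (p s * g s * kconv a f s) =
  \int[mu]_(r in D) (f r * \int[mu]_(s in D) (p s * ker a (s - r) * g s)).
Proof.
move=> a01 T0 bf bg mp p0 ip pfin; have a0 : 0 < a by case/andP: a01.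
have M0 := bm_ge0 bf; have N0 := bm_ge0 bg.
have [mf Mf] := bf; have [mg Ng] := bg.
pose h (x : R * R) := p x.1 * g x.1 * (ker a (x.1 - x.2) * f x.2).
have mh : measurable_fun setT h.
  apply: measurable_funM; apply: measurable_funM.
  - exact: measurableT_comp.
  - exact: measurableT_comp.
  - by apply: measurable_ker_comp; exact: measurable_funB.
  - exact: measurableT_comp.
have ipr r : D r -> mu.-integrable D (fun s => (p s * ker a (s - r))%:E).
  move=> Dr; apply: ge0_integrable => //.
  - apply: measurable_funM; last exact: measurable_ker_shift.
    exact: measurable_funTS.
  - by move=> s _; rewrite mulr_ge0 ?p0 ?ker_ge0.
  - exact: pfin.
have mabs x : D x -> (\int[mu]_(y in D) (`|h (x, y)|)%:E <= (p x * (N * M * kerprim a T))%:E)%E.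
  rewrite /= in_itv/= => /andP[x0 xT].
  apply: (@le_trans _ _ (\int[mu]_(y in D) ((p x * N * M)%:E * (ker a (x - y))%:E))%E).
    apply: ge0_le_integral_gen => //.
    move=> y _; rewrite -EFinM lee_fin /h/= !normrM (ger0_norm (p0 _)) (ger0_norm (ker_ge0 _ _)).
    rewrite -!mulrA ler_wpM2l// ler_pM// ?mulr_ge0 ?ker_ge0 ?Ng//.
    by rewrite mulrC ler_wpM2r ?ker_ge0.
  rewrite ge0_integralZl//.
  - rewrite integral_ker_refl// -EFinM lee_fin -!mulrA ler_wpM2l// !ler_wpM2l//.
    by rewrite subr0 lerBlDr (le_trans (le_kerprim a0 xT))// lerDl kerprim_ge0.
  - by apply/measurable_EFinP; exact: measurable_ker_refl.
  - by move=> y _; rewrite lee_fin ker_ge0.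
  - by rewrite lee_fin !mulr_ge0.
transitivity (\int[mu]_(x in D) \int[mu]_(y in D) h (x, y)).
  apply: eq_Rintegral => s _; rewrite /kconv -RintegralZl//.
  exact: (integrable_kconv _ a01 bf).
rewrite (Rintegral_fubini _ mh)//.
- apply: eq_Rintegral => r; rewrite inE => Dr.
  rewrite -RintegralZl//; last exact: (integrable_bmM _ (ipr _ Dr) bg).
  by apply: eq_Rintegral => s _; rewrite /h/=; ring.
- move=> x Dx; apply: (@eq_integrable _ _ _ mu D _ (fun y => ((p x * g x)%:E * (ker a (x - y) * f y)%:E)%E)) => //.
  apply: integrableZl => //; exact: (integrable_kconv _ a01 bf).
- move=> y Dy; apply: (@eq_integrable _ _ _ mu D _ (fun s => ((f y)%:E * (p s * ker a (s - y) * g s)%:E)%E)) => //.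
    by move=> s _; rewrite -EFinM; congr EFin; rewrite /h/=; ring.
  by apply: integrableZl => //; exact: (integrable_bmM _ (ipr _ Dy) bg).
apply: (@le_lt_trans _ _ (\int[mu]_(x in D) ((N * M * kerprim a T)%:E * (p x)%:E))%E).
  apply: ge0_le_integral_gen => //.
  - by move=> x _; apply: integral_ge0 => y _; rewrite lee_fin.
  - by move=> x Dx; apply: (le_trans (mabs x Dx)); rewrite -EFinM mulrC.
rewrite ge0_integralZl//.
- by rewrite -Rintegral_fin// -EFinM ltry.
- exact: measurable_int ip.
- by move=> x _; rewrite lee_fin.
- by rewrite lee_fin !mulr_ge0// kerprim_ge0.
Qed.

End convolution.

Section fractional_integral.
Context {R : realType}.
Variable T : R.
Hypothesis T0 : 0 <= T.
Local Notation mu := (@lebesgue_measure R).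
Local Notation D := `[0, T]%classic.
Local Notation kconv := (@kconv R T).
Implicit Types (f g k p : R -> R).

Lemma kconv_kconv a b M f tau : 0 < a <= 1 -> 0 < b <= 1 -> a + b <= 1 -> bm M f -> tau <= T ->
  kconv b (kconv a f) tau = beta a b * kconv (a + b) f tau.
Proof.
move=> a01 b01 ab1 bf tauT.
have ab01 : 0 < a + b <= 1 by rewrite ab1 andbT; case/andP: a01 => ? _; case/andP: b01 => ? _; lra.
rewrite {1}/kconv.
transitivity (\int[mu]_(s in D) (ker b (tau - s) * 1 * kconv a f s)).
  by apply: eq_Rintegral => s _; rewrite mulr1.
rewrite (@kconv_fubini _ T a M 1 f (fun=> 1) (fun s => ker b (tau - s)) a01 T0 bf bm_cst1).
- rewrite /kconv -RintegralZl//; last exact: (integrable_kconv _ _ ab01 bf).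
  apply: eq_Rintegral => r; rewrite inE/= in_itv/= => /andP[r0 rT].
  under eq_Rintegral do rewrite mulr1.
  by rewrite /Rintegral integral_ker_ker//=; ring.
- exact: measurable_ker_refl.
- by move=> s; exact: ker_ge0.
- exact: integrable_ker_refl.
- by move=> r /=; rewrite in_itv/= => /andP[r0 rT]; rewrite integral_ker_ker// ltry.
Qed.

Lemma kconv1E f tau : tau \in `[0, T] -> kconv 1 f tau = \int[mu]_(s in `[0, tau]) f s.
Proof.
rewrite in_itv/= => /andP[tau0 tauT]; congr fine.
apply: (@integral_off2 _ _ _ _ _ tau tau) => s st _; rewrite !patchE.
have [s0|s0] := leP 0 s; last first.
  by rewrite !memNset//= in_itv/= => /andP[]; rewrite leNgt s0.
have [sT|sT] := ltP s tau.
  rewrite !mem_set ?ker_gt0 ?subr_gt0//= ?in_itv/= ?s0/= ?(ltW sT)//; last first.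
    by rewrite (le_trans (ltW sT)).
  by rewrite subrr powRr0 mul1r.
rewrite [in RHS]memNset; last first.
  by rewrite /= in_itv/= s0/= leNgt lt_neqAle eq_sym st sT.
by case: ifP => // _; rewrite ker_le0 ?mul0r// subr_le0.
Qed.

Lemma ker_le a (u v : R) : a <= 1 -> 0 < u -> u <= v -> ker a v <= ker a u.
Proof.
move=> a1 u0 uv; have v0 := lt_le_trans u0 uv.
rewrite !ker_gt0// -(opprB 1 a) !powRN lef_pV2 ?posrE ?powR_gt0//.
by apply: ge0_ler_powR; rewrite ?nnegrE ?subr_ge0// ltW.
Qed.

Lemma kconv_hoelder a M f (t t' : R) : 0 < a <= 1 -> bm M f ->
  `|kconv a f t' - kconv a f t| <= 3 * M * kerprim a `|t' - t|.
Proof.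
move=> a01 bf; have M0 := bm_ge0 bf; have [a0 a1] := andP a01.
wlog tt' : t t' / t <= t'.
  move=> h; have [/h//|/ltW/h] := leP t t'.
  by move=> h'; rewrite distrC (distrC t').
rewrite [`|t' - t|]ger0_norm ?subr_ge0//.
have k1 := @integrable_ker_refl R a t 0 T a01; have k2 := @integrable_ker_refl R a t' 0 T a01.
have i3 := integrable_bmM (measurable_itv _) k2 (bm_indic (measurable_itv `[t, t'])).
have i4 := integrable_scale 2 (measurable_itv _) i3.
have i5 := integrable_sub (measurable_itv _) k1 k2.
(* the kernel at t' falls below the kernel at t, except between t and t' *)
apply: (le_trans (Rintegral_dist_le _ k1 k2 (integrable_add _ i5 i4) bf _)) => //.
  move=> s _; rewrite indicE; have [st|ts] := ltP s t.
    rewrite memNset; last by rewrite /= in_itv/= leNgt st.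
    rewrite mulr0 mulr0 addr0 distrC ger0_norm// subr_ge0 ker_le ?subr_gt0//; lra.
  rewrite (@ker_le0 _ a (t - s)) ?subr_le0// subr0 sub0r ger0_norm ?ker_ge0//.
  have [st'|st'] := leP s t'; last first.
    have -> : ker a (t' - s) = 0 by rewrite ker_le0// subr_le0 ltW.
    by rewrite mul0r mulr0 oppr0 addr0.
  rewrite mem_set /= ?in_itv/= ?ts ?st'// mulr1; have := ker_ge0 a (t' - s); lra.
rewrite -mulrA mulrCA ler_wpM2l// RintegralD// RintegralB// !Rintegral_ker_refl// !subr0 RintegralZl//.
have h1 : kerprim a t <= kerprim a t' := le_kerprim a0 tt'.
have h2 := kerprim_hoelder (t' - T) (t - T) a01.
have h3 := ler_norm (kerprim a (t' - T) - kerprim a (t - T)).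
have h4 : `|t' - T - (t - T)| = t' - t by rewrite (_ : _ - _ = t' - t); [rewrite ger0_norm ?subr_ge0|ring].
rewrite h4 in h2.
have h5 := Rintegral_indic_le (measurable_itv _) (measurable_itv `[t, t'])
  (fun s => ker_ge0 a (t' - s)) i3 (@integrable_ker_refl R a t' t t' a01).
rewrite Rintegral_ker_refl// subrr (@kerprim_le0 _ _ 0)// subr0 in h5.
lra.
Qed.

Lemma continuous_kconv a M f : 0 < a <= 1 -> bm M f -> continuous (kconv a f).
Proof.
move=> a01 bf t; have a0 : 0 < a by case/andP: a01.
have M0 : 0 <= 3 * M by rewrite mulr_ge0// (bm_ge0 bf).
apply/cvgrPdist_le => e e0; have [dl dl0 h] := kerprim_small_mul a0 M0 e0.
exists dl => //= t' /= tt'; exact: le_trans (kconv_hoelder _ _ a01 bf) (h _ tt').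
Qed.

Lemma measurable_kconv a M f : 0 < a <= 1 -> bm M f -> measurable_fun setT (kconv a f).
Proof. by move=> a01 bf; apply: continuous_measurable_fun; exact: continuous_kconv bf. Qed.

Lemma bm_kconv a M f : 0 < a <= 1 -> bm M f -> bm (M * kerprim a T) (kconv a f).
Proof.
move=> a01 bf; split; first exact: measurable_kconv bf.
move=> t; apply: (le_trans (kconv_le _ a01 T0 bf)); rewrite ler_wpM2l ?(bm_ge0 bf)//.
apply: (le_trans (ler_norm _)); apply: (le_trans (kerprim_hoelder _ _ a01)).
by rewrite opprB addrC subrK ger0_norm.
Qed.

(** The two densities differ only between t and t', where the kernel has mass at most
    kerprim a |t' - t|. *)
Lemma kconv_upto_dist a M f (t t' xi : R) : 0 < a <= 1 -> bm M f ->
  `|kconv a (upto t' f) xi - kconv a (upto t f) xi| <= M * kerprim a `|t' - t|.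
Proof.
move=> a01 bf; have M0 := bm_ge0 bf; have [a0 a1] := andP a01.
wlog tt' : t t' / t <= t'.
  move=> h; have [/h//|/ltW/h] := leP t t'.
  by move=> h'; rewrite distrC (distrC t').
rewrite -(kconvB _ _ a01 (bm_upto t' bf) (bm_upto t bf)).
have -> : kconv a (fun s => upto t' f s - upto t f s) xi =
    \int[mu]_(s in D) ((ker a (xi - s) * \1_(`[t, t']) s) * (upto t' f s - upto t f s)).
  apply: eq_Rintegral => s _; rewrite indicE.
  have [st|ts] := ltP s t; first by rewrite /upto st (lt_le_trans st tt') subrr !mulr0.
  have [st'|t's] := ltP s t'; first by rewrite mem_set ?mulr1//= in_itv/= ts ltW.
  by rewrite /upto !ltNge ts t's/= subrr !mulr0.
have bc : bm M (fun s => upto t' f s - upto t f s).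
  split.
    by apply: measurable_funB; [case: (bm_upto t' bf)|case: (bm_upto t bf)].
  move=> s; have [_ bs] := bf; rewrite /upto; have [st|ts] := ltP s t.
    by rewrite (lt_le_trans st tt') subrr normr0.
  by rewrite subr0; case: ifP => // _; rewrite normr0.
have ik := integrable_bmM (measurable_itv _) (@integrable_ker_refl R a xi 0 T a01)
  (bm_indic (measurable_itv `[t, t'])).
apply: (le_trans (le_Rintegral_bmM _ ik _ bc)) => //.
  by move=> s _; rewrite mulr_ge0 ?ker_ge0// indicE ler0n.
rewrite ler_wpM2l//; apply: (le_trans (Rintegral_indic_le _ _ _ ik _)) => //.
- by move=> s; exact: ker_ge0.
- exact: integrable_ker_refl.
rewrite Rintegral_ker_refl//; apply: (le_trans (ler_norm _)).
apply: (le_trans (kerprim_hoelder _ _ a01)).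
by rewrite (_ : xi - t - (xi - t') = t' - t)//; ring.
Qed.

(** The kernel of [integral_moebius]: up to its constant, it expresses the values after t of
    a function with zero fractional derivative after t by the values before t. *)
Let mker a (t xi s : R) := ker (1 - a) (t - s) * ker 0 (xi - s).

Lemma integrable_mker a (t xi : R) : 0 < a < 1 -> t < xi ->
  mu.-integrable D (fun s => (mker a t xi s)%:E).
Proof.
move=> /andP[a0 a1] txi; have b01 : 0 < 1 - a <= 1 by apply/andP; split; lra.
have bg : bm (xi - t)^-1 (upto t (fun s => ker 0 (xi - s))).
  split.
    apply: measurable_fun_ifT => //; first exact: measurable_fun_ltr.
    exact: measurable_ker_refl.
  move=> s; rewrite /upto; case: ifPn => [st|_]; last first.
    by rewrite normr0 invr_ge0 subr_ge0 ltW.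
  rewrite ger0_norm ?ker_ge0// ker_gt0; last by lra.
  by rewrite sub0r powR_inv1; [rewrite lef_pV2 ?posrE; lra|lra].
have := integrable_bmM (measurable_itv _) (@integrable_ker_refl R (1 - a) t 0 T b01) bg.
apply: eq_integrable => // s _; congr EFin; rewrite /mker /upto.
by case: (ltP s t) => // ts; rewrite ker_le0 ?mul0r// subr_le0.
Qed.

Lemma integral_mker_ker a (t xi r : R) : 0 < a < 1 -> t <= T -> t < xi -> 0 <= r ->
  (\int[mu]_(s in D) (mker a t xi s * ker a (s - r))%:E =
   (if r < t then beta a (1 - a) * ((xi - t) `^ a)^-1 * (xi - r) `^ (a - 1) else 0)%:E)%E.
Proof.
move=> a01 tT txi r0; case: ifPn => rt; first by rewrite integral_moebius.
rewrite -leNgt in rt; rewrite integral0_eq// => s _; rewrite /mker.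
have [sr|rs] := leP s r; first by rewrite (@ker_le0 _ a (s - r)) ?mulr0// subr_le0.
by rewrite ker_le0 ?mul0r//; lra.
Qed.

(** By [integral_moebius], integrating a fractional integral against this kernel reproduces,
    up to a factor, the fractional integral of the density cut at t. *)
Lemma kconv_uptoE a M f (t xi : R) : 0 < a < 1 -> bm M f -> t <= T -> t < xi ->
  \int[mu]_(s in D) (mker a t xi s * kconv a f s) =
  beta a (1 - a) * ((xi - t) `^ a)^-1 * kconv a (upto t f) xi.
Proof.
move=> a01' bf tT txi; have [a0 a1] := andP a01'.
have a01 : 0 < a <= 1 by rewrite a0 ltW.
transitivity (\int[mu]_(s in D) (mker a t xi s * 1 * kconv a f s)).
  by apply: eq_Rintegral => s _; rewrite mulr1.
rewrite (@kconv_fubini _ T a M 1 f (fun=> 1) (mker a t xi) a01 T0 bf bm_cst1).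
- rewrite /kconv -RintegralZl//; last exact: (integrable_kconv _ _ a01 (bm_upto t bf)).
  apply: eq_Rintegral => r; rewrite inE/= in_itv/= => /andP[r0 rT].
  under eq_Rintegral do rewrite mulr1.
  rewrite /Rintegral integral_mker_ker//= /upto; case: ifPn => rt; last by rewrite !mulr0.
  by rewrite ker_gt0; [ring|lra].
- by apply: measurable_funM; exact: measurable_ker_refl.
- by move=> s; rewrite mulr_ge0 ?ker_ge0.
- exact: integrable_mker.
- by move=> r /=; rewrite in_itv/= => /andP[r0 rT]; rewrite integral_mker_ker// ltry.
Qed.

(** On the support s < t one has t^(a-1) <= s^(a-1), so the mass is compared with the case r
    = 0 of the Moebius formula, which is explicit, and there xi^(a-1) <= t^(a-1). *)
Lemma mker_mass a (t xi : R) : 0 < a < 1 -> 0 < t -> t <= T -> t < xi ->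
  \int[mu]_(s in D) mker a t xi s <= beta a (1 - a) * ((xi - t) `^ a)^-1.
Proof.
move=> a01' t0 tT txi; have [a0 a1] := andP a01'.
have a01 : 0 < a <= 1 by rewrite a0 ltW.
have b01 : 0 < 1 - a <= 1 by apply/andP; split; lra.
have ta0 : 0 < t `^ (a - 1) by rewrite powR_gt0.
rewrite -(ler_pM2l ta0) -RintegralZl//; last exact: integrable_mker.
apply: (@le_trans _ _ (beta a (1 - a) * ((xi - t) `^ a)^-1 * (xi - 0) `^ (a - 1))); last first.
  rewrite subr0 mulrC ler_wpM2r//.
    by rewrite mulr_ge0 ?invr_ge0 ?powR_ge0// ltW// beta_gt0.
  by have := ker_le (ltW a1) t0 (ltW txi); rewrite !ker_gt0// (lt_trans t0).
have -> : beta a (1 - a) * ((xi - t) `^ a)^-1 * (xi - 0) `^ (a - 1) =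
   fine (\int[mu]_(s in D) (mker a t xi s * ker a (s - 0))%:E)%E.
  by rewrite integral_mker_ker// t0.
apply: fine_le.
- apply: integrable_fin_num => //.
  by apply: integrable_scale => //; exact: integrable_mker.
- by rewrite integral_mker_ker.
have -> : (\int[mu]_(s in D) (t `^ (a - 1) * mker a t xi s)%:E =
           \int[mu]_(s in `]0%R, T]) (t `^ (a - 1) * mker a t xi s)%:E)%E.
  apply: (@integral_off2 _ _ _ _ _ 0 0) => s s0 _; rewrite !patchE.
  suff -> : (s \in `[0, T]%classic) = (s \in `]0, T]%classic) by [].
  by apply/idP/idP; rewrite !inE/= !in_itv/= (lt_neqAle 0) (eq_sym 0) s0.
have -> : (\int[mu]_(s in D) (mker a t xi s * ker a (s - 0))%:E =
           \int[mu]_(s in `]0%R, T]) (mker a t xi s * ker a (s - 0))%:E)%E.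
  apply: (@integral_off2 _ _ _ _ _ 0 0) => s s0 _; rewrite !patchE.
  suff -> : (s \in `[0, T]%classic) = (s \in `]0, T]%classic) by [].
  by apply/idP/idP; rewrite !inE/= !in_itv/= (lt_neqAle 0) (eq_sym 0) s0.
apply: ge0_le_integral_gen.
  by move=> s _; rewrite lee_fin !mulr_ge0 ?ker_ge0// ltW.
move=> s /=; rewrite in_itv/= => /andP[s0 sT]; rewrite lee_fin mulrC subr0.
have [st|ts] := ltP s t; last by rewrite /mker ker_le0 ?mul0r// subr_le0.
rewrite ler_wpM2l ?mulr_ge0 ?ker_ge0//.
by have := ker_le (ltW a1) s0 (ltW st); rewrite (ker_gt0 _ t0).
Qed.

(** A maximum principle: after time t, a function continued with zero fractional derivative
    is an average of its past, with a kernel of mass at most one. Hence stopping does not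
    increase the uniform norm of paths that start from zero. *)
Lemma kconv_upto_le a M f (t xi E : R) : 0 < a < 1 -> bm M f -> 0 <= t -> t <= T -> t < xi ->
  (forall s, 0 <= s <= t -> `|kconv a f s| <= E) -> `|kconv a (upto t f) xi| <= E.
Proof.
move=> a01' bf; rewrite le_eqVlt => /predU1P[<-|t0] tT txi fE; have [a0 a1] := andP a01'.
  have E0 : 0 <= E by apply: (le_trans _ (fE 0 _)); rewrite ?lexx.
  suff -> : kconv a (upto 0 f) xi = 0 by rewrite normr0.
  rewrite /kconv /Rintegral integral0_eq// => s /=; rewrite in_itv/= => /andP[s0 _].
  by rewrite /upto ltNge s0 mulr0.
have E0 : 0 <= E.
  by apply: (le_trans (normr_ge0 (kconv a f 0))); apply: fE; rewrite lexx ltW.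
have a01 : 0 < a <= 1 by rewrite a0 ltW.
have b01 : 0 < 1 - a <= 1 by apply/andP; split; lra.
have B0 := beta_gt0 a01 b01.
pose K := beta a (1 - a) * ((xi - t) `^ a)^-1.
have K0 : 0 < K by rewrite mulr_gt0// invr_gt0 powR_gt0// subr_gt0.
rewrite -(ler_pM2l K0) -{1}(ger0_norm (ltW K0)) -normrM -(kconv_uptoE a01' bf tT txi).
pose g s := if s <= t then (if 0 <= s then kconv a f s else 0) else 0.
have bg : bm E g.
  split.
    apply: measurable_fun_ifT => //; first exact: measurable_fun_ler.
    apply: measurable_fun_ifT => //; first exact: measurable_fun_ler.
    exact: measurable_kconv bf.
  move=> s; rewrite /g; case: ifPn => st; last by rewrite normr0.
  by case: ifPn => s0; [rewrite fE ?s0|rewrite normr0].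
have -> : \int[mu]_(s in D) (mker a t xi s * kconv a f s) = \int[mu]_(s in D) (mker a t xi s * g s).
  apply: eq_Rintegral => s; rewrite inE/= in_itv/= => /andP[s0 sT]; rewrite /g s0.
  by case: leP => // ts; rewrite /mker ker_le0 ?mul0r// subr_le0 ltW.
have ip := integrable_mker a01' txi.
apply: (le_trans (le_Rintegral_bmM _ ip _ bg)) => //.
  by move=> s _; rewrite mulr_ge0 ?ker_ge0.
by rewrite mulrC ler_wpM2r// mker_mass.
Qed.

(** Lebesgue differentiation. *)
Lemma kconv1_derive M f : bm M f ->
  {ae mu, forall x, 0 < x < T -> is_derive x 1 (kconv 1 f) (f x)}.
Proof.
move=> bf.
have int y : mu.-integrable `[0, y] (EFin \o f) by exact: integrable_bm bf.
have loc : locally_integrable [set: R] f.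
  split.
  - by case: bf.
  - exact: openT.
  - move=> K _ /compact_bounded[A [_ /(_ (A + 1)) hA]].
    have KA x : K x -> x \in `[- (A + 1), A + 1]%classic.
      move=> Kx; rewrite inE/= in_itv/= -ler_norml; apply: hA => //.
      by rewrite ltrDl.
    have /integrableP[_] := integrable_bm (- (A + 1)) (A + 1) bf.
    apply: le_lt_trans; rewrite integral_mkcond [leRHS]integral_mkcond.
    apply: ge0_le_integral_gen => x _; rewrite !patchE; first by case: ifP => // _; rewrite lee_fin.
    case: ifPn => [/set_mem/KA ->//|_]; case: ifP => // _; rewrite /= lee_fin//.
have := FTC1 int loc; apply: filterS; first exact: (ae_filter_ringOfSetsType mu).
move=> x h /andP[x0 xT].
case: h => [|h1 h2]; first by rewrite /= lte_fin.
have nE : \forall y \near x, (fun x : R => \int[mu]_(t in `[0, x]) f t) y = kconv 1 f y.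
  near=> y; rewrite kconv1E// in_itv/=; apply/andP; split; apply: ltW.
    by near: y; exact: lt_nbhsr.
  by near: y; exact: lt_nbhsl.
split; first exact: near_eq_derivable nE h1.
rewrite -h2 derive1E; apply/esym; exact: near_eq_derive.
Unshelve. all: by end_near. Qed.

End fractional_integral.

(** * Paths, densities and stopping *)

Section ae_lebesgue.
Context {R : realType}.
Local Notation mu := (@lebesgue_measure R).

Lemma aeS (P Q : R -> Prop) : (forall x, P x -> Q x) ->
  {ae mu, forall x, P x} -> {ae mu, forall x, Q x}.
Proof. by move=> PQ; apply: (@filterS _ _ (ae_filter_ringOfSetsType mu)). Qed.

Lemma aeI (P Q : R -> Prop) :
  {ae mu, forall x, P x} -> {ae mu, forall x, Q x} -> {ae mu, forall x, P x /\ Q x}.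
Proof. exact: (@filterI _ _ (ae_filter_ringOfSetsType mu)). Qed.

End ae_lebesgue.

(** The function a (. | t, x) as an element of the space. The alternative branch never
    occurs, since the fractional derivative cut at t is a bounded density. The definition is
    locked to keep simplification from unfolding it. *)
HB.lock Definition stop (R : realType) (n : nat) (T alpha t : R) (x : ACa n T alpha) :
    ACa n T alpha :=
  if pselect (exists y : ACa n T alpha, forall tau, tau \in `[0, T] -> y tau = afun t x tau)
    is left h then sval (cid h) else x.

Section densities.
Context {R : realType} {n : nat} {T alpha : R}.
Hypotheses (T_gt0 : 0 < T) (alpha01 : 0 < alpha < 1).
Local Notation mu := (@lebesgue_measure R).
Local Notation V := 'rV[R]_n.
Local Notation AC := (ACa n T alpha).
Local Notation D := `[0, T]%classic.
Local Notation kconv := (@kconv R T).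
Implicit Types (x y : AC) (f g : R -> V).

Let T0 : 0 <= T. Proof. exact: ltW. Qed.
Let a0 : 0 < alpha. Proof. by case/andP: alpha01. Qed.
Let a1 : alpha < 1. Proof. by case/andP: alpha01. Qed.
Let a01 : 0 < alpha <= 1. Proof. by rewrite a0 ltW. Qed.
Let b01 : 0 < 1 - alpha <= 1.
Proof. by apply/andP; split; [rewrite subr_gt0|rewrite lerBlDr lerDl ltW]. Qed.

Definition entry f (i : 'I_n) : R -> R := fun s => f s 0 i.

Definition bmv (M : R) f := forall i, bm M (entry f i).

Lemma le_enorm (v : V) i : `|v 0 i| <= enorm v.
Proof.
rewrite /enorm /dotv -(sqrtr_sqr (v 0 i)) ler_wsqrtr// (bigD1 i)//= -expr2 lerDl.
by apply: sumr_ge0 => j _; rewrite -expr2 sqr_ge0.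
Qed.

Lemma enorm_le_sum (v : V) : enorm v <= \sum_i `|v 0 i|.
Proof.
rewrite -[leRHS]ger0_norm ?sumr_ge0// -sqrtr_sqr ler_wsqrtr//.
rewrite expr2 mulr_suml ler_sum// => i _.
rewrite -expr2 -real_normK ?num_real// expr2 ler_wpM2l//.
by rewrite (bigD1 i)//= lerDl sumr_ge0.
Qed.

Lemma enorm_le_const (v : V) (C : R) : (forall i, `|v 0 i| <= C) -> enorm v <= n%:R * C.
Proof.
move=> vC; apply: (le_trans (enorm_le_sum _)).
by rewrite -[n in n%:R]card_ord mulr_natl -sumr_const; apply: ler_sum.
Qed.

Lemma ker_inv a (u : R) : a != 1 -> 0 <= u -> ((u `^ (1 - a))^-1) = ker a u.
Proof.
move=> a1'; rewrite le_eqVlt => /predU1P[<-|u0].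
  rewrite powR0 ?invr0 ?ker_le0// subr_eq0 eq_sym//.
by rewrite ker_gt0// -powRN opprB.
Qed.

Definition aeD f g := {ae mu, forall s, s \in `[0, T] -> f s = g s}.

Lemma frac_integralE f g (s tau : R) i : aeD f g -> 0 <= s -> s <= tau -> tau <= T ->
  frac_integral alpha s tau f 0 i = (Gamma alpha)^-1 * kconv alpha (upto s (entry g i)) tau.
Proof.
move=> [N [mN N0 fgN]] s0 stau tauT; rewrite mxE; congr (_ * _).
rewrite /vintegral mxE /kconv /Rintegral; congr fine.
apply: (@integral_ae _ (measurableTypeR R) R mu _ _ _ _ (N `|` [set s])).
- by apply: measurableU => //; exact: measurable_set1.
- apply/eqP; rewrite -measure_le0 (le_trans (measureU2 _ _ _))//=; last first.
    by rewrite [mu N]N0 add0e lebesgue_measure_set1.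
move=> xi /not_orP[xiN /= xis]; rewrite !patchE.
have [xi0|xi0] := leP 0 xi; last first.
  by rewrite !memNset//= in_itv/= => /andP[]; rewrite leNgt xi0.
have [xs|xs] := ltP xi s; last first.
  rewrite memNset; last by rewrite /= in_itv/= xi0/= => xs'; apply: xis; apply/eqP; rewrite eq_le xs'.
  by case: ifP => // _; rewrite /upto ltNge xs mulr0.
have xT : xi <= T by rewrite (le_trans (ltW xs))// (le_trans stau).
rewrite !mem_set /= ?in_itv/= ?xi0 ?xT ?(ltW xs)// /upto xs /entry mxE.
rewrite ker_inv ?subr_ge0 ?(lt_eqF a1)//; last by rewrite (le_trans (ltW xs)).
congr (_ * _)%:E; congr (fun_of_matrix _ _ _).
by apply: contrapT => fg; apply: xiN; apply: fgN => /= h; apply: fg; apply: h; rewrite in_itv/= xi0.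
Qed.

Lemma kconv_upto_self a (f : R -> R) (t tau : R) : tau <= t -> kconv a (upto t f) tau = kconv a f tau.
Proof.
move=> taut; apply: eq_Rintegral => s _; rewrite /upto; case: ltP => // ts.
by rewrite ker_le0 ?mul0r// subr_le0 (le_trans taut).
Qed.

Definition dens (M : R) f x := bmv M f /\
  forall tau i, tau \in `[0, T] ->
    x tau 0 i = x 0 0 i + (Gamma alpha)^-1 * kconv alpha (entry f i) tau.

(** Clipping each entry at the essential bound gives a representative that is bounded and
    measurable on the whole line, so that no exceptional set has to be carried along. *)
Lemma bmv_exists f : ess_bounded_measurable T f ->
  exists M, exists2 g, bmv M g & aeD f g.
Proof.
move=> [mf [M hM]]; pose M' := Num.max M 0.
have M'0 : 0 <= M' by rewrite le_max lexx orbT.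
pose g s : V := if s \in `[0, T] then \row_i Num.max (- M') (Num.min M' (f s 0 i)) else 0.
exists M', g.
  move=> i; split.
    have -> : entry g i = ((fun s => Num.max (- M') (Num.min M' (f s 0 i))) \_ D).
      by apply/funext => s; rewrite patchE mem_setE /entry /g; case: ifP; rewrite mxE.
    apply/(measurable_restrictT (fun s => Num.max (- M') (Num.min M' (f s 0 i)))) => //.
    by apply: measurable_maxr => //; apply: measurable_minr.
  move=> s; rewrite /entry /g; case: ifP => _; rewrite mxE ?normr0//.
  by rewrite ler_norml le_max lexx/= ge_max ge_min lexx/= andbT; lra.
apply: aeS hM => s hs sT; apply/rowP => i; rewrite /g sT mxE.
have : `|f s 0 i| <= M' by rewrite (le_trans (le_enorm _ i))// (le_trans (hs sT))// le_max lexx.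
rewrite ler_norml => /andP[h1 h2].
by rewrite (min_idPr h2) (max_idPr h1).
Qed.

Lemma dens_exists x : exists M f, dens M f x.
Proof.
case: (ACa_repr x) => f /bmv_exists[M [g bg fg]] xE.
exists M, g; split => // tau i tauT; rewrite {1}xE// mxE; congr (_ + _).
move: tauT; rewrite in_itv/= => /andP[tau0 tauT].
by rewrite (frac_integralE _ fg)// kconv_upto_self.
Qed.

(** The semigroup law with orders that add up to one: integrating the path to order 1 -
    alpha gives the primitive of its density. *)
Lemma kconv_increment x M f (s : R) i : dens M f x -> s \in `[0, T] ->
  kconv (1 - alpha) (fun xi => x xi 0 i - x 0 0 i) s = Gamma (1 - alpha) * kconv 1 (entry f i) s.
Proof.
move=> [bf xE] sT; have [G1 G2 GB] := Gamma_mul alpha01.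
have -> : kconv (1 - alpha) (fun xi => x xi 0 i - x 0 0 i) s =
    kconv (1 - alpha) (fun xi => (Gamma alpha)^-1 * kconv alpha (entry f i) xi) s.
  apply: eq_Rintegral => xi; rewrite inE/= => xiT.
  by rewrite xE// [X in _ * (X - _)]addrC addrK.
have -> : kconv (1 - alpha) (fun xi => (Gamma alpha)^-1 * kconv alpha (entry f i) xi) s =
    (Gamma alpha)^-1 * kconv (1 - alpha) (kconv alpha (entry f i)) s.
  rewrite /kconv -RintegralZl//.
    by apply: eq_Rintegral => xi _; rewrite mulrCA.
  exact: (integrable_kconv _ _ b01 (bm_kconv T0 a01 (bf i))).
have sT' : s <= T by move: sT; rewrite in_itv/= => /andP[].
rewrite (kconv_kconv T0 a01 b01 _ (bf i) sT'); last by rewrite addrC subrK.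
have -> : alpha + (1 - alpha) = 1 by ring.
by rewrite -GB mulrA mulKf// gt_eqF.
Qed.

Lemma kconv1_entry_derive M f : bmv M f ->
  {ae mu, forall s, s \in `[0, T] -> [/\ 0 < s, s < T &
    forall i, is_derive s (1 : R) (kconv 1 (entry f i)) (f s 0 i)]}.
Proof.
move=> bf.
have H : {ae mu, forall s, forall i, 0 < s < T ->
    is_derive s (1 : R) (kconv 1 (entry f i)) (entry f i s)}.
  have Hi i := kconv1_derive T (bf i).
  exact: (@filter_forall _ 'I_n _ (almost_everywhere mu) (ae_filter_ringOfSetsType mu) Hi).
have H0 : {ae mu, forall s : R, s != 0 /\ s != T}.
  exists [set 0; T]; split.
  - by apply: measurableU; exact: measurable_set1.
  - by apply: countable_lebesgue_measure0; apply: finite_set_countable; exact: finite_set2.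
  - move=> s /= h; apply: contrapT => /not_orP[s0 sT]; apply: h.
    by split; apply/eqP.
apply: aeS (aeI H H0) => s [hs [s0 sT]]; rewrite in_itv/= => /andP[s0' sT'].
have {}s0 : 0 < s by rewrite lt_neqAle eq_sym s0.
have {}sT : s < T by rewrite lt_neqAle sT.
by split=> // i; apply: hs; rewrite s0.
Qed.

(** By [kconv_increment] the function differentiated in the Caputo derivative is the
    primitive of the density, and Lebesgue differentiation applies; the Gamma factors
    cancel. *)
Lemma dens_caputo x M f : dens M f x -> aeD (caputo alpha x) f.
Proof.
move=> df; have [bf _] := df; have [G1 G2 GB] := Gamma_mul alpha01.
apply: aeS (kconv1_entry_derive bf) => s hs /hs[s0 sT {}hs].
pose F (u : R) : V := \row_i (Gamma (1 - alpha) * kconv 1 (entry f i) u).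
have dF i : is_derive s 1 (fun u => F u 0 i) (Gamma (1 - alpha) * f s 0 i).
  have -> : (fun u => F u 0 i) = (Gamma (1 - alpha)) \*: (kconv 1 (entry f i)).
    by apply/funext => u; rewrite mxE.
  exact: is_deriveZ.
have nE : \forall u \near s, vintegral `[0, u]
       (fun xi => ((u - xi) `^ alpha)^-1 *: (x xi - x 0)) = F u.
  near=> u; apply/rowP => i; rewrite !mxE.
  have u0 : 0 < u by near: u; exact: lt_nbhsr.
  have uT : u < T by near: u; exact: lt_nbhsl.
  rewrite -(kconv_increment i df) ?in_itv/= ?ltW//.
  congr fine; apply: (@integral_off2 _ _ _ _ _ u u) => xi xiu _; rewrite !patchE.
  have [xi0|xi0] := leP 0 xi; last first.
    by rewrite !memNset//= in_itv/= => /andP[]; rewrite leNgt xi0.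
  have [xs|xs] := ltP xi u; last first.
    rewrite memNset; last by rewrite /= in_itv/= xi0/= => xs'; move/eqP: xiu; apply; apply/eqP; rewrite eq_le xs'.
    by case: ifP => // _; rewrite ker_le0 ?mul0r// subr_le0.
  rewrite !mem_set /= ?in_itv/= ?xi0 ?(ltW xs) ?(ltW (lt_trans xs uT))// !mxE.
  rewrite -ker_inv ?subr_ge0 ?(ltW xs)//; last by rewrite lt_eqF// gtrBl.
  by have -> : 1 - (1 - alpha) = alpha by ring.
rewrite /caputo derive1E (near_eq_derive _ nE) derive_mx; last first.
  by apply/derivable_mxP => i' j; rewrite (ord1 i'); have [] := dF j.
apply/rowP => i; rewrite !mxE; have [_ ->] := dF i.
by rewrite mulKf// gt_eqF.
Unshelve. all: by end_near. Qed.

Lemma afunE t x M f tau i : dens M f x -> tau \in `[0, T] ->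
  afun t x tau 0 i = x 0 0 i + (Gamma alpha)^-1 * kconv alpha (upto t (entry f i)) tau.
Proof.
move=> df tauT; have [bf xE] := df; rewrite /afun; case: leP => taut.
  by rewrite xE// kconv_upto_self.
move: (tauT); rewrite in_itv/= => /andP[tau0 tauT']; rewrite mxE; congr (_ + _).
have [t0|t0] := leP 0 t; first by rewrite (frac_integralE _ (dens_caputo df))// ltW.
rewrite mxE /vintegral mxE set_itv_ge; last by rewrite bnd_simp -ltNge.
rewrite Rintegral_set0; congr (_ * _); apply/esym; rewrite /kconv /Rintegral integral0_eq// => s /=.
rewrite in_itv/= => /andP[s0 _]; rewrite /upto ltNge (le_trans (ltW t0) s0) mulr0//.
Qed.

Lemma entry_upto t f i : entry (upto t f) i = upto t (entry f i).
Proof. by apply/funext => s; rewrite /entry /upto; case: ifP => _ //; rewrite mxE. Qed.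

Lemma bmv_upto t M f : bmv M f -> bmv M (upto t f).
Proof. by move=> bf i; rewrite entry_upto; exact: bm_upto. Qed.

Lemma kconv_0 a (f : R -> R) : kconv a f 0 = 0.
Proof.
rewrite /kconv /Rintegral integral0_eq// => s /=; rewrite in_itv/= => /andP[s0 _].
by rewrite ker_le0 ?mul0r// sub0r oppr_le0.
Qed.

Lemma in0 : (0 : R) \in `[0, T]. Proof. by rewrite in_itv/= lexx. Qed.

Lemma ACa_eq x y : (forall tau, tau \in `[0, T] -> x tau = y tau) -> x = y.
Proof.
case: x => x xr xo; case: y => y yr yo /= xy.
have {}xy : x = y.
  by apply/funext => s; have [/xy//|sT] := boolP (s \in `[0, T]); rewrite xo ?yo.
by subst y; congr MkACa; exact: Prop_irrelevance.
Qed.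

Lemma ACa_of_dens (x0 : V) M f : bmv M f -> exists2 y : AC, dens M f y & y 0 = x0.
Proof.
move=> bf.
pose v tau : V := if tau \in `[0, T] then x0 + frac_integral alpha tau tau f else 0.
have vE tau i : tau \in `[0, T] -> v tau 0 i = x0 0 i + (Gamma alpha)^-1 * kconv alpha (entry f i) tau.
  move=> tauT; rewrite /v tauT mxE; congr (_ + _).
  move: (tauT); rewrite in_itv/= => /andP[tau0 tauT'].
  rewrite (@frac_integralE f f)//; last by apply: aeW.
  by rewrite kconv_upto_self.
have v0 : v 0 = x0.
  by apply/rowP => i; rewrite vE ?in0// kconv_0 mulr0 addr0.
have vr : exists2 f : R -> V, ess_bounded_measurable T f &
    forall tau, tau \in `[0, T] -> v tau = v 0 + frac_integral alpha tau tau f.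
  exists f; last by move=> tau tauT; rewrite v0 /v tauT.
  split; first by move=> i; exact: bm_measurable (bf i).
  exists (n%:R * M); apply: aeW => s _; apply: enorm_le_const => i.
  by have [_ h] := bf i; exact: (h s).
have vo tau : tau \notin `[0, T] -> v tau = 0 by rewrite /v => /negbTE ->.
exists (MkACa vr vo) => //=; split => //= tau i tauT.
by rewrite v0 vE.
Qed.

Let stop_spec t x M f : dens M f x -> exists2 y, dens M (upto t f) y &
  stop t x = y /\ forall tau, tau \in `[0, T] -> y tau = afun t x tau.
Proof.
move=> df; have [y dy y0] := ACa_of_dens (x 0) (bmv_upto t df.1).
have yE tau : tau \in `[0, T] -> y tau = afun t x tau.
  move=> tauT; apply/rowP => i; rewrite (afunE _ _ df)// dy.2// y0; congr (_ + _ * _).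
  apply: eq_Rintegral => s _; congr (_ * _).
  by rewrite /entry /upto; case: ifP => _; rewrite ?mxE.
exists y => //; split=> //; rewrite unlock; case: pselect => [h'|]; last by move=> h; case: h; exists y.
by case: (cid h') => /= z zE; apply: ACa_eq => tau tauT; rewrite zE// yE.
Qed.

Lemma dens_stop t x M f : dens M f x -> dens M (upto t f) (stop t x).
Proof. by move=> /(stop_spec t)[y dy [-> _]]. Qed.

Lemma stopE t x tau : tau \in `[0, T] -> stop t x tau = afun t x tau.
Proof.
have [M [f /(stop_spec t)[y _ [-> yE]]]] := dens_exists x; exact: yE.
Qed.

Lemma stop_past t x tau : tau \in `[0, T] -> tau <= t -> stop t x tau = x tau.
Proof. by move=> tauT taut; rewrite stopE// /afun taut. Qed.

Lemma stop0E t x : stop t x 0 = x 0.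
Proof.
have [M [f df]] := dens_exists x.
by rewrite stopE ?in0//; apply/rowP => i; rewrite (afunE _ _ df) ?in0// kconv_0 mulr0 addr0.
Qed.

Lemma stop_densE t x M f tau i : dens M f x -> tau \in `[0, T] ->
  stop t x tau 0 i = x 0 0 i + (Gamma alpha)^-1 * kconv alpha (upto t (entry f i)) tau.
Proof. by move=> df tauT; rewrite stopE// (afunE _ _ df). Qed.

Lemma stop_stop s t x : t <= s -> stop s (stop t x) = stop t x.
Proof.
move=> ts; apply: ACa_eq => tau tauT; apply/rowP => i; have [M [f df]] := dens_exists x.
rewrite (stop_densE _ _ (dens_stop t df))// stop0E (stop_densE _ _ df)//.
by rewrite entry_upto upto_upto.
Qed.

Lemma afun_stop s t x tau : t <= s -> tau \in `[0, T] -> afun s (stop t x) tau = stop t x tau.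
Proof. by move=> ts tauT; rewrite -stopE// stop_stop. Qed.

(** The maximum principle applies to the difference of the two paths minus its value at
    zero, which is bounded by 2 E on [0, t]; adding the value at zero back gives the third
    E. *)
Lemma stop_lip t x y i (E : R) : 0 <= t -> t <= T ->
  (forall s, 0 <= s <= t -> `|x s 0 i - y s 0 i| <= E) ->
  forall xi, xi \in `[0, T] -> `|stop t x xi 0 i - stop t y xi 0 i| <= 3 * E.
Proof.
move=> t0 tT xyE xi xiT.
have E0 : 0 <= E by apply: (le_trans (normr_ge0 _) (xyE 0 _)); rewrite lexx.
have [xit|txi] := leP xi t.
  rewrite (stop_past x xiT xit) (stop_past y xiT xit).
  apply: le_trans (xyE xi _) _; last by rewrite ler_peMl// ler1n.
  rewrite xit andbT; by move: xiT; rewrite in_itv/= => /andP[-> _].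
have [M [f df]] := dens_exists x; have [N [g dg]] := dens_exists y.
have [bf xE] := df; have [bg yE] := dg.
rewrite (stop_densE _ _ df)// (stop_densE _ _ dg)//.
pose h s := entry f i s - entry g i s.
have bh : bm (M + N) h by exact: bmB.
have hE : kconv alpha (upto t (entry f i)) xi - kconv alpha (upto t (entry g i)) xi =
    kconv alpha (upto t h) xi.
  rewrite -(kconvB _ _ a01 (bm_upto t (bf i)) (bm_upto t (bg i))).
  by congr kconv; apply/funext => s; rewrite /upto /h; case: ifP => // _; rewrite subr0.
have G0 : 0 < Gamma alpha := Gamma_gt0 alpha01.
have hb : `|kconv alpha (upto t h) xi| <= Gamma alpha * (2 * E).
  apply: (kconv_upto_le T0 alpha01 bh t0 tT txi) => s /andP[s0 st].
  have sT : s \in `[0, T] by rewrite in_itv/= s0 (le_trans st).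
  rewrite /h (kconvB _ _ a01 (bf i) (bg i)).
  have -> : kconv alpha (entry f i) s - kconv alpha (entry g i) s =
      Gamma alpha * ((x s 0 i - y s 0 i) - (x 0 0 i - y 0 0 i)).
    by rewrite xE// yE//; field; rewrite gt_eqF.
  rewrite normrM gtr0_norm// ler_pM2l//; apply: (le_trans (ler_normB _ _)).
  rewrite mulr2n mulrDl mul1r; apply: lerD; apply: xyE; rewrite ?s0 ?lexx//.
have -> : x 0 0 i + (Gamma alpha)^-1 * kconv alpha (upto t (entry f i)) xi -
    (y 0 0 i + (Gamma alpha)^-1 * kconv alpha (upto t (entry g i)) xi) =
    (x 0 0 i - y 0 0 i) + (Gamma alpha)^-1 * kconv alpha (upto t h) xi.
  by rewrite -hE; ring.
apply: (le_trans (ler_normD _ _)).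
have -> : 3 * E = E + (Gamma alpha)^-1 * (Gamma alpha * (2 * E)).
  by field; rewrite gt_eqF.
apply: lerD; first by apply: xyE; rewrite lexx.
have Gi : 0 <= (Gamma alpha)^-1 by rewrite invr_ge0 ltW.
by rewrite normrM (ger0_norm Gi) ler_wpM2l.
Qed.

Lemma stop_Y t x y : 0 <= t -> t <= T -> Y t x y -> stop t y = stop t x.
Proof.
move=> t0 tT xy; apply: ACa_eq => tau tauT; apply/rowP => i.
apply/eqP; rewrite -subr_eq0 -normr_le0 -[leRHS](mulr0 3); apply: stop_lip => // s st.
by rewrite xy ?in_itv//= subrr normr0.
Qed.

Lemma stop_time x M f (t t' : R) i xi : dens M f x -> xi \in `[0, T] ->
  `|stop t' x xi 0 i - stop t x xi 0 i| <= (Gamma alpha)^-1 * M * kerprim alpha `|t' - t|.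
Proof.
move=> df xiT; have [bf xE] := df; have G0 : 0 < Gamma alpha := Gamma_gt0 alpha01.
rewrite !(stop_densE _ _ df)// opprD addrACA subrr add0r -mulrBr normrM.
have Gi : 0 <= (Gamma alpha)^-1 by rewrite invr_ge0 ltW.
rewrite (ger0_norm Gi) -mulrA ler_wpM2l//.
exact: kconv_upto_dist (bf i).
Qed.

Lemma dens_hoelder x M f (t t' : R) i : dens M f x -> t \in `[0, T] -> t' \in `[0, T] ->
  `|x t' 0 i - x t 0 i| <= (Gamma alpha)^-1 * (3 * M) * kerprim alpha `|t' - t|.
Proof.
move=> df tT t'T; have [bf xE] := df; have G0 : 0 < Gamma alpha := Gamma_gt0 alpha01.
rewrite (xE t)// (xE t')// opprD addrACA subrr add0r -mulrBr normrM.
have Gi : 0 <= (Gamma alpha)^-1 by rewrite invr_ge0 ltW.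
rewrite (ger0_norm Gi) -mulrA ler_wpM2l//.
exact: kconv_hoelder (bf i).
Qed.

(** After t the stopped path has zero derivative. There the right-hand side of the
    inequality that defines X_k is still nonnegative, because the same inequality holds for
    x. *)
Lemma stop_Xset c k t x : Xset c k x -> Xset c k (stop t x).
Proof.
move=> [x0k xk]; split; first by rewrite stop0E.
have [M [f df]] := dens_exists x.
have H0 : {ae mu, forall s : R, s != t}.
  exists [set t]; split.
  - exact: measurable_set1.
  - exact: lebesgue_measure_set1.
  - by move=> s /= h; apply: contrapT => st; apply: h; apply/eqP.
have H1 := dens_caputo (dens_stop t df); have H2 := dens_caputo df.
have H3 := aeI (aeI H0 xk) (aeI H1 H2).
apply: aeS H3 => s [[st xks] [h1 h2]] sT; rewrite h1// /upto.
have [st'|ts] := ltP s t.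
  rewrite (stop_past _ sT (ltW st')) -(h2 sT); exact: xks.
rewrite enorm0.
have := le_trans (enorm_ge0 _) (xks sT); have := enorm_ge0 (x s); have := enorm_ge0 (stop t x s).
move=> h3 h4 h5; rewrite mulr_ge0 ?addr_ge0//.
by move: h5; rewrite pmulr_lge0// ltr_pwDl.
Qed.

Lemma unif_ballP x y (e : R) : ball x e y -> forall tau i, tau \in `[0, T] ->
  `|x tau 0 i - y tau 0 i| < e.
Proof.
move=> xy tau i tauT; rewrite -lte_fin; apply: le_lt_trans xy.
apply: (@le_trans _ _ (enorm (x tau - y tau))%:E).
  by rewrite lee_fin; have := le_enorm (x tau - y tau) i; rewrite !mxE.
by apply: ereal_sup_ubound; exists tau.
Qed.

Lemma ball_unif x y (e e' : R) : (forall tau i, tau \in `[0, T] ->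
  `|x tau 0 i - y tau 0 i| <= e') -> n%:R * e' < e -> ball x e y.
Proof.
move=> xy ee; apply: (@le_lt_trans _ _ (n%:R * e')%:E); last by rewrite lte_fin.
apply: ge_ereal_sup => _ [tau tauT <-]; rewrite lee_fin.
by apply: enorm_le_const => i; rewrite !mxE xy.
Qed.

End densities.

(** * Uniform continuity on compact sets *)

Section uniform_continuity.
Context {R : realType} {X Y : pseudoMetricType R}.

Lemma within_contP (A : set X) (f : X -> Y) :
  {within A, continuous f} <->
  (forall p, A p -> forall e : R, 0 < e ->
    exists2 dl : R, 0 < dl & forall q, A q -> ball p dl q -> ball (f p) e (f q)).
Proof.
split=> [/subspace_continuousP cf p Ap e e0|h].
  have /nbhs_ballP[dl /= dl0 hdl] : within A (nbhs p) (f @^-1` ball (f p) e).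
    by apply: (cf p Ap); apply/nbhs_ballP; exists e.
  by exists dl => // q Aq pq; apply: hdl.
apply/subspace_continuousP => p Ap B /nbhs_ballP[e /= e0 eB].
have [dl dl0 hdl] := h p Ap e e0.
by apply/nbhs_ballP; exists dl => //= q pq Aq; apply: eB; exact: hdl.
Qed.

(** The Heine theorem for a function continuous on a compact set, by a covering argument
    uniform in the radius. *)
Lemma compact_unif_cont (K : set X) (f : X -> Y) : compact K -> {within K, continuous f} ->
  forall e : R, 0 < e ->
  exists2 dl : R, 0 < dl & forall p q, K p -> K q -> ball p dl q -> ball (f p) e (f q).
Proof.
move=> cK /within_contP cf e e0; have e2 : 0 < e / 2 by rewrite divr_gt0.
have /compact_near_coveringP/near_covering_withinP cov := cK.
have : \forall dl \near 0^'+, K `<=` (fun p => forall q, K q -> ball p dl q -> ball (f p) e (f q)).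
  apply: cov => p Kp; have [d1 d10 hd1] := cf p Kp (e / 2) e2.
  have d12 : 0 < d1 / 2 by rewrite divr_gt0.
  near=> p' dl => Kp' q Kq p'q.
  have pp' : ball p (d1 / 2) p' by near: p'; exact: nbhsx_ballx.
  have dld : dl < d1 / 2 by near: dl; exact: nbhs_right_lt.
  have pq : ball p d1 q.
    rewrite (splitr d1); apply: (ball_triangle pp'); exact: le_ball (ltW dld) _ p'q.
  rewrite (splitr e); apply: (@ball_triangle _ _ (f p)).
    by apply: ball_sym; apply: hd1 => //; apply: le_ball pp'; rewrite ler_pdivrMr// ler_peMr ?ler1n// ltW.
  exact: hd1.
move=> [dl /= dl0 h]; exists (dl / 2); first by rewrite divr_gt0.
move=> p q Kp Kq pq; apply: (h (dl / 2)) => //=.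
  by rewrite /ball_/= sub0r normrN gtr0_norm ?divr_gt0// ltr_pdivrMr// ltr_pMr// ltr1n.
by rewrite divr_gt0.
Unshelve. all: by end_near. Qed.

End uniform_continuity.

(** * A smooth majorant of the absolute value *)

Section smoothing.
Context {R : realType}.
Implicit Types (e r h : R).

(** A smooth function that lies between |r| and |r| + e; applied entry by entry it replaces
    the Euclidean norm of condition (L), which is not differentiable at zero. *)
Definition sm e r : R := Num.sqrt (e ^+ 2 + r ^+ 2).
Definition dsm e r : R := r / sm e r.

Lemma sm_sqr e r : sm e r ^+ 2 = e ^+ 2 + r ^+ 2.
Proof. by rewrite sqr_sqrtr// addr_ge0 ?sqr_ge0. Qed.

Lemma sm_ge0 e r : 0 <= sm e r. Proof. exact: sqrtr_ge0. Qed.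

Lemma le_sm e r : `|r| <= sm e r.
Proof. by rewrite -sqrtr_sqr ler_wsqrtr// lerDr sqr_ge0. Qed.

Lemma sm_ge e r : 0 < e -> e <= sm e r.
Proof.
by move=> e0; rewrite -{1}(gtr0_norm e0) -sqrtr_sqr ler_wsqrtr// lerDl sqr_ge0.
Qed.

Lemma sm_gt0 e r : 0 < e -> 0 < sm e r.
Proof. by move=> e0; rewrite (lt_le_trans e0)// sm_ge. Qed.

Lemma sm_le e r : 0 < e -> sm e r <= `|r| + e.
Proof.
move=> e0; rewrite -[leRHS]ger0_norm ?addr_ge0 ?(ltW e0)// -sqrtr_sqr ler_wsqrtr//.
rewrite sqrrD real_normK ?num_real//; have := normr_ge0 r; nra.
Qed.

Lemma sm0 e : 0 < e -> sm e 0 = e.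
Proof. by move=> e0; rewrite /sm expr0n addr0 sqrtr_sqr gtr0_norm. Qed.

Lemma smN e r : sm e (- r) = sm e r.
Proof. by rewrite /sm sqrrN. Qed.

Lemma dsmN e r : dsm e (- r) = - dsm e r.
Proof. by rewrite /dsm smN mulNr. Qed.

Lemma dsm_le1 e r : 0 < e -> `|dsm e r| <= 1.
Proof.
move=> e0; have s0 := sm_gt0 r e0.
rewrite normrM normfV (gtr0_norm s0) ler_pdivrMr// mul1r.
exact: le_sm.
Qed.

Lemma sm_lip e r h : 0 < e -> `|sm e (r + h) - sm e r| <= `|h|.
Proof.
move=> e0; have s1 := sm_gt0 r e0; have s2 := sm_gt0 (r + h) e0.
have q1 := sm_sqr e r; have q2 := sm_sqr e (r + h).
have l1 := le_sm e r; have l2 := le_sm e (r + h).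
rewrite -(ler_pM2r (addr_gt0 s2 s1)).
have <- : `|sm e (r + h) + sm e r| = sm e (r + h) + sm e r by rewrite gtr0_norm// addr_gt0.
rewrite -normrM.
have -> : (sm e (r + h) - sm e r) * (sm e (r + h) + sm e r) = h * ((r + h) + r).
  by rewrite -subr_sqr q1 q2; ring.
rewrite normrM ler_wpM2l// (le_trans (ler_normD _ _))//.
have s12 := addr_gt0 s2 s1; by rewrite (gtr0_norm s12) lerD.
Qed.

(** Multiplying by the conjugate root makes the first-order term explicit, and the remainder
    is controlled because both roots are at least e. *)
Lemma sm_taylor e r h : 0 < e -> `|sm e (r + h) - sm e r - dsm e r * h| <= h ^+ 2 / e.
Proof.
move=> e0; have s1 := sm_gt0 r e0; have s2 := sm_gt0 (r + h) e0.
have q1 := sm_sqr e r; have q2 := sm_sqr e (r + h).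
have l1 := le_sm e r; have l2 := sm_lip r h e0.
set B := sm e r in s1 q1 l1 l2 *; set A := sm e (r + h) in s2 q2 l2 *.
have AB := addr_gt0 s2 s1.
have -> : A - B - dsm e r * h = (h ^+ 2 * B - r * h * (A - B)) / (B * (A + B)).
  have -> : h ^+ 2 * B = (A ^+ 2 - B ^+ 2 - 2 * r * h) * B by rewrite q1 q2; ring.
  rewrite /dsm -/B; field; rewrite !gt_eqF//.
have eA : e <= A by exact: sm_ge.
have eB : e <= B by exact: sm_ge.
rewrite normrM normfV (gtr0_norm (mulr_gt0 s1 AB)) ler_pdivrMr ?mulr_gt0//.
apply: (@le_trans _ _ (h ^+ 2 * B + h ^+ 2 * B)).
  apply: (le_trans (ler_normB _ _)); apply: lerD.
    by rewrite normrM (gtr0_norm s1) ger0_norm ?sqr_ge0.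
  rewrite !normrM -[h ^+ 2](real_normK (num_real h)) expr2.
  have h0 := normr_ge0 h.
  apply: (@le_trans _ _ (B * `|h| * `|h|)); last by rewrite mulrAC -mulrA mulrC.
  by apply: ler_pM => //; rewrite ler_wpM2r.
have -> : h ^+ 2 / e * (B * (A + B)) = (h ^+ 2 * B) * ((A + B) / e) by field; rewrite gt_eqF.
have hB : 0 <= h ^+ 2 * B by apply: mulr_ge0; [exact: sqr_ge0|exact: ltW].
rewrite -mulr2n -mulr_natr ler_wpM2l//.
rewrite ler_pdivlMr//; lra.
Qed.

Lemma dsm_lip e r s : 0 < e -> `|dsm e r - dsm e s| <= 2 / e * `|r - s|.
Proof.
move=> e0; have s1 := sm_gt0 r e0; have s2 := sm_gt0 s e0.
have l := sm_lip s (r - s) e0; rewrite (addrC s) subrK in l.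
have l2 := le_sm e s.
set A := sm e r in s1 l *; set B := sm e s in s2 l l2 *.
have -> : dsm e r - dsm e s = ((r - s) * B + s * (B - A)) / (A * B).
  by rewrite /dsm -/A -/B; field; rewrite !gt_eqF.
have eA : e <= A by exact: sm_ge.
rewrite normrM normfV (gtr0_norm (mulr_gt0 s1 s2)) ler_pdivrMr ?mulr_gt0//.
apply: (@le_trans _ _ (`|r - s| * B + B * `|r - s|)).
  apply: (le_trans (ler_normD _ _)); apply: lerD.
    by rewrite normrM (gtr0_norm s2).
  by rewrite normrM distrC; apply: ler_pM.
have -> : 2 / e * `|r - s| * (A * B) = (2 * `|r - s| * B) * (A / e) by field; rewrite gt_eqF.
have -> : `|r - s| * B + B * `|r - s| = 2 * `|r - s| * B by ring.
rewrite ler_peMr ?mulr_ge0 ?(ltW s2)//.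
by rewrite ler_pdivlMr// mul1r.
Qed.

Lemma continuous_sm e : 0 < e -> continuous (sm e).
Proof.
move=> e0 r; apply/cvgrPdist_lt => d d0; exists d => //= s rs.
have := sm_lip s (r - s) e0; rewrite (addrC s) subrK => h.
exact: le_lt_trans rs.
Qed.

Lemma continuous_dsm e : 0 < e -> continuous (dsm e).
Proof.
move=> e0 r; apply/cvgrPdist_lt => d d0; exists (d * e / 2) => /=.
  by rewrite divr_gt0 ?mulr_gt0.
move=> s rs; apply: (le_lt_trans (dsm_lip _ _ e0)).
by rewrite mulrC mulrA ltr_pdivrMr// -ltr_pdivlMr.
Qed.

Lemma measurable_dsm e (f : R -> R) : 0 < e -> measurable_fun setT f ->
  measurable_fun setT (fun s => dsm e (f s)).
Proof.
move=> e0 mf; apply: (@measurableT_comp _ _ _ _ _ _ (dsm e)) => //.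
by apply: continuous_measurable_fun; exact: continuous_dsm.
Qed.

Lemma measurable_sm e (f : R -> R) : 0 < e -> measurable_fun setT f ->
  measurable_fun setT (fun s => sm e (f s)).
Proof.
move=> e0 mf; apply: (@measurableT_comp _ _ _ _ _ _ (sm e)) => //.
by apply: continuous_measurable_fun; exact: continuous_sm.
Qed.

Lemma bm_dsm e (f : R -> R) : 0 < e -> measurable_fun setT f ->
  bm 1 (fun s => dsm e (f s)).
Proof. by move=> e0 mf; split; [exact: measurable_dsm|move=> s; exact: dsm_le1]. Qed.

Lemma bm_sm e M (f : R -> R) : 0 < e -> bm M f -> bm (M + e) (fun s => sm e (f s)).
Proof.
move=> e0 [mf Mf]; split; first exact: measurable_sm.
by move=> s; rewrite ger0_norm ?sm_ge0// (le_trans (sm_le _ e0))// lerD2r.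
Qed.

End smoothing.

(** * First variation of the penalty *)

Section slope.
Context {R : realType}.
Variables (T alpha : R).
Hypotheses (T_gt0 : 0 < T) (alpha01 : 0 < alpha < 1).
Local Notation mu := (@lebesgue_measure R).
Local Notation D := `[0, T]%classic.
Local Notation kconv := (@kconv R T).
Implicit Types (f g : R -> R).

Let T0 : 0 <= T. Proof. exact: ltW. Qed.
Let a0 : 0 < alpha. Proof. by case/andP: alpha01. Qed.
Let a1 : alpha < 1. Proof. by case/andP: alpha01. Qed.
Let a01 : 0 < alpha <= 1. Proof. by rewrite a0 ltW. Qed.
Let G0 : 0 < Gamma alpha. Proof. exact: Gamma_gt0. Qed.
Let Gi : 0 <= (Gamma alpha)^-1. Proof. by rewrite invr_ge0 ltW. Qed.

(** The weight in the integral of condition (L). *)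
Definition wker (t : R) : R := ker alpha (T - t).

(** The adjoint of the fractional integral, applied to the functional that integrates g with
    weight [wker] and adds the value g (T): see [slope_fubini]. It gives the ci-gradient of
    the penalty. *)
Definition slope (t : R) g : R :=
  (Gamma alpha)^-1 * (\int[mu]_(s in D) (wker s * ker alpha (s - t) * g s) + wker t * g T).

(** By the Beta integral, the mass of the kernel of [slope]. *)
Let J (t : R) : R := ker (alpha + alpha) (T - t) * beta alpha alpha.

Lemma wker_ge0 t : 0 <= wker t. Proof. exact: ker_ge0. Qed.

Lemma integrable_wker : mu.-integrable D (fun s => (wker s)%:E).
Proof. exact: integrable_ker_refl. Qed.

Lemma measurable_wker (E : set R) : measurable_fun E wker.
Proof. exact: measurable_ker_refl. Qed.

Lemma integral_wkk t : 0 <= t -> (\int[mu]_(s in D) (wker s * ker alpha (s - t))%:E = (J t)%:E)%E.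
Proof. by move=> t0; rewrite /wker integral_ker_ker. Qed.

Lemma integrable_wkk t : 0 <= t -> mu.-integrable D (fun s => (wker s * ker alpha (s - t))%:E).
Proof.
move=> t0; apply: ge0_integrable => //.
- by apply: measurable_funM; [exact: measurable_wker|exact: measurable_ker_shift].
- by move=> s _; rewrite mulr_ge0 ?wker_ge0 ?ker_ge0.
- by rewrite integral_wkk// ltry.
Qed.

Lemma Rintegral_wkk t : 0 <= t -> \int[mu]_(s in D) (wker s * ker alpha (s - t)) = J t.
Proof. by move=> t0; rewrite /Rintegral integral_wkk. Qed.

Lemma slope1E t : 0 <= t -> slope t (cst 1) = (Gamma alpha)^-1 * (J t + wker t).
Proof.
move=> t0; rewrite /slope -Rintegral_wkk// /= mulr1; congr (_ * (_ + _)).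
by apply: eq_Rintegral => s _; rewrite mulr1.
Qed.

Lemma slope1_ge0 t : 0 <= t -> 0 <= slope t (cst 1).
Proof.
move=> t0; rewrite slope1E// mulr_ge0// addr_ge0 ?wker_ge0//.
by rewrite mulr_ge0 ?ker_ge0// ltW// beta_gt0.
Qed.

Lemma slope_le N t g : 0 <= t -> bm N g -> `|slope t g| <= N * slope t (cst 1).
Proof.
move=> t0 bg; rewrite slope1E// /slope normrM (ger0_norm Gi) mulrCA ler_wpM2l//.
apply: (le_trans (ler_normD _ _)); rewrite mulrDr; apply: lerD.
  rewrite -Rintegral_wkk//; apply: le_Rintegral_bmM => //; first exact: integrable_wkk.
  by move=> s _; rewrite mulr_ge0 ?wker_ge0 ?ker_ge0.
by rewrite normrM (ger0_norm (wker_ge0 _)) mulrC ler_wpM2r ?wker_ge0//; case: bg.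
Qed.

Lemma slopeB M N t f g : 0 <= t -> bm M f -> bm N g ->
  slope t (fun s => f s - g s) = slope t f - slope t g.
Proof.
move=> t0 bf bg; rewrite /slope -mulrBr; congr (_ * _).
rewrite opprD addrACA -RintegralB//.
- rewrite -mulrBr; congr (_ + _); apply: eq_Rintegral => s _; rewrite mulrBr//.
- exact: (integrable_bmM _ (integrable_wkk t0) bf).
- exact: (integrable_bmM _ (integrable_wkk t0) bg).
Qed.

Lemma slopeN N t g : 0 <= t -> bm N g -> slope t (fun s => - g s) = - slope t g.
Proof.
move=> t0 bg; have b0 : bm 0 (cst 0 : R -> R) by split=> // s; rewrite normr0.
rewrite -[RHS]add0r; have <- : slope t (cst 0) = 0.
  by apply/eqP; rewrite -normr_le0; apply: (le_trans (slope_le t0 b0)); rewrite mul0r.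
rewrite -(slopeB t0 b0 bg); congr slope; apply/funext => s; exact/esym/sub0r.
Qed.

(** For s > t' the kernel with the singularity at t' exceeds the one with the singularity at
    t, so its difference is integrated exactly, as J t' - J t; the interval between t and
    t', where the order is reversed, contributes the term with [kerprim]. *)
Lemma slope_dist N t t' g : 0 <= t -> t <= t' -> t' < T -> bm N g ->
  `|slope t' g - slope t g| <= (Gamma alpha)^-1 * (N *
     ((J t' - J t + 2 * (wker t' * kerprim alpha (t' - t))) + (wker t' - wker t))).
Proof.
move=> t0 tt' t'T bg; have N0 := bm_ge0 bg; have t'0 := le_trans t0 tt'.
rewrite /slope -mulrBr normrM (ger0_norm Gi) ler_wpM2l//.
have tT := le_lt_trans tt' t'T.
have wtt' s : s <= t' -> wker s <= wker t'.
  by move=> st'; apply: ker_le; rewrite ?(ltW a1)//; lra.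
rewrite opprD addrACA -mulrBl mulrDr.
apply: (le_trans (ler_normD _ _)); apply: lerD; last first.
  rewrite normrM ger0_norm ?subr_ge0 ?wtt'// mulrC ler_wpM2r ?subr_ge0 ?wtt'//.
  by case: bg.
pose p s := wker s * ker alpha (s - t); pose p' s := wker s * ker alpha (s - t').
have ip : mu.-integrable D (fun s => (p s)%:E) by exact: integrable_wkk.
have ip' : mu.-integrable D (fun s => (p' s)%:E) by exact: integrable_wkk.
have ik := integrable_bmM (measurable_itv _) (@integrable_ker_shift R alpha t 0 T a01)
  (bm_indic (measurable_itv `[t, t'])).
have i4 := integrable_scale (2 * wker t') (measurable_itv _) ik.
have i5 := integrable_sub (measurable_itv _) ip' ip.
pose q s := (p' s - p s) + (2 * wker t') * (ker alpha (s - t) * \1_(`[t, t']) s).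
have iq : mu.-integrable D (fun s => (q s)%:E) := integrable_add (measurable_itv _) i5 i4.
have pq s : `|p' s - p s| <= q s.
  rewrite /q /p /p' indicE; have [st|ts] := leP s t.
    rewrite (@ker_le0 _ _ (s - t)) ?subr_le0// (@ker_le0 _ _ (s - t')); last first.
      by rewrite subr_le0 (le_trans st).
    by rewrite mulr0 subrr normr0 mul0r mulr0 addr0.
  have [st'|t's] := leP s t'.
    rewrite (@ker_le0 _ _ (s - t')) ?subr_le0// mulr0 sub0r normrN.
    rewrite mem_set /= ?in_itv/= ?(ltW ts)// mulr1 ger0_norm ?mulr_ge0 ?wker_ge0 ?ker_ge0//.
    have k0 := ker_ge0 alpha (s - t); have := ler_wpM2r k0 (wtt' _ st'); lra.
  rewrite memNset; last by rewrite /= in_itv/= (leNgt s t') t's andbF.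
  rewrite mulr0 mulr0 addr0 ger0_norm// subr_ge0 ler_wpM2l ?wker_ge0//.
  by apply: ker_le; rewrite ?(ltW a1)//; lra.
apply: (le_trans (Rintegral_dist_le (measurable_itv _) ip ip' iq bg (fun s _ => pq s))).
rewrite ler_wpM2l// /q RintegralD// RintegralB// RintegralZl//.
rewrite !Rintegral_wkk// lerD2l -!mulrA ler_wpM2l// ler_wpM2l ?wker_ge0//.
have -> : kerprim alpha (t' - t) = \int[mu]_(s in `[t, t']) ker alpha (s - t).
  by rewrite /Rintegral integral_ker_shift//= subrr (@kerprim_le0 _ _ 0)// subr0.
apply: (Rintegral_indic_le _ _ _ ik) => //; last exact: integrable_ker_shift.
by move=> s; exact: ker_ge0.
Qed.

Let continuous_kerT a t : t < T -> {for t, continuous (fun t => ker a (T - t))}.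
Proof.
move=> tT; have h : {for t, continuous (fun t : R => (T - t) `^ (a - 1))}.
  apply: (@continuous_comp _ _ _ (fun t : R => T - t) (fun v : R => v `^ (a - 1))).
    by apply: continuousB; [exact: cst_continuous|exact: cvg_id].
  by apply: continuous_powR_pos; rewrite subr_gt0.
rewrite /prop_for /continuous_at ker_gt0 ?subr_gt0//.
move: h; rewrite /prop_for /continuous_at; apply: cvg_trans; apply: near_eq_cvg.
near=> s; rewrite -/(ker a (T - s)) ker_gt0// subr_gt0.
by near: s; exact: lt_nbhsl.
Unshelve. all: by end_near. Qed.

Let within_kerT a d : 0 < d -> {within `[0, T - d], continuous (fun t => ker a (T - t))}.
Proof.
move=> d0; apply: continuous_in_subspaceT => t /set_mem /=; rewrite in_itv/= => /andP[_ tT].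
by apply: continuous_kerT; lra.
Qed.

(** The bound of [slope_dist] involves g only through its supremum. So the modulus is
    uniform in g, which is what the comparison argument needs: there g depends on the
    smoothing parameter. *)
Lemma slope_unif (d e : R) : 0 < d -> 0 < e -> exists2 dl : R, 0 < dl &
  forall t t', t \in `[0, T - d] -> t' \in `[0, T - d] -> `|t' - t| < dl ->
  forall g, bm 1 g -> `|slope t' g - slope t g| <= e.
Proof.
move=> d0 e0.
have B0 : 0 < beta alpha alpha by apply: beta_gt0.
pose e1 := e * Gamma alpha / 3.
have e10 : 0 < e1 by rewrite divr_gt0 ?mulr_gt0.
have [d1 d10 h1] := compact_unif_cont (segment_compact (a:=0) (b:=T - d))
  (@within_kerT (alpha + alpha) d d0) (divr_gt0 e10 B0).
have [d2 d20 h2] := compact_unif_cont (segment_compact (a:=0) (b:=T - d))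
  (@within_kerT alpha d d0) e10.
have W0 : 0 < 2 * ker alpha d by rewrite mulr_gt0// ker_gt0// powR_gt0.
have [d3 d30 h3] := kerprim_small a0 (divr_gt0 e10 W0).
exists (Num.min d1 (Num.min d2 d3)); first by rewrite !lt_min d10 d20.
move=> t t' + + + g bg; wlog tt' : t t' / t <= t'.
  move=> H tI t'I tt; have [tt'|/ltW tt'] := leP t t'; first exact: H.
  by rewrite distrC; apply: H => //; rewrite distrC.
move=> tI t'I; rewrite !lt_min => /and3P[b1 b2 b3].
have [t0 tT] : 0 <= t /\ t <= T - d by move: tI; rewrite in_itv/= => /andP[].
have [t'0 t'T] : 0 <= t' /\ t' <= T - d by move: t'I; rewrite in_itv/= => /andP[].
have t'T' : t' < T by lra.
apply: (le_trans (slope_dist t0 tt' t'T' bg)); rewrite mul1r.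
rewrite mulrC ler_pdivrMr//.
have {}h1 : J t' - J t < e1.
  have := h1 _ _ t'I tI; rewrite /ball/= => /(_ b1).
  rewrite ltr_pdivlMr// /J -mulrBl => h; apply: le_lt_trans h.
  by rewrite ler_wpM2r ?ler_norm// ltW.
have {}h2 : wker t' - wker t < e1.
  have := h2 _ _ t'I tI; rewrite /ball/= => /(_ b2) h; apply: le_lt_trans h.
  exact: ler_norm.
have {}h3 : 2 * (wker t' * kerprim alpha (t' - t)) < e1.
  have := h3 _ b3; rewrite ger0_norm ?subr_ge0// ltr_pdivlMr// => h; apply: le_lt_trans h.
  rewrite mulrA mulrC ler_wpM2l ?kerprim_ge0// ler_wpM2l//.
  by apply: ker_le; rewrite ?(ltW a1)//; lra.
have E3 : e * Gamma alpha = 3 * e1 by rewrite /e1; field.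
rewrite E3; lra.
Qed.

Lemma slope_bounded (d : R) : 0 < d -> d <= T -> exists2 K : R, 0 <= K &
  forall t, t \in `[0, T - d] -> slope t (cst 1) <= K.
Proof.
move=> d0 dT; pose f t := (Gamma alpha)^-1 * (J t + wker t).
have cf : {within `[0, T - d], continuous f}.
  apply: continuous_in_subspaceT => t /set_mem /=; rewrite in_itv/= => /andP[_ tT].
  have tT' : t < T by lra.
  have c1 := continuous_kerT (a:=alpha) tT'.
  have c2 := continuous_kerT (a:=alpha + alpha) tT'.
  have c3 := continuousM c2 (@cst_continuous _ _ (beta alpha alpha) t).
  exact: (continuousM (@cst_continuous _ _ (Gamma alpha)^-1 t) (continuousD c3 c1)).
have Td : 0 <= T - d by rewrite subr_ge0.
have [c cI hc] := EVT_max Td cf.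
have cI0 : 0 <= c by move: cI; rewrite in_itv/= => /andP[].
exists (f c); first by rewrite /f -slope1E// slope1_ge0.
move=> t tI; rewrite slope1E; last by move: tI; rewrite in_itv/= => /andP[].
exact: hc.
Qed.

Lemma bm_slope d g : 0 < d -> d <= T -> bm 1 g -> exists K,
  bm K (fun r => if r \in `[0, T - d] then slope r g else 0).
Proof.
move=> d0 dT bg; have [K K0 hK] := slope_bounded d0 dT; exists K; split.
  have -> : (fun r => if r \in `[0, T - d] then slope r g else 0) =
      ((slope^~ g) \_ `[0, T - d]) by apply/funext => r; rewrite patchE mem_setE.
  apply/(measurable_restrictT (slope^~ g)) => //; apply: subspace_continuous_measurable_fun => //.
  apply/within_contP => p pI e e0; have e2 : 0 < e / 2 by rewrite divr_gt0.
  have [dl dl0 h] := slope_unif d0 e2; exists dl => // q qI pq.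
  rewrite /ball/=; apply: (@le_lt_trans _ _ (e / 2)); last first.
    by rewrite ltr_pdivrMr// ltr_pMr// ltr1n.
  by apply: h.
move=> r; case: ifPn => rI; last by rewrite normr0.
have r0 : 0 <= r by move: rI; rewrite in_itv/= => /andP[].
by apply: (le_trans (slope_le r0 bg)); rewrite mul1r; exact: hK.
Qed.

(** Exchange the order of integration. The density has to vanish near T because the slopes
    are unbounded there. *)
Lemma slope_fubini M d f g : 0 < d -> d <= T -> bm M f -> bm 1 g ->
  (forall r, T - d < r -> f r = 0) ->
  (Gamma alpha)^-1 * (\int[mu]_(s in D) (wker s * g s * kconv alpha f s) + g T * kconv alpha f T) =
  \int[mu]_(r in D) (f r * slope r g).
Proof.
move=> d0 dT bf bg fd.
have pf r : D r -> (\int[mu]_(s in D) (wker s * ker alpha (s - r))%:E < +oo)%E.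
  by rewrite /= in_itv/= => /andP[r0 _]; rewrite integral_wkk// ltry.
rewrite (@kconv_fubini _ T alpha M 1 f g wker a01 T0 bf bg) ?integrable_wker//; last 2 first.
- exact: measurable_wker.
- exact: wker_ge0.
have [K bS] := bm_slope d0 dT bg.
(* the slope made bounded by cutting it off near T, where f vanishes *)
pose S r := if r \in `[0, T - d] then slope r g else 0.
have fS r : D r -> f r * slope r g = f r * S r.
  rewrite /= in_itv/= /S in_itv/= => /andP[r0 rT]; rewrite r0/=.
  by case: leP => // /fd ->; rewrite !mul0r.
have iw : mu.-integrable D (fun r => (wker r * f r)%:E).
  exact: (integrable_bmM _ integrable_wker bf).
have iS : mu.-integrable D (fun r => (f r * S r)%:E).
  exact: (integrable_bm 0 T (bmM bf bS)).
have -> : \int[mu]_(r in D) (f r * \int[mu]_(s in D) (wker s * ker alpha (s - r) * g s)) =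
    \int[mu]_(r in D) (Gamma alpha * (f r * S r) - g T * (wker r * f r)).
  apply: eq_Rintegral => r; rewrite inE => Dr; rewrite -fS// /slope; field.
  by rewrite gt_eqF.
have -> : \int[mu]_(r in D) (f r * slope r g) = \int[mu]_(r in D) (f r * S r).
  by apply: eq_Rintegral => r; rewrite inE => Dr; rewrite fS.
rewrite RintegralB//; [|exact: integrable_scale|exact: integrable_scale].
rewrite RintegralZl// RintegralZl//.
have -> : kconv alpha f T = \int[mu]_(r in D) (wker r * f r) by [].
by field; rewrite gt_eqF.
Qed.

End slope.

Section pairing.
Context {R : realType}.
Variables (T alpha : R).
Hypotheses (T_gt0 : 0 < T) (alpha01 : 0 < alpha < 1).
Local Notation mu := (@lebesgue_measure R).
Local Notation D := `[0, T]%classic.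
Local Notation kconv := (@kconv R T).
Local Notation wker := (@wker R T alpha).
Local Notation slope := (@slope R T alpha).
Implicit Types (f g : R -> R).

Let T0 : 0 <= T. Proof. exact: ltW. Qed.
Let a0 : 0 < alpha. Proof. by case/andP: alpha01. Qed.
Let a1 : alpha < 1. Proof. by case/andP: alpha01. Qed.
Let a01 : 0 < alpha <= 1. Proof. by rewrite a0 ltW. Qed.
Let G0 : 0 < Gamma alpha. Proof. exact: Gamma_gt0. Qed.
Let Gi : 0 <= (Gamma alpha)^-1. Proof. by rewrite invr_ge0 ltW. Qed.

Lemma Rintegral_bound (a b C : R) f : a <= b -> measurable_fun `[a, b] f ->
  (forall s, s \in `[a, b] -> `|f s| <= C) -> `|\int[mu]_(s in `[a, b]) f s| <= C * (b - a).
Proof.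
move=> ab mf fC.
have C0 : 0 <= C by apply: (le_trans (normr_ge0 _) (fC a _)); rewrite in_itv/= lexx.
have bf : bm C (f \_ `[a, b]) by exact: bm_patch.
have -> : \int[mu]_(s in `[a, b]) f s = \int[mu]_(s in `[a, b]) (1 * (f \_ `[a, b]) s).
  by apply: eq_Rintegral => s sab; rewrite mul1r patchE sab.
have i1 : mu.-integrable `[a, b] (fun s => (1 : R)%:E).
  exact: (integrable_bm a b (@bm_cst1 R)).
apply: (le_trans (le_Rintegral_bmM (measurable_itv _) i1 _ bf)) => //.
have -> : \int[mu]_(s in `[a, b]) 1 = b - a; last by [].
by rewrite Rintegral_cst//= lebesgue_measure_itv/= lte_fin; case: ltgtP ab => //= [_|->] _; rewrite mul1r// subrr.
Qed.

Lemma Rintegral_window f (phi : R -> R) (t t' : R) : 0 <= t -> t <= t' -> t' <= T ->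
  \int[mu]_(s in D) ((upto t' f s - upto t f s) * phi s) =
  \int[mu]_(s in `[t, t']) (f s * phi s).
Proof.
move=> t0 tt' t'T; congr fine.
apply: (@integral_off2 _ _ _ _ _ t' t') => s st _; rewrite !patchE.
have [ts|st'] := leP t s; last first.
  rewrite [in RHS]memNset; last by rewrite /= in_itv/= leNgt st'.
  by case: ifP => // _; rewrite /upto st' (lt_le_trans st' tt') subrr mul0r.
have [st'|t's] := ltP s t'; last first.
  rewrite [in RHS]memNset; last first.
    by rewrite /= in_itv/= => /andP[_ h]; move/eqP: st; apply; apply/eqP; rewrite eq_le h.
  by case: ifP => // _; rewrite /upto !ltNge ts t's subrr mul0r.
rewrite !mem_set /= ?in_itv/= ?ts ?(ltW st')//; last first.
  by rewrite (le_trans t0 ts) (le_trans (ltW st') t'T).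
by rewrite /upto st' ltNge ts subr0.
Qed.

Lemma measurable_slope (d : R) g (a b : R) : 0 < d -> d <= T -> bm 1 g ->
  0 <= a -> b <= T - d -> measurable_fun `[a, b] (slope^~ g).
Proof.
move=> d0 dT bg a0' bT; have [K [mS _]] := bm_slope alpha01 d0 dT bg.
apply: (eq_measurable_fun _ _ (measurable_funTS mS)) => s.
rewrite inE/= in_itv/= => /andP[as_ sb].
by rewrite in_itv/= (le_trans a0' as_) (le_trans sb bT).
Qed.

(** The linear functional which, applied to the norm of a path, gives the right-hand side of
    condition (L). *)
Definition pairing g : R := \int[mu]_(s in D) (wker s * g s) + g T.

Let iw := integrable_wker T alpha01.

Lemma pairingB M N f g : bm M f -> bm N g ->
  pairing (fun s => f s - g s) = pairing f - pairing g.
Proof.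
move=> bf bg; rewrite /pairing opprD addrACA -RintegralB//.
- by congr (_ + _); apply: eq_Rintegral => s _; rewrite mulrBr.
- exact: (integrable_bmM _ iw bf).
- exact: (integrable_bmM _ iw bg).
Qed.

Lemma pairing_mono M N f g : bm M f -> bm N g ->
  (forall s, D s -> `|f s| <= g s) -> `|pairing f| <= pairing g.
Proof.
move=> bf bg fg; apply: (le_trans (ler_normD _ _)); apply: lerD; last first.
  by apply: fg; rewrite /= in_itv/= T0 lexx.
have i1 := integrable_bmM (measurable_itv _) iw bf.
have i2 := integrable_bmM (measurable_itv _) iw bg.
apply: le_Rintegral_norm => // s Ds.
by rewrite normrM (ger0_norm (wker_ge0 _ _ _)) ler_wpM2l ?wker_ge0// fg.
Qed.

Lemma pairingZ M f (c : R) : bm M f -> pairing (fun s => c * f s) = c * pairing f.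
Proof.
move=> bf; rewrite /pairing mulrDr -RintegralZl//.
  by congr (_ + _); apply: eq_Rintegral => s _; rewrite mulrCA.
exact: (integrable_bmM _ iw bf).
Qed.

Let mass := pairing (cst 1).

Lemma mass_gt0 : 0 < mass.
Proof.
rewrite /mass /pairing ltr_pwDr// Rintegral_ge0// => s _.
by rewrite mulr1 wker_ge0.
Qed.

Lemma pairing_bound N f (C : R) : bm N f -> (forall s, D s -> `|f s| <= C) ->
  `|pairing f| <= C * mass.
Proof.
move=> bf fC; rewrite -(pairingZ C (@bm_cst1 R)).
have C0 : 0 <= C by apply: (le_trans (normr_ge0 _) (fC T _)); rewrite /= in_itv/= T0 lexx.
have bC : bm C (fun s : R => C * (1 : R)).
  by split=> [|s]; [exact: measurable_cst|rewrite mulr1 ger0_norm].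
by apply: (pairing_mono bf bC) => s Ds; rewrite mulr1 fC.
Qed.

(** The increment h is the fractional integral of f over the window from t to tau. The
    Taylor expansion leaves a first-order term, which by [slope_fubini] is the integral of f
    against the slopes at times between t and tau; these are close to the slope at t. The
    remainder is quadratic in h: one factor is uniformly small, of order (tau - t)^alpha,
    and the other one has pairing of order tau - t, again by [slope_fubini]. *)
Lemma pairing_increment (e M N t : R) f (z : R -> R) : 0 < e -> 0 <= t -> t < T ->
  bm M f -> bm N z -> forall d : R, 0 < d -> exists2 dl : R, 0 < dl &
  forall tau, t < tau -> tau < t + dl -> tau < T ->
  forall h : R -> R,
  (forall r, h r = (Gamma alpha)^-1 * kconv alpha (fun s => upto tau f s - upto t f s) r) ->
  `|pairing (fun r => sm e (z r + h r)) - pairing (fun r => sm e (z r))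
     - \int[mu]_(r in `[t, tau]) (f r * slope t (fun r => dsm e (z r)))| <= d * (tau - t).
Proof.
move=> e0 t0 tT bf bz d d0.
have M0 := bm_ge0 bf.
pose d' := (T - t) / 2.
have d'0 : 0 < d' by rewrite divr_gt0// subr_gt0.
have d'T : d' <= T by rewrite /d'; lra.
have [K K0 hK] := slope_bounded alpha01 d'0 d'T.
pose e1 := d / 2 / (M + 1).
have e10 : 0 < e1 by rewrite !divr_gt0// ltr_wpDl.
have [dl1 dl10 h1] := slope_unif T alpha01 d'0 e10.
have Q0 : 0 <= (Gamma alpha)^-1 * M / e * (M * K) by rewrite !mulr_ge0// invr_ge0 ltW.
have [dl2 dl20 h2] := kerprim_small_mul a0 Q0 (divr_gt0 d0 (ltr0n R 2)).
exists (Num.min d' (Num.min dl1 dl2)); first by rewrite !lt_min d'0 dl10.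
move=> tau ttau td tauT h hE; move: td; rewrite -ltrBlDl !lt_min => /and3P[td' td1 td2].
have tau0 := le_trans t0 (ltW ttau).
have tauI r : r \in `[t, tau] -> r \in `[0, T - d'].
  rewrite !in_itv/= => /andP[tr rtau]; rewrite (le_trans t0 tr)/= (le_trans rtau)//.
  by rewrite /d' in td' *; lra.
have tI : t \in `[0, T - d'] by apply: tauI; rewrite in_itv/= lexx ltW.
pose F s := upto tau f s - upto t f s.
pose I s : R := upto tau (fun _ => 1 : R) s - upto t (fun _ => 1 : R) s.
have bF : bm (M + M) F by apply: bmB; exact: bm_upto.
have bI : bm (1 + 1) I by apply: bmB; apply: bm_upto; exact: bm_cst1.
have FI s : `|F s| <= M * I s.
  rewrite /F /I /upto; case: (ltP s t) => st.
    by rewrite (lt_trans st ttau) !subrr normr0 mulr0.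
  by case: ltP => _; rewrite !subr0 ?mulr1 ?mulr0 ?normr0//; case: bf.
pose eta := (Gamma alpha)^-1 * (M * kerprim alpha (tau - t)).
have eta0 : 0 <= eta by rewrite !mulr_ge0 ?kerprim_ge0.
have {}hE : h = (fun r => (Gamma alpha)^-1 * kconv alpha F r) by apply/funext => r; rewrite hE.
have heta r : `|h r| <= eta.
  rewrite hE normrM (ger0_norm Gi) ler_wpM2l//.
  rewrite /F (kconvB _ _ a01 (bm_upto tau bf) (bm_upto t bf)).
  by have <- : `|tau - t| = tau - t by [rewrite gtr0_norm// subr_gt0]; exact: kconv_upto_dist bf.
have bkF := bm_kconv T0 a01 bF; have bkI := bm_kconv T0 a01 bI.
have bh := bmZ (Gamma alpha)^-1 bkF; rewrite -hE in bh.
pose k r := (Gamma alpha)^-1 * kconv alpha I r.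
have bk := bmZ (Gamma alpha)^-1 bkI.
have hk r : `|h r| <= M * k r.
  rewrite hE normrM (ger0_norm Gi) /k mulrCA ler_wpM2l//.
  rewrite /kconv -RintegralZl//; last exact: (integrable_kconv T r a01 bI).
  apply: le_Rintegral_norm => //.
  - exact: (integrable_kconv T r a01 bF).
  - by apply: integrable_scale => //; exact: (integrable_kconv T r a01 bI).
  - by move=> s _; rewrite normrM (ger0_norm (ker_ge0 _ _)) mulrCA ler_wpM2l ?ker_ge0.
have bG := bm_dsm e0 (proj1 bz).
have bsm1 := bm_sm e0 (bmD bz bh).
have bsm := bm_sm e0 bz.
have bGh := bmM bG bh.
pose G r := dsm e (z r).
have slopew (s : R) : s \in `[t, tau] -> 0 <= slope s (cst 1) <= K.
  move=> sI; have sI' := tauI _ sI; rewrite hK// slope1_ge0//.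
  by move: sI'; rewrite in_itv/= => /andP[].
have Fd s : T - (T - tau) < s -> F s = 0.
  rewrite opprB addrC subrK => ts; rewrite /F /upto !ltNge (ltW ts).
  by rewrite (ltW (lt_trans ttau ts)) subrr.
have Id s : T - (T - tau) < s -> I s = 0.
  rewrite opprB addrC subrK => ts; rewrite /I /upto !ltNge (ltW ts).
  by rewrite (ltW (lt_trans ttau ts)) subrr.
have dtau0 : 0 < T - tau by rewrite subr_gt0.
have dtauT : T - tau <= T by lra.
have tauTd : tau <= T - (T - tau) by lra.
have main : pairing (fun r => G r * h r) = \int[mu]_(r in `[t, tau]) (f r * slope r G).
  rewrite -(Rintegral_window f (slope^~ G) t0 (ltW ttau) (ltW tauT)).
  rewrite -(slope_fubini T_gt0 alpha01 dtau0 dtauT bF bG Fd) /pairing mulrDr.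
  congr (_ + _); last by rewrite hE mulrCA.
  rewrite -RintegralZl//.
    by apply: eq_Rintegral => s _; rewrite hE /G /=; ring.
  apply: (@eq_integrable _ _ _ mu D _ (fun s => (wker s * (G s * kconv alpha F s))%:E)) => //.
    by move=> s _; rewrite mulrA.
  exact: (integrable_bmM _ iw (bmM bG bkF)).
(* k dominates h / M, and its pairing is a mean of slopes of the constant one *)
have pk : pairing k <= K * (tau - t).
  have -> : pairing k = \int[mu]_(r in `[t, tau]) (1 * slope r (cst 1)).
    rewrite -(Rintegral_window (fun _ => 1) (slope^~ (cst 1)) t0 (ltW ttau) (ltW tauT)).
    rewrite -(slope_fubini T_gt0 alpha01 dtau0 dtauT bI (@bm_cst1 R) Id) /pairing mulrDr.
    congr (_ + _); last by rewrite mul1r.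
    rewrite -RintegralZl//.
      by apply: eq_Rintegral => s _; rewrite /k /=; ring.
    apply: (@eq_integrable _ _ _ mu D _ (fun s => (wker s * kconv alpha I s)%:E)) => //.
      by move=> s _; rewrite /= mulr1.
    exact: (integrable_bmM _ iw bkI).
  apply: (le_trans (ler_norm _)); apply: Rintegral_bound; first exact: ltW.
    apply: measurable_funM => //.
    exact: (measurable_slope dtau0 dtauT (@bm_cst1 R) t0 tauTd).
  by move=> s /slopew /andP[s1 s2]; rewrite mul1r ger0_norm.
have rem : `|pairing (fun r => sm e (z r + h r) - sm e (z r) - G r * h r)| <=
    eta / e * M * (K * (tau - t)).
  have bMk := bmZ (eta / e * M) bk.
  apply: (@le_trans _ _ (pairing (fun r => eta / e * M * k r))).
    apply: (pairing_mono (bmB (bmB bsm1 bsm) bGh) bMk) => r _.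
    apply: (le_trans (sm_taylor _ _ e0)); rewrite -real_normK ?num_real// expr2.
    rewrite mulrAC -(mulrA _ M); apply: ler_pM => //.
      by rewrite mulr_ge0// invr_ge0 ltW.
    by rewrite ler_wpM2r ?invr_ge0 ?(ltW e0).
  rewrite (pairingZ _ bk) ler_wpM2l//; apply: mulr_ge0 => //; apply: mulr_ge0 => //.
  by rewrite invr_ge0 ltW.
have diff : `|\int[mu]_(r in `[t, tau]) (f r * slope r G) -
    \int[mu]_(r in `[t, tau]) (f r * slope t G)| <= (M * e1) * (tau - t).
  have mf : measurable_fun `[t, tau] f by exact: bm_measurable bf.
  have ms := measurable_slope dtau0 dtauT bG t0 tauTd.
  have ib C (p : R -> R) : measurable_fun `[t, tau] p ->
      (forall s, s \in `[t, tau] -> `|p s| <= C) -> mu.-integrable `[t, tau] (fun s => (p s)%:E).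
    move=> mp pC; apply: (@eq_integrable _ _ _ mu `[t, tau] _ (fun s => ((p \_ `[t, tau]) s)%:E)) => //.
      by move=> s sI; rewrite patchE sI.
    have C0 : 0 <= C by apply: (le_trans (normr_ge0 _) (pC t _)); rewrite in_itv/= lexx ltW.
    exact: (integrable_bm _ _ (bm_patch (measurable_itv _) C0 mp pC)).
  have sG s : s \in `[t, tau] -> `|slope s G| <= K.
    move=> sI; have /andP[_ sK] := slopew _ sI.
    have s0 : 0 <= s by move: (tauI _ sI); rewrite in_itv/= => /andP[].
    by apply: (le_trans (slope_le T alpha01 s0 bG)); rewrite mul1r.
  rewrite -RintegralB//; last 2 first.
  - apply: (ib (M * K)); first exact: measurable_funM.
    by move=> s sI; rewrite normrM; apply: ler_pM => //; [case: bf|exact: sG].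
  - apply: (ib (M * K)); first by apply: measurable_funM => //; exact: measurable_cst.
    move=> s sI; rewrite normrM; apply: ler_pM => //; first by case: bf.
    by apply: sG; rewrite in_itv/= lexx ltW.
  apply: Rintegral_bound; first exact: ltW.
    apply: measurable_funB; apply: measurable_funM => //; exact: measurable_cst.
  move=> s sI; rewrite -mulrBr normrM; apply: ler_pM => //; first by case: bf.
  apply: h1 => //; first exact: tauI.
  move: sI; rewrite in_itv/= => /andP[ts stau].
  by rewrite ger0_norm ?subr_ge0//; lra.
have -> : pairing (fun r => sm e (z r + h r)) - pairing (fun r => sm e (z r)) =
    pairing (fun r => sm e (z r + h r) - sm e (z r) - G r * h r) +
    \int[mu]_(r in `[t, tau]) (f r * slope r G).
  rewrite -main (pairingB (bmB bsm1 bsm) bGh) (pairingB bsm1 bsm) subrK//.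
rewrite -addrA; apply: (le_trans (ler_normD _ _)); apply: (le_trans (lerD rem diff)).
rewrite mulrA -mulrDl ler_wpM2r ?subr_ge0 ?(ltW ttau)//.
rewrite [leRHS]splitr; apply: lerD.
  suff -> : eta / e * M * K = ((Gamma alpha)^-1 * M / e * (M * K)) * kerprim alpha (tau - t) by exact: h2.
  by rewrite /eta; ring.
rewrite /e1 mulrCA ger_pMr ?divr_gt0// ler_pdivrMr ?mul1r ?lerDl//.
by rewrite ltr_wpDl.
Qed.

End pairing.

(** * Test functionals *)

Section test_functionals.
Context {R : realType} {n : nat} {T alpha : R}.
Hypotheses (T_gt0 : 0 < T) (alpha01 : 0 < alpha < 1).
Local Notation mu := (@lebesgue_measure R).
Local Notation V := 'rV[R]_n.
Local Notation AC := (ACa n T alpha).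
Local Notation D := `[0, T]%classic.
Local Notation kconv := (@kconv R T).
Local Notation wker := (@wker R T alpha).
Local Notation slope := (@slope R T alpha).
Local Notation pairing := (@pairing R T alpha).
Implicit Types (x y A : AC) (f g z : R -> V).

Let T0 : 0 <= T. Proof. exact: ltW. Qed.
Let a0 : 0 < alpha. Proof. by case/andP: alpha01. Qed.
Let a1 : alpha < 1. Proof. by case/andP: alpha01. Qed.
Let a01 : 0 < alpha <= 1. Proof. by rewrite a0 ltW. Qed.
Let G0 : 0 < Gamma alpha. Proof. exact: Gamma_gt0. Qed.
Let Gi : 0 <= (Gamma alpha)^-1. Proof. by rewrite invr_ge0 ltW. Qed.

Lemma Rintegral_dotv (q : V) M f (a b : R) : bmv M f ->
  \int[mu]_(s in `[a, b]) dotv q (f s) = \sum_i q 0 i * \int[mu]_(s in `[a, b]) entry f i s.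
Proof.
move=> bf.
have ib i : mu.-integrable `[a, b] (fun s => (q 0 i * entry f i s)%:E).
  exact: (integrable_bm a b (bmZ (q 0 i) (bf i))).
rewrite {1}/Rintegral /dotv.
have -> : (\int[mu]_(s in `[a, b]) (\sum_i q 0 i * f s 0 i)%:E =
    \sum_i (\int[mu]_(s in `[a, b]) (q 0 i * entry f i s)%:E))%E.
  by rewrite -integral_sum//; apply: eq_integral => s _; rewrite sumEFin.
under eq_bigr => i _ do rewrite -(Rintegral_fin (measurable_itv _) (ib i)).
rewrite sumEFin /=; apply: eq_bigr => i _; rewrite RintegralZl//.
exact: (integrable_bm a b (bf i)).
Qed.

Lemma bmv_path x : exists N, bmv N x.
Proof.
have [M [f [bf xE]]] := dens_exists alpha01 x.
exists (enorm (x 0) + (Gamma alpha)^-1 * (M * kerprim alpha T)) => i.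
have bk := bm_kconv T0 a01 (bf i).
have cE : entry x i = (fun s => x 0 0 i + (Gamma alpha)^-1 * kconv alpha (entry f i) s) \_ D.
  apply/funext => s; rewrite patchE /entry.
  by rewrite mem_setE; case: ifPn => sT; [rewrite xE|rewrite ACa_out// mxE].
rewrite cE; apply: bm_patch => //.
- by rewrite addr_ge0 ?enorm_ge0// mulr_ge0//; exact: bm_ge0 bk.
- apply: measurable_funTS; apply: measurable_funD; first exact: measurable_cst.
  by apply: measurable_funM; [exact: measurable_cst|case: bk].
move=> s _; apply: (le_trans (ler_normD _ _)); apply: lerD; first exact: le_enorm.
by rewrite normrM (ger0_norm Gi) ler_wpM2l//; case: bk.
Qed.

Lemma bmv_pathB x A : exists N, bmv N (fun s => x s - A s).
Proof.
have [N bx] := bmv_path x; have [N' bA] := bmv_path A; exists (N + N') => i.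
have -> : entry (fun s => x s - A s) i = (fun s => entry x i s - entry A i s).
  by apply/funext => s; rewrite /entry !mxE.
exact: bmB.
Qed.

(** The smoothed norm of condition (L), taken entry by entry. *)
Definition penalty (e : R) z : R := \sum_i pairing (fun s => sm e (z s 0 i)).

Lemma pairing_eq (f g : R -> R) : (forall s, D s -> f s = g s) -> pairing f = pairing g.
Proof.
move=> fg; congr (_ + _); last by apply: fg; rewrite /= in_itv/= T0 lexx.
by apply: eq_Rintegral => s; rewrite inE => Ds; rewrite fg.
Qed.

Lemma penalty_lip e N N' z z' (E : R) : 0 < e -> bmv N z -> bmv N' z' ->
  (forall s i, D s -> `|z s 0 i - z' s 0 i| <= E) ->
  `|penalty e z - penalty e z'| <= n%:R * (E * pairing (cst 1)).
Proof.
move=> e0 bz bz' zE; rewrite /penalty -sumrB; apply: (le_trans (ler_norm_sum _ _ _)).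
rewrite -[n in n%:R]card_ord mulr_natl -sumr_const; apply: ler_sum => i _.
have b1 := bm_sm e0 (bz i); have b2 := bm_sm e0 (bz' i).
rewrite -(pairingB T alpha01 b1 b2); apply: (pairing_bound T_gt0 alpha01 (bmB b1 b2)) => s Ds.
apply: le_trans (zE s i Ds).
by have := sm_lip (z' s 0 i) (z s 0 i - z' s 0 i) e0; rewrite (addrC (z' s 0 i)) subrK.
Qed.

(** Split into a change of the stopping time, controlled by the modulus of the path x alone,
    and a change of the path, controlled by the maximum principle. The order of the two
    steps is essential, since nothing is known about the modulus of y. *)
Lemma stop_cont t x (e : R) : t \in `[0, T] -> 0 < e -> exists2 dl : R, 0 < dl &
  forall t' y, t' \in `[0, T] -> `|t - t'| < dl -> ball x dl y ->
  forall xi i, D xi -> `|stop t x xi 0 i - stop t' y xi 0 i| <= e.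
Proof.
move=> tT e0; have [M [f df]] := dens_exists alpha01 x.
have e2 : 0 < e / 2 by rewrite divr_gt0.
have Q0 : 0 <= (Gamma alpha)^-1 * `|M| by rewrite mulr_ge0.
have [d1 d10 h1] := kerprim_small_mul a0 Q0 e2.
exists (Num.min d1 (e / 6)); first by rewrite lt_min d10 divr_gt0.
move=> t' y t'T; rewrite lt_min => /andP[td1 _] xy xi i xiT.
have {}xy : ball x (e / 6) y by apply: le_ball xy; rewrite ge_min lexx orbT.
have [t'0 t'T'] : 0 <= t' /\ t' <= T by move: t'T; rewrite in_itv/= => /andP[].
rewrite -(subrK (stop t' x xi 0 i) (stop t x xi 0 i)) -addrA [leRHS]splitr.
apply: (le_trans (ler_normD _ _)); apply: lerD.
  apply: (le_trans (stop_time T_gt0 alpha01 t' t i df xiT)).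
  by apply: le_trans (h1 _ td1); rewrite ler_wpM2r ?kerprim_ge0// ler_wpM2l// ler_norm.
have -> : e / 2 = 3 * (e / 6) by field.
apply: (stop_lip T_gt0 alpha01 t'0 t'T') => // s /andP[s0 st'].
by apply: ltW; apply: (unif_ballP xy); rewrite in_itv/= s0 (le_trans st').
Qed.

Section test.
Variables (e kappa a b c : R) (A : AC).
Hypothesis e0 : 0 < e.

(** The test functionals penalise the distance of the path stopped at s from a fixed path A,
    and add a quadratic polynomial in time. *)
Definition test_dev (s : R) x : R -> V := fun r => stop s x r - A r.

Definition test_fun (s : R) x : R :=
  kappa * penalty e (test_dev s x) + (a + b * s + c * s ^+ 2).

Definition test_dt (s : R) (x : AC) : R := b + 2 * c * s.

Definition test_grad (s : R) x : V :=
  \row_i (kappa * slope s (fun r => dsm e (test_dev s x r 0 i))).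

(** Stopping is continuous in the uniform norm, and the penalty is Lipschitz with respect to
    it. *)
Lemma test_fun_cont : continuous_upto `[0, T] test_fun.
Proof.
apply/within_contP => -[t x] [/= tT _] d d0.
have d2 : 0 < d / 2 by rewrite divr_gt0.
have m0 := mass_gt0 T alpha.
pose Q := `|kappa| * (n%:R * pairing (cst 1)) + 1.
have Q0 : 0 < Q by rewrite ltr_wpDl// mulr_ge0// mulr_ge0// ltW.
have [d1 d10 h1] := stop_cont x tT (divr_gt0 d2 Q0).
pose p (s : R) := a + b * s + c * s ^+ 2.
have cp : {for t, continuous p}.
  apply: continuousD; first apply: continuousD; first exact: cst_continuous.
    by apply: continuousM; [exact: cst_continuous|exact: cvg_id].
  apply: continuousM; first exact: cst_continuous.
  exact: exprn_continuous.
have /nbhs_ballP[d3 /= d30 h3] : \forall s \near t, `|p t - p s| < d / 2.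
  by have /cvgrPdist_lt := cp; apply.
exists (Num.min d1 d3); first by rewrite lt_min d10.
move=> [t' y] [/= t'T _] [/= tt' xy].
move: tt'; rewrite /ball/= lt_min => /andP[tt1 tt3].
have {}xy : ball x d1 y by apply: le_ball xy; rewrite ge_min lexx.
rewrite /test_fun -/(p t) -/(p t') opprD addrACA -mulrBr (splitr d).
apply: (le_lt_trans (ler_normD _ _)); apply: ler_ltD; last exact: h3.
have [N bz] := bmv_pathB (stop t x) A; have [N' bz'] := bmv_pathB (stop t' y) A.
rewrite normrM; apply: (@le_trans _ _ (`|kappa| * (n%:R * (d / 2 / Q * pairing (cst 1))))).
  rewrite ler_wpM2l//; apply: (penalty_lip e0 bz bz') => s i Ds; rewrite !mxE.
  have -> : stop t x s 0 i - A s 0 i - (stop t' y s 0 i - A s 0 i) =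
    stop t x s 0 i - stop t' y s 0 i by ring.
  exact: h1.
have -> : `|kappa| * (n%:R * (d / 2 / Q * pairing (cst 1))) =
  (d / 2) * ((`|kappa| * (n%:R * pairing (cst 1))) / Q) by field; rewrite gt_eqF.
by apply: ger_ratio; [exact: ltW|rewrite mulr_ge0// mulr_ge0// ltW].
Qed.

Lemma test_dt_cont : continuous_upto `[0, T[ test_dt.
Proof.
have h : continuous (fun s : R => b + 2 * c * s).
  move=> s; apply: continuousD; first exact: cst_continuous.
  by apply: continuousM; [exact: cst_continuous|exact: cvg_id].
apply: continuous_subspaceT => -[t x].
apply: (@continuous_comp _ _ _ fst (fun s : R => b + 2 * c * s)); last exact: h.
exact: cvg_fst.
Qed.

(** Two effects: the time of the slope moves, which [slope_unif] controls uniformly in the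
    integrand; and the integrand moves, uniformly, because the stopped path does. *)
Lemma test_grad_cont : continuous_upto `[0, T[ test_grad.
Proof.
apply/within_contP => -[t x] [/= tT _] d d0.
have [t0 tT'] : 0 <= t /\ t < T by move: tT; rewrite in_itv/= => /andP[].
pose d' := (T - t) / 2.
have d'0 : 0 < d' by rewrite divr_gt0// subr_gt0.
have d'T : d' <= T by rewrite /d'; lra.
have k0 : 0 < `|kappa| + 1 by rewrite ltr_wpDl.
have dk : 0 < d / 3 / (`|kappa| + 1) by rewrite !divr_gt0.
have [d1 d10 h1] := slope_unif T alpha01 d'0 dk.
have [K K0 hK] := slope_bounded alpha01 d'0 d'T.
have K1 : 0 < 2 / e * (K + 1) by rewrite mulr_gt0// ?divr_gt0// ltr_wpDl.
have tTc : t \in `[0, T] by rewrite in_itv/= t0 ltW.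
have [d2 d20 h2] := stop_cont x tTc (divr_gt0 dk K1).
exists (Num.min d' (Num.min d1 d2)); first by rewrite !lt_min d'0 d10.
move=> [t' y] [/= t'T _] [/= tt' xy].
move: tt'; rewrite /ball/= !lt_min => /and3P[tt0 tt1 tt2].
have {}xy : ball x d2 y by apply: le_ball xy; rewrite !ge_min lexx !orbT.
have [t'0 t'T'] : 0 <= t' /\ t' < T by move: t'T; rewrite in_itv/= => /andP[].
have tI : t \in `[0, T - d'] by rewrite in_itv/= t0/= /d'; lra.
have t'I : t' \in `[0, T - d'].
  by rewrite in_itv/= t'0/=; move: tt0; rewrite ltr_norml /d' => /andP[]; lra.
have t'Tc : t' \in `[0, T] by rewrite in_itv/= t'0 ltW.
split=> // i' i; rewrite (ord1 i') /ball/= !mxE -mulrBr normrM.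
have [N bz] := bmv_pathB (stop t x) A; have [N' bz'] := bmv_pathB (stop t' y) A.
have bG := bm_dsm e0 (proj1 (bz i)); have bG' := bm_dsm e0 (proj1 (bz' i)).
set G := (fun r => dsm e (test_dev t x r 0 i)).
set G' := (fun r => dsm e (test_dev t' y r 0 i)).
have GT : bm (d / 3 / (`|kappa| + 1) / (K + 1)) (fun r => (G r - G' r) * \1_D r).
  have [m1 _] := bmM (bmB bG bG') (bm_indic (measurable_itv `[0, T])); split=> // s.
  rewrite indicE; have [/set_mem Ds|_] := boolP (s \in D); last first.
    by rewrite mulr0 normr0 !mulr_ge0// ?invr_ge0 ltW// ltr_wpDl.
  rewrite mulr1; apply: (le_trans (dsm_lip _ _ e0)).
  rewrite /test_dev !mxE.
  have -> : stop t x s 0 i - A s 0 i - (stop t' y s 0 i - A s 0 i) =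
    stop t x s 0 i - stop t' y s 0 i by ring.
  have := h2 t' y t'Tc tt2 xy s i Ds; rewrite ler_pdivlMr// => hh.
  rewrite ler_pdivlMr ?ltr_wpDl//.
  by move: hh; rewrite mulrC (mulrAC _ (K + 1)).
have sGG : slope t' G - slope t' G' = slope t' (fun r => (G r - G' r) * \1_D r).
  rewrite -(slopeB T alpha01 t'0 bG bG') /slope /slope; congr (_ * (_ + _)).
    by apply: eq_Rintegral => s sD; rewrite indicE sD mulr1.
  by rewrite indicE mem_set ?mulr1//= in_itv/= T0 lexx.
have s1 : `|slope t' G - slope t' G'| <= d / 3 / (`|kappa| + 1).
  rewrite sGG; apply: (le_trans (slope_le T alpha01 t'0 GT)).
  rewrite mulrAC ler_pdivrMr ?ltr_wpDl// ler_wpM2l//.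
    by rewrite ltW.
  by apply: (le_trans (hK _ t'I)); rewrite lerDl.
have s2 : `|slope t G - slope t' G| <= d / 3 / (`|kappa| + 1).
  exact: h1.
have s3 : `|slope t G - slope t' G'| <= d / 3 / (`|kappa| + 1) * 2.
  rewrite -(subrK (slope t' G) (slope t G)) -addrA mulr2n mulrDr mulr1.
  by apply: (le_trans (ler_normD _ _)); apply: lerD.
apply: (@le_lt_trans _ _ (`|kappa| * (d / 3 / (`|kappa| + 1) * 2))).
  by rewrite ler_wpM2l.
apply: (@le_lt_trans _ _ (d / 3 * 2)); last lra.
have -> : `|kappa| * (d / 3 / (`|kappa| + 1) * 2) = (d / 3 * 2) * (`|kappa| / (`|kappa| + 1)).
  by field; rewrite gt_eqF.
by apply: ger_ratio; rewrite ?mulr_ge0 ?divr_ge0// ltW.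
Qed.

(** Only the density of y after t matters, since y stopped at t is x stopped at t. The
    expansion is [pairing_increment] for each entry, and the square in time contributes to
    the remainder. *)
Lemma test_ci_derivative t x : t \in `[0, T[ ->
  is_ci_derivative test_fun t x (test_dt t x) (test_grad t x).
Proof.
move=> tT y xy.
have [t0 tT'] : 0 <= t /\ t < T by move: tT; rewrite in_itv/= => /andP[].
pose I (u : R) := \int[mu]_(s in `[t, u]) dotv (test_grad t x) (caputo alpha y s).
exists (fun d => test_fun (t + d) y - test_fun t x - test_dt t x * d - I (t + d)); last first.
  by move=> tau _; rewrite -/(I tau) (addrC t) subrK; ring.
have [M [f df]] := dens_exists alpha01 y; have [bf yE] := df.
have ae := dens_caputo T_gt0 alpha01 df.
have IE u : u <= T -> I u = \sum_i test_grad t x 0 i * \int[mu]_(s in `[t, u]) entry f i s.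
  move=> uT; rewrite -(Rintegral_dotv _ _ _ bf) /I; congr fine.
  case: ae => N [mN N0 hN].
  apply: (@integral_ae _ (measurableTypeR R) R mu _ _ _ _ N) => // s sN.
  rewrite !patchE; case: ifPn => // /set_mem; rewrite /= in_itv/= => /andP[ts su].
  congr (dotv _ _)%:E; apply: contrapT => fg; apply: sN; apply: hN => /= h; apply: fg; apply: h.
  by rewrite in_itv/= (le_trans t0 ts) (le_trans su).
have styx : stop t y = stop t x by apply: (stop_Y T_gt0 alpha01 t0 (ltW tT')).
have [N bz] := bmv_pathB (stop t x) A.
pose z i r := test_dev t x r 0 i.
pose G i := fun r => dsm e (z i r).
apply/cvgrPdist_le => d d0.
have k0 : 0 < `|kappa| * n%:R + 1 by rewrite ltr_wpDl// mulr_ge0.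
have dk : 0 < d / 2 / (`|kappa| * n%:R + 1) by rewrite !divr_gt0.
have H i : \forall u \near (0 : R)^'+,
    `|pairing (fun r => sm e (test_dev (t + u) y r 0 i)) - pairing (fun r => sm e (z i r))
      - slope t (G i) * \int[mu]_(s in `[t, t + u]) entry f i s| <= d / 2 / (`|kappa| * n%:R + 1) * u.
  have [dl dl0 hdl] := pairing_increment T_gt0 alpha01 e0 t0 tT' (bf i) (bz i) dk.
  near=> u.
  have u0 : 0 < u by near: u; exact: nbhs_right_gt.
  have udl : u < dl by near: u; exact: nbhs_right_lt.
  have uT : u < T - t by near: u; apply: nbhs_right_lt; rewrite subr_gt0.
  have := hdl (t + u); rewrite ltrDl ltrD2l -ltrBrDl => /(_ u0 udl uT).
  move=> /(_ (fun r => (Gamma alpha)^-1 * kconv alpha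
    (fun s => upto (t + u) (entry f i) s - upto t (entry f i) s) r) (fun=> erefl)).
  rewrite (addrC t u) addrK (addrC u t).
  have -> : pairing (fun r => sm e (entry (fun s => stop t x s - A s) i r +
      (Gamma alpha)^-1 * kconv alpha (fun s => upto (t + u) (entry f i) s - upto t (entry f i) s) r)) =
    pairing (fun r => sm e (test_dev (t + u) y r 0 i)).
    apply: pairing_eq => r Dr; congr sm.
    rewrite (kconvB _ _ a01 (bm_upto _ (bf i)) (bm_upto _ (bf i))) /entry /test_dev !mxE -styx.
    by rewrite !(stop_densE T_gt0 alpha01 _ _ df)// /entry; ring.
  rewrite RintegralZr//; last exact: (integrable_bm _ _ (bf i)).
  by rewrite (mulrC _ (slope _ _)).
have Hn : \forall u \near (0 : R)^'+, forall i,
    `|pairing (fun r => sm e (test_dev (t + u) y r 0 i)) - pairing (fun r => sm e (z i r))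
      - slope t (G i) * \int[mu]_(s in `[t, t + u]) entry f i s| <= d / 2 / (`|kappa| * n%:R + 1) * u.
  exact: filter_forall.
near=> u.
have u0 : 0 < u by near: u; exact: nbhs_right_gt.
have uT : u < T - t by near: u; apply: nbhs_right_lt; rewrite subr_gt0.
have c0 : 0 < `|c| + 1 by rewrite ltr_wpDl.
have uc : u < d / 2 / (`|c| + 1) by near: u; apply: nbhs_right_lt; rewrite !divr_gt0.
have {}H : forall i,
    `|pairing (fun r => sm e (test_dev (t + u) y r 0 i)) - pairing (fun r => sm e (z i r))
      - slope t (G i) * \int[mu]_(s in `[t, t + u]) entry f i s| <= d / 2 / (`|kappa| * n%:R + 1) * u.
  by near: u; exact: Hn.
rewrite sub0r normrN normrM normfV (gtr0_norm u0) ler_pdivrMr//.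
pose S := \sum_i (pairing (fun r => sm e (test_dev (t + u) y r 0 i)) - pairing (fun r => sm e (z i r))
      - slope t (G i) * \int[mu]_(s in `[t, t + u]) entry f i s).
have -> : test_fun (t + u) y - test_fun t x - test_dt t x * u - I (t + u) = kappa * S + c * u ^+ 2.
  rewrite IE; last by rewrite ltW// -ltrBrDl.
  have -> : \sum_i test_grad t x 0 i * \int[mu]_(s in `[t, t + u]) entry f i s =
    kappa * \sum_i slope t (G i) * \int[mu]_(s in `[t, t + u]) entry f i s.
    by rewrite mulr_sumr; apply: eq_bigr => i _; rewrite mxE mulrA.
  rewrite /S !sumrB /test_fun /test_dt /penalty.
  by rewrite /z; ring.
have Sb : `|S| <= n%:R * (d / 2 / (`|kappa| * n%:R + 1) * u).
  apply: (le_trans (ler_norm_sum _ _ _)).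
  by rewrite -[n in n%:R * _]card_ord mulr_natl -sumr_const; apply: ler_sum => i _.
rewrite (splitr d) mulrDl; apply: (le_trans (ler_normD _ _)); apply: lerD.
  rewrite normrM; apply: (@le_trans _ _ (`|kappa| * (n%:R * (d / 2 / (`|kappa| * n%:R + 1) * u)))).
    by rewrite ler_wpM2l.
  have -> : `|kappa| * (n%:R * (d / 2 / (`|kappa| * n%:R + 1) * u)) =
    d / 2 * u * ((`|kappa| * n%:R) / (`|kappa| * n%:R + 1)) by field; rewrite gt_eqF.
  by apply: ger_ratio; rewrite ?mulr_ge0// ?divr_ge0// ltW.
rewrite normrM normrX (gtr0_norm u0) expr2 mulrA ler_wpM2r ?(ltW u0)//.
move: uc; rewrite ltr_pdivlMr// => /ltW; apply: le_trans.
by rewrite mulrC ler_wpM2l ?(ltW u0)// lerDl.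
Unshelve. all: by end_near. Qed.

Lemma ci_smooth_test : ci_smooth test_fun test_dt test_grad.
Proof.
split; [exact: test_fun_cont|exact: test_ci_derivative|exact: test_dt_cont|exact: test_grad_cont].
Qed.

End test.

End test_functionals.

(** * Densities of dominated set functions *)

Section ultra_limits.
Context {R : realType} {X : Type}.

(** By compactness of a segment. Ultrafilters make all limits exist at once, so no diagonal
    extraction is needed. *)
Lemma ultra_bounded_cvg (U : set_system X) (K : set X) (g : X -> R) (B : R) :
  UltraFilter U -> U K -> (forall x, K x -> `|g x| <= B) -> exists l : R, g @ U --> l.
Proof.
move=> UU UK gB.
have UB : (g @ U) `[- B, B]%classic.
  have KB : K `<=` (g @^-1` `[- B, B]%classic).
    by move=> x Kx; have := gB x Kx; rewrite ler_norml /preimage /= in_itv.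
  exact: filterS KB UK.
have [l [_ cl]] := @segment_compact R (- B) B (g @ U) _ UB.
exists l => O Ol; have [//|Oc] := in_ultra_setVsetC (g @^-1` O) UU.
by have [z []] := cl (~` O) O Oc Ol.
Qed.

End ultra_limits.

Section bounded_radon_nikodym.
Context {R : realType}.
Local Notation RR := (measurableTypeR R).
Variable D : set RR.
Hypotheses (mD : measurable D).
Local Notation mu := (@lebesgue_measure R).
Hypothesis finD : (mu D < +oo)%E.
Local Notation m A := (fine (mu (A `&` D))).

Let mfin (A : set RR) : measurable A -> mu (A `&` D) \is a fin_num.
Proof.
move=> mA; rewrite ge0_fin_numE//; apply: le_lt_trans finD.
apply: le_measure; rewrite ?inE//; exact: measurableI.
Qed.

(** On the set where h > M the integral of h - M is both nonnegative and nonpositive, so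
    this positive function vanishes almost everywhere there. *)
Lemma ae_le_of_integral (h : R -> R) (M : R) : mu.-integrable D (EFin \o h) ->
  (forall A : set RR, measurable A -> A `<=` D -> \int[mu]_(s in A) h s <= M * m A) ->
  {ae mu, forall s, D s -> h s <= M}.
Proof.
move=> ih hM; have mh : measurable_fun D h by apply/measurable_EFinP; exact: measurable_int ih.
pose E := D `&` h @^-1` `]M, +oo[.
have mE : measurable E by apply: mh.
have ED : E `<=` D by move=> s [].
have ihE : mu.-integrable E (EFin \o h) by by apply: (integrableS mD mE ED).
have muE : (mu E < +oo)%E.
  by apply: le_lt_trans finD; apply: le_measure; rewrite ?inE.
have iM : mu.-integrable E (EFin \o cst M).
  apply/integrableP; split; first exact/measurable_EFinP/measurable_cst.
  rewrite (_ : integral _ _ _ = (`|M|%:E * mu E)%E); last by rewrite -integral_cst.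
  by rewrite lte_mul_pinfty ?lee_fin.
have ik : mu.-integrable E (fun s => (h s - M)%:E) by exact: (integrable_sub mE ihE iM).
have le0 : \int[mu]_(s in E) (h s - M) <= 0.
  rewrite RintegralB// subr_le0 Rintegral_cst//.
  by have := hM _ mE ED; rewrite (setIidl ED).
have k0 s : E s -> 0 < h s - M.
  by move=> [_]; rewrite /= in_itv/= andbT subr_gt0.
have ge0 : 0 <= \int[mu]_(s in E) (h s - M).
  by apply: Rintegral_ge0 => s /k0/ltW.
have e0 : (\int[mu]_(s in E) `|(h s - M)%:E|)%E = 0%E.
  transitivity (\int[mu]_(s in E) (h s - M)%:E)%E.
    by apply: eq_integral => s /set_mem/k0 hs; rewrite /= gtr0_norm.
  by rewrite -Rintegral_fin//; congr EFin; apply/eqP; rewrite eq_le le0.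
have mk : measurable_fun E (fun s => (h s - M)%:E) by exact: measurable_int ik.
have /(ae_eq_integral_abs mu mE mk) ae0 := e0.
apply: aeS ae0 => s hs Ds; rewrite leNgt; apply/negP => Mh.
have Es : E s by split=> //=; rewrite in_itv/= andbT.
have := hs Es => -[] /eqP; rewrite subr_eq0 => /eqP hE.
by move: Mh; rewrite hE ltxx.
Qed.

Variables (nu : set RR -> R) (M : R).
Hypothesis nuU : forall A B : set RR, measurable A -> measurable B -> A `&` B = set0 ->
  nu (A `|` B) = nu A + nu B.
Hypothesis nu_le : forall A : set RR, measurable A -> `|nu A| <= M * m A.

Let nuE (A : set (measurableTypeR R)) : \bar R := (nu A)%:E.

Let nu0 : nuE set0 = 0%E.
Proof.
rewrite /nuE; congr EFin; apply/eqP; rewrite -normr_le0.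
by apply: (le_trans (nu_le measurable0)); rewrite set0I measure0 mulr0.
Qed.

Let nu_fin A : measurable A -> nuE A \is a fin_num. Proof. by []. Qed.

Let nu_bigU (F : nat -> set (measurableTypeR R)) k : (forall i, measurable (F i)) ->
  trivIset setT F -> nu (\big[setU/set0]_(0 <= i < k) F i) = \sum_(0 <= i < k) nu (F i).
Proof.
move=> mF tF; elim: k => [|k IH].
  by rewrite !big_geq//; case: nu0.
rewrite !big_nat_recr//= nuU ?IH//.
- by rewrite big_mkord; apply: bigsetU_measurable => i _; exact: mF.
- rewrite big_mkord -bigcup_mkord; apply/seteqP; split=> // s [[i /= ik Fi] Fk].
  by have := tF i k I I (ex_intro _ s (conj Fi Fk)) => ik'; rewrite ik' ltnn in ik.
Qed.

(* countable additivity comes from domination: the tail of a disjoint union has small measure *)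
Let nu_sigma : semi_sigma_additive nuE.
Proof.
move=> F mF tF mUF.
have mFR i : measurable (F i) by exact: mF.
have cm := @measure_semi_sigma_additive _ _ _ (mrestr mu mD) F mF tF mUF.
have {}cm : (\sum_(0 <= i < k) m (F i)) @[k --> \oo] --> m (\bigcup_i F i).
  have : (\sum_(0 <= i < k) mu (F i `&` D))%E @[k --> \oo] --> (m (\bigcup_i F i))%:E.
    by rewrite fineK ?mfin.
  have -> : (fun k => \sum_(0 <= i < k) mu (F i `&` D))%E =
      (fun k => (\sum_(0 <= i < k) m (F i))%:E).
    apply/funext => k; rewrite -sumEFin; apply: eq_bigr => i _.
    by rewrite fineK ?mfin.
  by move/fine_cvgP => [_].
have mnu : (\sum_(0 <= i < k) nu (F i)) @[k --> \oo] --> nu (\bigcup_i F i).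
  apply/cvgrPdist_le => e e0.
  have M0 : 0 < `|M| + 1 by rewrite ltr_wpDl.
  have /cvgrPdist_le/(_ _ (divr_gt0 e0 M0)) := cm; apply: filterS => k hk.
  pose P := \big[setU/set0]_(0 <= i < k) F i.
  have mP : measurable P by rewrite /P big_mkord; apply: bigsetU_measurable => i _; exact: mF.
  have PU : P `<=` \bigcup_i F i.
    by rewrite /P big_mkord -bigcup_mkord => s [i _ Fi]; exists i.
  have mQ : measurable (\bigcup_i F i `\` P) by exact: measurableD.
  have UE : \bigcup_i F i = P `|` (\bigcup_i F i `\` P).
    by rewrite setDUK.
  have PQ : P `&` (\bigcup_i F i `\` P) = set0 by rewrite setDE setICA setICr setI0.
  have mE : m (\bigcup_i F i `\` P) = m (\bigcup_i F i) - \sum_(0 <= i < k) m (F i).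
    have -> : \sum_(0 <= i < k) m (F i) = m P.
      have := @measure_semi_additive _ _ _ (mrestr mu mD) F k mF tF.
      have mPk : measurable (\big[setU/set0]_(i < k) F i) by apply: bigsetU_measurable => i _; exact: mF.
      move=> /(_ mPk) hh; rewrite /P !big_mkord.
      have -> : m (\big[setU/set0]_(i < k) F i) = fine (\sum_(i < k) mu (F i `&` D))%E by rewrite (_ : mu _ = mrestr mu mD (\big[setU/set0]_(i < k) F i))// hh.
      rewrite (_ : (\sum_(i < k) mu (F i `&` D))%E = (\sum_(i < k) m (F i))%:E)//.
      by rewrite -sumEFin; apply: eq_bigr => i _; rewrite fineK ?mfin.
    rewrite {2}UE setIUl measureU; last 3 first.
    - exact: measurableI.
    - exact: measurableI.
    - by rewrite setIACA PQ set0I.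
    by rewrite fineD ?mfin// [X in X - _]addrC addrK.
  rewrite {1}UE nuU// nu_bigU// [X in X - _]addrC addrK.
  apply: (le_trans (nu_le mQ)); rewrite mE.
  move: hk; rewrite ler_pdivlMr//; apply: le_trans.
  rewrite mulrC; apply: (le_trans (ler_norm _)); rewrite normrM ler_wpM2l//.
  by rewrite lerDl.
have -> : (fun k => \sum_(0 <= i < k) nuE (F i))%E = EFin \o (fun k => \sum_(0 <= i < k) nu (F i)).
  by apply/funext => k; rewrite /= -sumEFin.
exact: cvg_comp mnu _.
Qed.

HB.instance Definition _ := isCharge.Build _ _ _ nuE nu0 nu_fin nu_sigma.

(** Domination by a multiple of the Lebesgue measure upgrades finite additivity to countable
    additivity and gives absolute continuity, so that the Radon-Nikodym theorem applies; it
    also bounds the derivative almost everywhere, and clipping makes the bound hold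
    everywhere. *)
Lemma bounded_density : exists2 g : R -> R, bm `|M| g &
  forall A : set RR, measurable A -> nu A = \int[mu]_(s in A `&` D) g s.
Proof.
have dom : nuE `<< mu.
  apply/null_content_dominatesP => A mA A0; congr EFin; apply/eqP; rewrite -normr_le0.
  apply: (le_trans (nu_le mA)); have -> : mu (A `&` D) = 0%E; last by rewrite mulr0.
  apply/eqP; rewrite -measure_le0 -A0; apply: le_measure; rewrite ?inE//.
  exact: measurableI.
pose h0 := Radon_Nikodym nuE mu; pose h s := fine (h0 s).
have hE s : (h s)%:E = h0 s by rewrite fineK// Radon_Nikodym_fin_num.
have ih : mu.-integrable setT (EFin \o h).
  have -> : EFin \o h = h0 by apply/funext => s; rewrite /= hE.
  exact: Radon_Nikodym_integrable.
have nuh A : measurable A -> nu A = \int[mu]_(s in A) h s.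
  move=> mA; have := Radon_Nikodym_integral dom mA.
  rewrite /Rintegral => e; rewrite (_ : integral _ _ _ = nuE A)// e.
  by apply: eq_integral => s _; rewrite /= hE.
have ihD : mu.-integrable D (EFin \o h) by apply: (integrableS measurableT).
have h1 : {ae mu, forall s, D s -> h s <= M}.
  apply: ae_le_of_integral => // A mA _; rewrite -nuh//.
  exact: le_trans (ler_norm _) (nu_le mA).
have h2 : {ae mu, forall s, D s -> - h s <= M}.
  apply: ae_le_of_integral.
    apply: (@eq_integrable _ _ _ mu D _ (fun s => - (h s)%:E)%E) => //.
    exact: integrableN.
  move=> A mA _; have -> : \int[mu]_(s in A) - h s = - nu A.
    rewrite nuh//; under eq_Rintegral do rewrite -mulN1r.
    by rewrite RintegralZl ?mulN1r//; apply: (integrableS measurableT).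
  by apply: le_trans (nu_le mA); rewrite -normrN ler_norm.
have mhD : measurable_fun D h by apply/measurable_EFinP; exact: measurable_int ihD.
pose g := (fun s => Num.max (- `|M|) (Num.min `|M| (h s))) \_ D.
exists g.
  apply: bm_patch => //.
    by apply: measurable_maxr => //; apply: measurable_minr.
  move=> s _.
  by rewrite ler_norml le_max lexx/= ge_max ge_min lexx/= andbT; have := normr_ge0 M; lra.
move=> A mA; have mAD : measurable (A `&` D) by exact: measurableI.
have -> : nu A = nu (A `&` D).
  have -> : nu A = nu (A `&` D `|` A `\` D) by rewrite setUIDK.
  rewrite nuU//; last 2 first.
  - exact: measurableD.
  - by rewrite setDE setIACA setICr setI0.
  suff -> : nu (A `\` D) = 0 by rewrite addr0.
  apply/eqP; rewrite -normr_le0; apply: (le_trans (nu_le (measurableD mA mD))).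
  by rewrite setDE -setIA setICl setI0 measure0 mulr0.
rewrite nuh//; congr fine.
have [N [mN N0 hN]] := aeI h1 h2.
apply: (@integral_ae _ (measurableTypeR R) R mu _ _ _ _ N) => // s sN.
rewrite !patchE; case: ifPn => // /set_mem[_ Ds]; congr EFin.
have [a1 a2] : (h s <= M) /\ (- h s <= M).
  by apply: contrapT => hc; apply: sN; apply: hN => /= -[b1 b2]; apply: hc; split; [exact: b1|exact: b2].
rewrite /g patchE mem_set//.
have hM : h s <= `|M| by rewrite (le_trans a1)// ler_norm.
have hM' : - `|M| <= h s by rewrite lerNl (le_trans a2)// ler_norm.
by rewrite (min_idPr hM) (max_idPr hM').
Qed.

End bounded_radon_nikodym.

(** * A priori bound on the sets X_k *)

Section apriori.
Context {R : realType} {n : nat} {T alpha : R}.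
Hypotheses (T_gt0 : 0 < T) (alpha01 : 0 < alpha < 1).
Local Notation mu := (@lebesgue_measure R).
Local Notation V := 'rV[R]_n.
Local Notation AC := (ACa n T alpha).
Local Notation D := `[0, T]%classic.
Local Notation kconv := (@kconv R T).
Implicit Types (x y A : AC) (f g z : R -> V).

Let T0 : 0 <= T. Proof. exact: ltW. Qed.
Let a0 : 0 < alpha. Proof. by case/andP: alpha01. Qed.
Let a1 : alpha < 1. Proof. by case/andP: alpha01. Qed.
Let a01 : 0 < alpha <= 1. Proof. by rewrite a0 ltW. Qed.
Let G0 : 0 < Gamma alpha. Proof. exact: Gamma_gt0. Qed.
Let Gi : 0 <= (Gamma alpha)^-1. Proof. by rewrite invr_ge0 ltW. Qed.

Lemma kconvZ a M (f : R -> R) (r tau : R) : 0 < a <= 1 -> bm M f ->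
  kconv a (fun s => r * f s) tau = r * kconv a f tau.
Proof.
move=> ha bf; rewrite /kconv -RintegralZl//; last exact: (integrable_kconv T tau ha bf).
by apply: eq_Rintegral => s _; rewrite mulrCA.
Qed.

Lemma kconvD a M N (f g : R -> R) (tau : R) : 0 < a <= 1 -> bm M f -> bm N g ->
  kconv a (fun s => f s + g s) tau = kconv a f tau + kconv a g tau.
Proof.
move=> ha bf bg; rewrite /kconv -RintegralD//.
- by apply: eq_Rintegral => s _; rewrite mulrDr.
- exact: (integrable_kconv T tau ha bf).
- exact: (integrable_kconv T tau ha bg).
Qed.

Lemma kconv_mono a M N (f g : R -> R) (tau : R) : 0 < a <= 1 -> bm M f -> bm N g ->
  (forall s, D s -> s < tau -> `|f s| <= g s) -> `|kconv a f tau| <= kconv a g tau.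
Proof.
move=> ha bf bg fg.
have i1 := integrable_kconv T tau ha bf; have i2 := integrable_kconv T tau ha bg.
apply: le_Rintegral_norm => // s Ds; rewrite normrM (ger0_norm (ker_ge0 _ _)).
have [taus|staus] := leP tau s; first by rewrite ker_le0 ?subr_le0// !mul0r.
by rewrite ler_wpM2l ?ker_ge0// fg.
Qed.

Lemma measurable_enorm f : (forall i, measurable_fun setT (entry f i)) ->
  measurable_fun setT (fun s => enorm (f s)).
Proof.
move=> mf; apply: (@measurableT_comp _ _ _ _ _ _ (@Num.sqrt R)).
  by apply: continuous_measurable_fun; exact: sqrt_continuous.
rewrite /dotv; apply: measurable_sum => i.
by apply: measurable_funM; exact: mf.
Qed.

Lemma dens_ae M f g x : dens M f x -> bmv M g -> aeD (T:=T) f g -> dens M g x.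
Proof.
move=> [bf xE] bg [N [mN N0 hN]]; split=> // tau i tauT; rewrite xE//; congr (_ + _ * _).
rewrite /kconv; congr fine.
apply: (@integral_ae _ (measurableTypeR R) R mu _ _ _ _ N) => // s sN.
rewrite !patchE; case: ifPn => // /set_mem Ds; congr (_ * _)%:E; rewrite /entry.
suff -> : f s = g s by [].
by apply: contrapT => fg; apply: sN; apply: hN => /= h; apply: fg; apply: h.
Qed.

(** Setting the density to zero where the inequality fails changes it on a null set only. *)
Lemma Xset_dens c k x : 0 <= c -> Xset c k x -> exists M f, dens M f x /\
  forall s, enorm (f s) <= k%:R * c * (1 + enorm (x s)).
Proof.
move=> c0 [_ xk]; have [M [f df]] := dens_exists alpha01 x; have [bf _] := df.
pose g s := if enorm (f s) <= k%:R * c * (1 + enorm (x s)) then f s else 0.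
have [N bx] := bmv_path T_gt0 alpha01 x.
exists M, g; split; last first.
  move=> s; rewrite /g; case: ifP => // _; rewrite enorm0 mulr_ge0// ?mulr_ge0//.
  by rewrite addr_ge0// enorm_ge0.
apply: (dens_ae df).
  move=> i; split.
    have -> : entry g i = fun s => if enorm (f s) <= k%:R * c * (1 + enorm (x s))
        then entry f i s else 0.
      by apply/funext => s; rewrite /entry /g; case: ifP => // _; rewrite mxE.
    apply: measurable_fun_ifT => //; last by case: (bf i).
    apply: measurable_fun_ler; first by apply: measurable_enorm => j; case: (bf j).
    apply: measurable_funM; first exact: measurable_cst.
    apply: measurable_funD; first exact: measurable_cst.
    by apply: measurable_enorm => j; case: (bx j).
  move=> s; rewrite /entry /g; case: ifP => _; last by rewrite mxE normr0; exact: bm_ge0 (bf i).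
  by have [_ h] := bf i; exact: (h s).
have H := aeI xk (dens_caputo T_gt0 alpha01 df).
by apply: aeS H => s [h1 h2] sT; rewrite /g -(h2 sT) (h1 sT).
Qed.

(** Below tau - d the exponential is small compared with its value at tau, when L is large;
    between tau - d and tau the kernel has small mass, when d is small. *)
Lemma exp_weight (th : R) : 0 < th -> exists2 L : R, 0 <= L &
  exists2 N : R, bm N ((fun s => expR (L * s)) \_ D) &
  forall tau, tau \in `[0, T] -> kconv alpha ((fun s => expR (L * s)) \_ D) tau <= th * expR (L * tau).
Proof.
move=> th0; have th2 : 0 < th / 2 by rewrite divr_gt0.
have [dl dl0 hdl] := kerprim_small a0 th2.
pose d := dl / 2; have d0 : 0 < d by rewrite divr_gt0.
have kd : kerprim alpha d <= th / 2 by apply/ltW/hdl; rewrite /d ltr_pdivrMr// ltr_pMr// ltr1n.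
pose K := kerprim alpha T; have K0 : 0 <= K by exact: kerprim_ge0.
pose eta := Num.min 1 (th / 2 / (K + 1)).
have K1 : 0 < K + 1 by rewrite ltr_wpDl.
have eta0 : 0 < eta by rewrite lt_min ltr01 divr_gt0.
pose L := - ln eta / d.
have L0 : 0 <= L by rewrite /L divr_ge0 ?(ltW d0)// oppr_ge0 ln_le0// ge_min lexx.
exists L => //.
have bP : bm (expR (L * T)) ((fun s => expR (L * s)) \_ D).
  apply: bm_patch => //.
    by apply: measurable_funTS; apply: measurableT_comp => //.
  move=> s; rewrite /= in_itv/= => /andP[s0 sT]; rewrite ger0_norm ?expR_ge0// ler_expR.
  exact: ler_wpM2l.
exists (expR (L * T)) => // tau tauT.
have [tau0 tauT'] : 0 <= tau /\ tau <= T by move: tauT; rewrite in_itv/= => /andP[].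
pose I s : R := upto tau (fun _ => 1 : R) s - upto (tau - d) (fun _ => 1 : R) s.
have bI : bm (1 + 1) I by apply: bmB; apply: bm_upto; exact: bm_cst1.
have b1 := @bm_cst1 R.
have bQ := bmZ (expR (L * tau)) (bmD (bmZ eta b1) bI).
have h := @kconv_mono alpha _ _ _ _ tau a01 bP bQ.
apply: (le_trans (ler_norm _)); apply: (le_trans (h _)).
  move=> s Ds staus; rewrite patchE mem_set// ger0_norm ?expR_ge0//.
  rewrite mulr1 /I /upto staus; case: ltP => std.
    have eE : expR (ln eta) = eta by rewrite lnK ?posrE.
    rewrite subrr addr0 -eE -expRD ler_expR.
    have -> : ln eta = - (L * d) by rewrite /L mulrAC -mulrA divff ?gt_eqF// mulr1 opprK.
    by rewrite -mulrBr ler_wpM2l// ltW.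
  rewrite subr0; apply: (@le_trans _ _ (expR (L * tau))).
    by rewrite ler_expR ler_wpM2l// ltW.
  by rewrite ler_peMr ?expR_ge0// lerDr ltW.
move=> {h}; rewrite (kconvZ _ _ a01 (bmD (bmZ eta b1) bI)).
rewrite (kconvD _ a01 (bmZ eta b1) bI) (kconvZ _ _ a01 b1) mulrC ler_wpM2r ?expR_ge0//.
rewrite [leRHS]splitr; apply: lerD.
  apply: (@le_trans _ _ (eta * K)).
    rewrite ler_wpM2l ?(ltW eta0)//; apply: (le_trans (ler_norm _)).
    apply: (le_trans (kconv_le tau a01 T0 b1)); rewrite mul1r (@kerprim_le0 _ _ (tau - T)) ?subr_le0// subr0.
    by apply: le_kerprim => //; exact: ltW.
  apply: (@le_trans _ _ (th / 2 / (K + 1) * K)).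
    by rewrite ler_wpM2r// ge_min lexx orbT.
  by rewrite mulrAC -mulrA; apply: ger_ratio => //; exact: ltW.
have hI := @kconv_upto_dist R T alpha 1 (fun=> 1) (tau - d) tau tau a01 b1.
rewrite (kconvB _ _ a01 (bm_upto _ b1) (bm_upto _ b1)).
apply: (le_trans (ler_norm _)); apply: (le_trans hI).
by rewrite mul1r opprB addrC subrK (gtr0_norm d0).
Qed.

(** The fractional Gronwall inequality, by a weighted norm: let W be the supremum of |x (s)|
    exp (- L s). By [exp_weight] the integral equation gives W <= const + W / 2 for L large,
    whatever the path. *)
Lemma Xset_bound c k : 0 <= c -> exists B : R, forall x, Xset c k x ->
  forall s i, s \in `[0, T] -> `|x s 0 i| <= B.
Proof.
move=> c0; pose C := k%:R * c; have C0 : 0 <= C by rewrite mulr_ge0.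
pose kap := (Gamma alpha)^-1 * C * (n%:R + 1).
have kap0 : 0 <= kap by rewrite !mulr_ge0// addr_ge0.
have th0 : 0 < 2^-1 / (kap + 1) by rewrite divr_gt0// ltr_wpDl.
have [L L0 [N bP hP]] := exp_weight th0.
exists (2 * (k%:R + 2^-1) * expR (L * T)) => x xk s i sT.
have [M [f [[bf xE] fC]]] := Xset_dens c0 xk.
have [x0k _] := xk.
have [Nx bx] := bmv_path T_gt0 alpha01 x.
pose S : set R := [set r | r = 0 \/ exists u j, u \in `[0, T] /\ r = `|x u 0 j| / expR (L * u)].
have exp1 u : u \in `[0, T] -> 1 <= expR (L * u).
  rewrite in_itv/= => /andP[u0 _]; rewrite -expR0 ler_expR mulr_ge0//.
have hS : has_sup S.
  split; first by exists 0; left.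
  exists `|Nx| => r [->//|[u [j [uT ->]]]]; rewrite ler_pdivrMr ?expR_gt0//.
  apply: (@le_trans _ _ `|Nx|); last by rewrite ler_peMr// exp1.
  have [_ h] := bx j; apply: (le_trans (h u)); exact: ler_norm.
pose W := sup S.
have W0 : 0 <= W by apply: ub_le_sup; [exact: hS.2|left].
have xW u j : u \in `[0, T] -> `|x u 0 j| <= W * expR (L * u).
  move=> uT; rewrite -ler_pdivrMr ?expR_gt0//; apply: ub_le_sup; first exact: hS.2.
  by right; exists u, j.
have eW u : u \in `[0, T] -> enorm (x u) <= n%:R * W * expR (L * u).
  by move=> uT; rewrite -mulrA; apply: enorm_le_const => j; exact: xW.
have step u j : u \in `[0, T] -> `|x u 0 j| / expR (L * u) <= k%:R + 2^-1 + W / 2.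
  move=> uT; rewrite ler_pdivrMr ?expR_gt0// xE//.
  apply: (le_trans (ler_normD _ _)).
  have Q0 : 0 <= C * (1 + n%:R * W) by rewrite mulr_ge0// addr_ge0// mulr_ge0.
  have bQ := bmZ (C * (1 + n%:R * W)) bP.
  have h : `|kconv alpha (entry f j) u| <= C * (1 + n%:R * W) * (2^-1 / (kap + 1) * expR (L * u)).
    apply: (le_trans (kconv_mono a01 (bf j) bQ _)); last first.
      by rewrite (kconvZ _ _ a01 bP) ler_wpM2l// hP.
    move=> r Dr _; rewrite patchE mem_set//.
    apply: (le_trans (le_enorm (f r) j)); apply: (le_trans (fC r)).
    rewrite -[C * _ * _]mulrA; apply: ler_wpM2l => //; rewrite mulrDl mul1r.
    by apply: lerD; [exact: exp1|exact: eW].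
  rewrite normrM (ger0_norm Gi).
  have h2 := ler_wpM2l Gi h.
  have h1 : `|x 0 0 j| <= k%:R * expR (L * u).
    by apply: (le_trans (le_enorm _ j)); apply: (le_trans x0k); rewrite ler_peMr// exp1.
  apply: (le_trans (lerD h1 h2)).
  rewrite -addrA mulrDl lerD2l !mulrA ler_wpM2r ?expR_ge0//.
  rewrite ler_pdivrMr ?ltr_wpDl//.
  have -> : (2^-1 + W / 2) = (1 + W) / 2 by field.
  rewrite [leRHS]mulrAC ler_pM2r ?invr_gt0//.
  set g := (Gamma alpha)^-1 * k%:R * c; have g1 : 0 <= g by rewrite !mulr_ge0.
  have -> : kap = g * (n%:R + 1) by rewrite /kap /C /g; ring.
  have -> : (1 + W) * (g * (n%:R + 1) + 1) =
    g * (1 + n%:R * W) + (g * n%:R + g * W + (1 + W)) by ring.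
  by rewrite lerDl !addr_ge0// mulr_ge0.
have WW : W <= k%:R + 2^-1 + W / 2.
  apply: ge_sup; first by exists 0; left.
  by move=> r [->|[u [j [uT ->]]]]; [rewrite !addr_ge0// ?divr_ge0|exact: step].
have W2 : W <= 2 * (k%:R + 2^-1) by lra.
apply: (le_trans (xW s i sT)).
have E0 : 0 <= expR (L * s) by exact: expR_ge0.
apply: ler_pM => //.
by rewrite ler_expR ler_wpM2l//; move: sT; rewrite in_itv/= => /andP[].
Qed.

End apriori.

(** * Inversion of the fractional integral *)

Section limits.
Context {R : realType}.

Lemma cvg_le_bound {X : Type} (F : set_system X) (g : X -> R) (l K : R) : ProperFilter F ->
  g @ F --> l -> (\forall x \near F, g x <= K) -> l <= K.
Proof.
move=> FF gl gK; rewrite -(cvg_lim (@Rhausdorff R) gl); apply: limr_le => //.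
by apply/cvg_ex; exists l.
Qed.

Lemma cvg_norm_bound {X : Type} (F : set_system X) (g : X -> R) (l K : R) : ProperFilter F ->
  g @ F --> l -> (\forall x \near F, `|g x| <= K) -> `|l| <= K.
Proof.
move=> FF gl gK; rewrite ler_norml; apply/andP; split; last first.
  apply: (cvg_le_bound FF gl); apply: filterS gK => x; exact: le_trans (ler_norm _).
rewrite lerNl; apply: (cvg_le_bound FF (cvgN gl)); apply: filterS gK => x.
by rewrite -normrN; exact: le_trans (ler_norm _).
Qed.

Lemma is_derive_right_le (F : R -> R) (s l K dl : R) : is_derive s 1 F l -> 0 < dl ->
  (forall h, 0 < h -> h < dl -> F (s + h) - F s <= K * h) -> l <= K.
Proof.
move=> [dF lE] dl0 FK.
have : h^-1 *: ((F \o shift s) (h *: 1) - F s) @[h --> 0^'] --> l.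
  by rewrite -lE; exact: dF.
move=> /cvg_dnbhs_at_right h; apply: (cvg_le_bound _ h).
near=> u.
have u0 : 0 < u by near: u; exact: nbhs_right_gt.
have ud : u < dl by near: u; exact: nbhs_right_lt.
rewrite /= /GRing.scale /= mulr1 (addrC u) ler_pdivrMl// mulrC.
exact: FK.
Unshelve. all: by end_near. Qed.

End limits.

Section inversion.
Context {R : realType}.
Variables (T alpha : R).
Hypotheses (T_gt0 : 0 < T) (alpha01 : 0 < alpha < 1).
Local Notation mu := (@lebesgue_measure R).
Local Notation D := `[0, T]%classic.
Local Notation kconv := (@kconv R T).
Implicit Types (f g u y : R -> R).

Let T0 : 0 <= T. Proof. exact: ltW. Qed.
Let a0 : 0 < alpha. Proof. by case/andP: alpha01. Qed.
Let a1 : alpha < 1. Proof. by case/andP: alpha01. Qed.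
Let a01 : 0 < alpha <= 1. Proof. by rewrite a0 ltW. Qed.
Let b01 : 0 < 1 - alpha <= 1.
Proof. by apply/andP; split; [rewrite subr_gt0|rewrite lerBlDr lerDl ltW]. Qed.
Let G0 : 0 < Gamma alpha. Proof. exact: Gamma_gt0. Qed.
Let Gi : 0 <= (Gamma alpha)^-1. Proof. by rewrite invr_ge0 ltW. Qed.

Definition unif_cont_at (u : R -> R) (tau : R) := forall e : R, 0 < e -> exists2 dl : R, 0 < dl &
  forall s, s \in `[0, T] -> `|s - tau| < dl -> `|u s - u tau| <= e.

Lemma kconv1_itv M f (a b : R) : bm M f -> 0 <= a -> a <= b -> b <= T ->
  kconv 1 f b - kconv 1 f a = \int[mu]_(s in `[a, b]) f s.
Proof.
move=> bf a0' ab bT.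
have k1 t : kconv 1 f t = \int[mu]_(s in D) upto t f s.
  apply: eq_Rintegral => s _; rewrite /ker /upto subr_gt0; case: ifP => _; last by rewrite mul0r.
  by rewrite subrr powRr0 mul1r.
rewrite !k1 -RintegralB//; last 2 first.
- exact: (integrable_bm 0 T (bm_upto b bf)).
- exact: (integrable_bm 0 T (bm_upto a bf)).
have := Rintegral_window f (fun _ => 1) a0' ab bT.
under eq_Rintegral do rewrite mulr1.
by under [in RHS]eq_Rintegral do rewrite mulr1.
Qed.

(** If u (tau) were nonzero, u would keep its sign and half its size on an interval. *)
Lemma zero_of_integrals M u : bm M u -> (forall tau, tau \in `[0, T] -> unif_cont_at u tau) ->
  (forall tau, tau \in `[0, T] -> kconv 1 u tau = 0) -> forall tau, tau \in `[0, T] -> u tau = 0.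
Proof.
move=> bu cu iu tau tauT; apply: contrapT => /eqP u0.
have e0 : 0 < `|u tau| / 2 by rewrite divr_gt0// normr_gt0.
have [dl dl0 h] := cu tau tauT _ e0.
have [tau0 tauT'] : 0 <= tau /\ tau <= T by move: tauT; rewrite in_itv/= => /andP[].
pose a := Num.max 0 (tau - dl / 2); pose b := Num.min T (tau + dl / 2).
have dl2 : 0 < dl / 2 by rewrite divr_gt0.
have dl3 : dl / 2 < dl by rewrite ltr_pdivrMr// ltr_pMr// ltr1n.
have a0' : 0 <= a by rewrite le_max lexx.
have bT : b <= T by rewrite ge_min lexx.
have ataub : (a <= tau /\ tau <= b) /\ (tau - dl / 2 <= a /\ b <= tau + dl / 2).
  split; split.
  - by rewrite ge_max tau0/= gerBl ltW.
  - by rewrite le_min tauT'/= lerDl ltW.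
  - by rewrite le_max lexx orbT.
  - by rewrite ge_min lexx orbT.
have ab : a < b.
  rewrite lt_min !gt_max T_gt0/=; apply/andP; split; first by apply: (lt_le_trans _ tauT'); rewrite gtrBl.
  by apply/andP; split; [rewrite (le_lt_trans tau0)// ltrDl|lra].
case: ataub => -[atau taub] [ad bd].
have aT : a \in `[0, T] by rewrite in_itv/= a0' (le_trans atau).
have bT' : b \in `[0, T] by rewrite in_itv/= bT (le_trans tau0).
have i0 : \int[mu]_(s in `[a, b]) u s = 0.
  by rewrite -(kconv1_itv bu a0' (ltW ab) bT) !iu// subrr.
have ic : mu.-integrable `[a, b] (EFin \o cst (u tau)).
  exact: (integrable_bm a b (bm_cst (u tau))).
have iu' : mu.-integrable `[a, b] (EFin \o u) by exact: (integrable_bm a b bu).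
have hb : `|\int[mu]_(s in `[a, b]) (u s - u tau)| <= `|u tau| / 2 * (b - a).
  apply: Rintegral_bound; first exact: ltW.
    by apply: measurable_funB; [exact: bm_measurable bu|exact: measurable_cst].
  move=> s; rewrite in_itv/= => /andP[as_ sb]; apply: h.
    by rewrite in_itv/= (le_trans a0' as_) (le_trans sb bT).
  by rewrite ltr_norml; apply/andP; split; lra.
have : \int[mu]_(s in `[a, b]) (u s - u tau) = - (u tau * (b - a)).
  rewrite RintegralB// i0 sub0r Rintegral_cst//; congr (- (_ * _)).
  by rewrite /= lebesgue_measure_itv/= lte_fin ab.
move=> E; move: hb; rewrite E normrN normrM (gtr0_norm (x:=b - a)) ?subr_gt0//.
rewrite ler_pM2r ?subr_gt0// leNgt => /negP; apply.
by rewrite ltr_pdivrMr// ltr_pMr ?ltr1n// normr_gt0.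
Qed.

(** The difference u of the two sides is continuous, and its fractional integral of order 1
    - alpha vanishes. Applying the integral of order alpha, the semigroup law shows that its
    primitive vanishes. *)
Lemma frac_inversion M N y g : bm N y -> bm M g ->
  (forall tau, tau \in `[0, T] -> unif_cont_at y tau) ->
  (forall tau, tau \in `[0, T] ->
    kconv (1 - alpha) (fun s => y s - y 0) tau = Gamma (1 - alpha) * kconv 1 g tau) ->
  forall tau, tau \in `[0, T] -> y tau = y 0 + (Gamma alpha)^-1 * kconv alpha g tau.
Proof.
move=> b_y bg cy yg tau tauT; have [G1 G2 GB] := Gamma_mul alpha01.
pose u s := (y s - y 0) - (Gamma alpha)^-1 * kconv alpha g s.
have bk := bm_kconv T0 a01 bg.
have bZ := bmZ (Gamma alpha)^-1 bk.
have by0 := bmB b_y (bm_cst (y 0)).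
have bu : bm _ u := bmB by0 bZ.
suff : u tau = 0.
  by move/eqP; rewrite subr_eq0 subr_eq => /eqP ->; rewrite addrC.
apply: (zero_of_integrals bu) => // {}tau {}tauT.
- move=> e e0; have e2 : 0 < e / 2 by rewrite divr_gt0.
  have [d1 d10 h1] := cy tau tauT _ e2.
  have ck : {for tau, continuous (kconv alpha g)} by exact: (continuous_kconv T0 a01 bg).
  have e3 : 0 < e / 2 * Gamma alpha by rewrite mulr_gt0.
  have /cvgrPdist_le/(_ _ e3) /nbhs_ballP[d2 /= d20 h2] := ck.
  exists (Num.min d1 d2); first by rewrite lt_min d10.
  move=> s sT; rewrite lt_min => /andP[s1 s2].
  have -> : u s - u tau = (y s - y tau) + (Gamma alpha)^-1 * (kconv alpha g tau - kconv alpha g s).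
    rewrite /u; move: (kconv alpha g tau) (kconv alpha g s) (y s) (y tau) (y 0) => *; ring.
  apply: (le_trans (ler_normD _ _)); rewrite [leRHS]splitr; apply: lerD; first exact: h1.
  rewrite normrM (ger0_norm Gi) ler_pdivrMl// mulrC; apply: h2.
  by rewrite /ball/= distrC.
have [tau0 tauT'] : 0 <= tau /\ tau <= T by move: tauT; rewrite in_itv/= => /andP[].
have ku s : s \in `[0, T] -> kconv (1 - alpha) u s = 0.
  move=> sT; have sT' : s <= T by move: sT; rewrite in_itv/= => /andP[].
  rewrite (kconvB _ _ b01 by0 bZ) (kconvZ _ _ b01 bk) yg//.
  rewrite (kconv_kconv T0 a01 b01 _ bg sT'); last by rewrite addrC subrK.
  have -> : alpha + (1 - alpha) = 1 by ring.
  by rewrite -GB mulrA mulKf ?gt_eqF// subrr.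
have k0 : kconv alpha (kconv (1 - alpha) u) tau = 0.
  rewrite /kconv /Rintegral integral0_eq// => s sT; congr EFin.
  by rewrite -[X in _ * X]/(kconv (1 - alpha) u s) ku ?mulr0.
move: k0; rewrite (kconv_kconv T0 b01 a01 _ bu tauT'); last by rewrite subrK.
have -> : 1 - alpha + alpha = 1 by ring.
move/eqP; rewrite mulf_eq0 gt_eqF/=; first by move/eqP.
by apply: beta_gt0 => //; rewrite subr_gt0.
Qed.

End inversion.

(** * Compactness of the sets X_k *)

Section compactness.
Context {R : realType} {n : nat} {T alpha : R}.
Hypotheses (T_gt0 : 0 < T) (alpha01 : 0 < alpha < 1).
Local Notation mu := (@lebesgue_measure R).
Local Notation RR := (measurableTypeR R).
Local Notation V := 'rV[R]_n.
Local Notation AC := (ACa n T alpha).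
Local Notation D := `[0, T]%classic.
Local Notation kconv := (@kconv R T).
Implicit Types (x y A : AC) (f g z : R -> V).

Let T0 : 0 <= T. Proof. exact: ltW. Qed.
Let a0 : 0 < alpha. Proof. by case/andP: alpha01. Qed.
Let a1 : alpha < 1. Proof. by case/andP: alpha01. Qed.
Let a01 : 0 < alpha <= 1. Proof. by rewrite a0 ltW. Qed.
Let b01 : 0 < 1 - alpha <= 1.
Proof. by apply/andP; split; [rewrite subr_gt0|rewrite lerBlDr lerDl ltW]. Qed.
Let G0 : 0 < Gamma alpha. Proof. exact: Gamma_gt0. Qed.
Let Gi : 0 <= (Gamma alpha)^-1. Proof. by rewrite invr_ge0 ltW. Qed.

(** By the a priori bound the linear growth in the definition of X_k is a constant bound,
    the same for all paths. *)
Lemma Xset_density c k : 0 <= c -> exists2 M : R, 0 <= M &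
  forall x, Xset c k x -> exists f, dens M f x /\
    forall s, enorm (f s) <= k%:R * c * (1 + enorm (x s)).
Proof.
move=> c0; have [B hB] := Xset_bound T_gt0 alpha01 k c0 (n:=n).
pose B' := `|B|; have B'0 : 0 <= B' by exact: normr_ge0.
exists (k%:R * c * (1 + n%:R * B')); first by apply: mulr_ge0; [exact: mulr_ge0|apply: addr_ge0 => //; exact: mulr_ge0].
move=> x xk; have [M [f [[bf xE] fC]]] := Xset_dens T_gt0 alpha01 c0 xk.
exists f; split=> //; split=> // i; split; first by case: (bf i).
move=> s; apply: (le_trans (le_enorm (f s) i)); apply: (le_trans (fC s)).
apply: ler_wpM2l; first exact: mulr_ge0.
rewrite lerD2l; apply: enorm_le_const => j.
have [sT|sT] := boolP (s \in `[0, T]); last by rewrite ACa_out// mxE normr0 normr_ge0.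
exact: le_trans (hB x xk s j sT) (ler_norm _).
Qed.

Section closure.
Variables (c M : R) (k : nat) (U : set_system AC).
Hypotheses (c0 : 0 <= c) (M0 : 0 <= M).
Hypothesis hM : forall x, Xset c k x -> exists f, dens M f x /\
    forall s, enorm (f s) <= k%:R * c * (1 + enorm (x s)).
Hypotheses (UU : UltraFilter U) (UK : U (Xset c k)).

Let C : R := k%:R * c.
Let C0 : 0 <= C. Proof. exact: mulr_ge0. Qed.

Let dn x : R -> V := if pselect (exists f, dens M f x /\
    forall s, enorm (f s) <= k%:R * c * (1 + enorm (x s))) is left h then sval (cid h) else 0.

Let dnP x : Xset c k x -> dens M (dn x) x /\ forall s, enorm (dn x s) <= C * (1 + enorm (x s)).
Proof.
move=> xk; rewrite /dn; case: pselect => [h|]; last by move=> h; case: h; exact: hM.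
by case: (cid h).
Qed.

Let Q0 : 0 <= (Gamma alpha)^-1 * (3 * M). Proof. by rewrite !mulr_ge0. Qed.

Let hoelder (t t' : R) := (Gamma alpha)^-1 * (3 * M) * kerprim alpha `|t' - t|.

Let x_hoelder x t t' i : Xset c k x -> t \in `[0, T] -> t' \in `[0, T] ->
  `|x t' 0 i - x t 0 i| <= hoelder t t'.
Proof. by move=> /dnP[dx _] tT t'T; apply: (dens_hoelder T_gt0 alpha01 _ dx tT t'T). Qed.

Let x_bounded x s i : Xset c k x -> s \in `[0, T] -> `|x s 0 i| <= k%:R + hoelder 0 s.
Proof.
move=> xk sT; rewrite -(subrK (x 0 0 i) (x s 0 i)) addrC.
apply: (le_trans (ler_normD _ _)); apply: lerD; last by apply: x_hoelder; rewrite ?in0.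
by apply: (le_trans (le_enorm _ i)); case: xk.
Qed.

Let ylim s i : R := lim ((fun x : AC => x s 0 i) @ U).

Let ylim_cvg s i : s \in `[0, T] -> (fun x : AC => x s 0 i) @ U --> ylim s i.
Proof.
move=> sT; have [l hl] := ultra_bounded_cvg UU UK (fun x xk => x_bounded i xk sT).
by rewrite /ylim (cvg_lim (@Rhausdorff R) hl).
Qed.

Let yl s : V := if s \in `[0, T] then \row_i ylim s i else 0.

Let yl_cvg s i : s \in `[0, T] -> (fun x : AC => x s 0 i) @ U --> yl s 0 i.
Proof. by move=> sT; rewrite /yl sT mxE; exact: ylim_cvg. Qed.

Let yl_hoelder t t' i : t \in `[0, T] -> t' \in `[0, T] ->
  `|yl t' 0 i - yl t 0 i| <= hoelder t t'.
Proof.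
move=> tT t'T.
have h : (fun x : AC => x t' 0 i - x t 0 i) @ U --> yl t' 0 i - yl t 0 i.
  exact: cvgB (@yl_cvg t' i t'T) (@yl_cvg t i tT).
apply: (cvg_norm_bound _ h); apply: filterS UK => x xk.
exact: x_hoelder.
Qed.

Let yl_cont i tau : tau \in `[0, T] -> unif_cont_at T (fun s => yl s 0 i) tau.
Proof.
move=> tauT e e0; have [dl dl0 h] := kerprim_small_mul a0 Q0 e0.
exists dl => // s sT sdl; exact: le_trans (yl_hoelder i tauT sT) (h _ sdl).
Qed.

(** Pointwise convergence of equi-Hoelder paths is uniform, by compactness of [0, T]. *)
Let yl_unif (e : R) : 0 < e ->
  \forall x \near U, forall (s : R) (i : 'I_n), s \in `[0, T] -> `|(x : AC) s 0 i - yl s 0 i| <= e.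
Proof.
move=> e0; have e3 : 0 < e / 3 by rewrite divr_gt0.
have [dl dl0 h] := kerprim_small_mul a0 Q0 e3.
have hdl t t' : `|t' - t| < dl -> hoelder t t' <= e / 3 by exact: h.
have cD : compact D := segment_compact (a:=0) (b:=T).
have /compact_near_coveringP/near_covering_withinP cov := cD.
suff : \forall x \near U, D `<=` (fun s => forall i, `|(x : AC) s 0 i - yl s 0 i| <= e).
  by apply: filterS => x hx s i sT; apply: hx.
apply: cov => s sD.
have sT : s \in `[0, T] by exact: sD.
have pt : \forall x \near U, forall i, `|yl s 0 i - (x : AC) s 0 i| <= e / 3.
  by apply: filter_forall => i; have /cvgrPdist_le := @yl_cvg s i sT; apply.
near=> t x => tD i.
have tT : t \in `[0, T] by exact: tD.
have ts : `|t - s| < dl.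
  by near: t; exists dl => //= t; rewrite /ball_/= distrC.
have xk : Xset c k x by near: x.
have p1 : `|yl s 0 i - x s 0 i| <= e / 3 by move: i; near: x; exact: pt.
have p2 := le_trans (x_hoelder i xk sT tT) (hdl _ _ ts).
have p3 := le_trans (yl_hoelder i sT tT) (hdl _ _ ts).
have -> : x t 0 i - yl t 0 i = (x t 0 i - x s 0 i) - (yl s 0 i - x s 0 i) - (yl t 0 i - yl s 0 i) by ring.
have -> : e = e / 3 + e / 3 + e / 3 by field.
by apply: (le_trans (ler_normB _ _)); apply: lerD => //; apply: (le_trans (ler_normB _ _)); apply: lerD.
Unshelve. all: by end_near. Qed.

(* the densities converge as set functions only, that is, weakly *)
Let int_dn (i : 'I_n) (A : set RR) x : R := \int[mu]_(s in A `&` D) entry (dn x) i s.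

Let finD : (mu D < +oo)%E.
Proof. by rewrite /= lebesgue_measure_itv/= lte_fin; case: ifP => _; rewrite ltry. Qed.

Let mD : measurable (D : set RR). Proof. exact: measurable_itv. Qed.

Let integrable_dn i (A : set RR) x : Xset c k x -> measurable A ->
  mu.-integrable (A `&` D) (EFin \o entry (dn x) i).
Proof.
move=> /dnP[[bf _] _] mA; apply: (integrableS mD (measurableI _ _ mA mD)).
  by move=> s [].
exact: (integrable_bm 0 T (bf i)).
Qed.

Let int_dn_le i (A : set RR) x : Xset c k x -> measurable A ->
  `|int_dn i A x| <= M * fine (mu (A `&` D)).
Proof.
move=> xk mA; have [[bf _] _] := dnP xk.
have mAD : measurable (A `&` D) by exact: measurableI.
have muAD : (mu (A `&` D) < +oo)%E.
  by apply: le_lt_trans finD; apply: le_measure; rewrite ?inE.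
have i1 : mu.-integrable (A `&` D) (fun s => (1 : R)%:E).
  apply: (integrableS mD mAD); first by move=> s [].
  exact: (integrable_bm 0 T (@bm_cst1 R)).
have -> : int_dn i A x = \int[mu]_(s in A `&` D) (1 * entry (dn x) i s).
  by apply: eq_Rintegral => s _; rewrite mul1r.
apply: (le_trans (le_Rintegral_bmM mAD i1 _ (bf i))) => //.
by rewrite Rintegral_cst// mul1r.
Qed.

Let nu (i : 'I_n) (A : set RR) : R := lim (int_dn i A @ U).

Let nu_cvg i (A : set RR) : measurable A -> int_dn i A @ U --> nu i A.
Proof.
move=> mA; have [l hl] := ultra_bounded_cvg UU UK (fun x xk => int_dn_le i xk mA).
by rewrite /nu (cvg_lim (@Rhausdorff R) hl).
Qed.

Let nuU i (A B : set RR) : measurable A -> measurable B -> A `&` B = set0 ->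
  nu i (A `|` B) = nu i A + nu i B.
Proof.
move=> mA mB AB; apply: (@cvg_unique _ (@Rhausdorff R) (int_dn i (A `|` B) @ U)).
  by apply: nu_cvg; exact: measurableU.
suff h : int_dn i (A `|` B) @ U --> nu i A + nu i B by exact: h.
apply: cvg_trans (cvgD (@nu_cvg i A mA) (@nu_cvg i B mB)); apply: near_eq_cvg.
apply: filterS UK => x xk; rewrite /int_dn /= setIUl Rintegral_setU//.
- exact: measurableI.
- exact: measurableI.
- by rewrite -setIUl; apply: integrable_dn => //; exact: measurableU.
- by apply/disj_setPS; rewrite setIACA AB set0I.
Qed.

Let nu_le i (A : set RR) : measurable A -> `|nu i A| <= M * fine (mu (A `&` D)).
Proof.
move=> mA; apply: (cvg_norm_bound _ (@nu_cvg i A mA)).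
by apply: filterS UK => x xk; exact: int_dn_le.
Qed.

Let dens_lim : exists2 g : R -> V, bmv M g &
  forall i (A : set RR), measurable A -> nu i A = \int[mu]_(s in A `&` D) entry g i s.
Proof.
have H i := bounded_density (measurable_itv `[0, T]) finD (@nuU i) (@nu_le i).
exists (fun s => \row_i sval (cid2 (H i)) s).
  move=> i; have -> : entry (fun s => \row_i sval (cid2 (H i)) s) i = sval (cid2 (H i)).
    by apply/funext => s; rewrite /entry mxE.
  by case: (cid2 (H i)) => g /=; rewrite ger0_norm.
move=> i A mA; have -> : entry (fun s => \row_i sval (cid2 (H i)) s) i = sval (cid2 (H i)).
  by apply/funext => s; rewrite /entry mxE.
by case: (cid2 (H i)) => g /= _ ->.
Qed.

Let itvD (a b : R) : 0 <= a -> b <= T -> `[a, b]%classic `&` D = `[a, b]%classic.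
Proof.
move=> a0' bT; apply: setIidl => s; rewrite /= !in_itv/= => /andP[as_ sb].
by rewrite (le_trans a0' as_) (le_trans sb bT).
Qed.

(** Both sides of the identity [kconv_increment] pass to the limit: the left one by uniform
    convergence of the paths, the right one by convergence of the integrals of the densities
    on [0, t]. Then [frac_inversion] recovers the limit path from its limit density. *)
Let yl_repr g : bmv M g ->
  (forall i (A : set RR), measurable A -> nu i A = \int[mu]_(s in A `&` D) entry g i s) ->
  forall tau i, tau \in `[0, T] ->
    yl tau 0 i = yl 0 0 i + (Gamma alpha)^-1 * kconv alpha (entry g i) tau.
Proof.
move=> bg nug tau i tauT.
have [G1 G2 GB] := Gamma_mul alpha01.
have by_ : bm (k%:R + hoelder 0 T) (entry yl i).
  split.
    have -> : entry yl i = (entry yl i) \_ D.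
      apply/funext => s; rewrite patchE; case: ifPn => // sD.
      rewrite /entry /yl ifN ?mxE//; apply: contra sD => sT; exact/mem_set.
    apply/(measurable_restrictT (entry yl i)) => //.
    apply: subspace_continuous_measurable_fun => //.
    apply/within_contP => p pI e e0; have e2 : 0 < e / 2 by rewrite divr_gt0.
    have [dl dl0 h] := yl_cont i pI e2; exists dl => // q qI; rewrite /ball/= distrC => pq.
    have := h q qI pq; rewrite distrC => hq.
    by apply: (le_lt_trans hq); rewrite ltr_pdivrMr// ltr_pMr// ltr1n.
  move=> s; rewrite /entry; have [sT|sT] := boolP (s \in `[0, T]); last first.
    by rewrite /yl ifN// mxE normr0 addr_ge0// !mulr_ge0// kerprim_ge0.
  apply: (cvg_norm_bound _ (@yl_cvg s i sT)).
  apply: filterS UK => x xk; apply: (le_trans (x_bounded i xk sT)); rewrite lerD2l.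
  rewrite /hoelder ler_wpM2l ?mulr_ge0//; apply: le_kerprim => //.
  rewrite !subr0; move: sT; rewrite in_itv/= => /andP[s0 sT].
  by rewrite !ger0_norm.
apply: (frac_inversion T_gt0 alpha01 by_ (bg i)) => // {tauT} t tT.
  exact: yl_cont.
have [t0 tT'] : 0 <= t /\ t <= T by move: tT; rewrite in_itv/= => /andP[].
have k1 (f : R -> R) : kconv 1 f t = \int[mu]_(s in `[0, t]) f s by rewrite (kconv1E f tT).
pose L x := kconv (1 - alpha) (fun xi => x xi 0 i - x 0 0 i) t.
have c1 : L @ U --> Gamma (1 - alpha) * nu i `[0, t].
  apply: cvg_trans (cvgM (cvg_cst (Gamma (1 - alpha))) (@nu_cvg i `[0, t]%classic (measurable_itv _))).
  apply: near_eq_cvg; apply: filterS UK => x xk; have [dx _] := dnP xk.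
  rewrite /L (kconv_increment T_gt0 alpha01 i dx tT) k1 /int_dn itvD//.
have c2 : L @ U --> kconv (1 - alpha) (fun s => entry yl i s - entry yl i 0) t.
  apply/cvgrPdist_le => e e0.
  have K0 := @kerprim_ge0 R (1 - alpha) t.
  have b0 : 0 < 1 - alpha by case/andP: b01.
  have d0 : 0 < e / 2 / (kerprim (1 - alpha) t + 1) by rewrite !divr_gt0// ltr_wpDl// K0.
  apply: filterS2 UK (yl_unif d0) => x xk hx.
  have [N bx] := bmv_path T_gt0 alpha01 x.
  have b1 := bmB by_ (bm_cst (entry yl i 0)); have b2 := bmB (bx i) (bm_cst (entry x i 0)).
  rewrite /L -(kconvB T t b01 b1 b2).
  set d := e / 2 / _ in d0 hx *.
  have bd : bm (2 * d) (fun _ : R => 2 * d).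
    by split=> [|s]; [exact: measurable_cst|rewrite ger0_norm// mulr_ge0// ltW].
  apply: (le_trans (kconv_mono b01 (bmB b1 b2) bd _)).
    move=> s sD _; rewrite /cst /entry.
    have -> : yl s 0 i - yl 0 0 i - (x s 0 i - x 0 0 i) =
      - (x s 0 i - yl s 0 i) + (x 0 0 i - yl 0 0 i) by ring.
    apply: (le_trans (ler_normD _ _)); rewrite normrN mulr2n mulrDl mul1r.
    by apply: lerD; apply: hx => //; rewrite in0.
  apply: (le_trans (ler_norm _)); apply: (le_trans (kconv_le t b01 T0 bd)).
  rewrite (@kerprim_le0 _ _ (t - T)) ?subr_le0// subr0 /d.
  have kp : 0 < kerprim (1 - alpha) t + 1 by rewrite ltr_wpDl// K0.
  have -> : 2 * (e / 2 / (kerprim (1 - alpha) t + 1)) * kerprim (1 - alpha) t =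
    e * (kerprim (1 - alpha) t / (kerprim (1 - alpha) t + 1)) by field; rewrite gt_eqF.
  by apply: ger_ratio; [exact: ltW|exact: K0].
rewrite (cvg_unique (@Rhausdorff R) c2 c1) (nug i _ (measurable_itv `[0, t])) itvD// k1//.
Qed.

(** The constraint is convex in the derivative, so it survives weak limits. Test it against
    the vector v = g (s) at a point s where g is the derivative of its primitive: over a
    short interval after s the integrals of the inner product of v with the densities are
    bounded by |v| times the constraint, which is almost constant there. In the limit v . v
    <= |v| C (1 + |yl (s)|). *)
Let dens_lim_le g : bmv M g ->
  (forall i (A : set RR), measurable A -> nu i A = \int[mu]_(s in A `&` D) entry g i s) ->
  {ae mu, forall s, s \in `[0, T] -> enorm (g s) <= C * (1 + enorm (yl s))}.
Proof.
move=> bg nug.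
apply: aeS (kconv1_entry_derive bg) => s hs sTT; have [s0 sT {}hs] := hs sTT.
have [s0' sT'] := (ltW s0, ltW sT).
pose v := g s; pose F (t : R) := \sum_i v 0 i * kconv 1 (entry g i) t.
have dF : is_derive s (1 : R) F (dotv v v).
  have -> : F = \sum_(i < n) ((v 0 i) \*: kconv 1 (entry g i)).
    by apply/funext => t; rewrite fct_sumE.
  by apply: is_derive_sum => i; exact: is_deriveZ.
have key (e : R) : 0 < e -> dotv v v <= enorm v * (C * (1 + (enorm (yl s) + n%:R * (2 * e)))).
  move=> e0.
  have H1 : \forall dl \near (0 : R)^'+, forall i, forall t, t \in `[0, T] -> `|t - s| < dl ->
      `|yl t 0 i - yl s 0 i| <= e.
    apply: filter_forall => i; have [dl dl0 h] := yl_cont i sTT e0.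
    near=> dl' => t tT tdl; apply: h => //; apply: (lt_trans tdl).
    by near: dl'; exact: nbhs_right_lt.
  have [dl [dl0 hdl]] : exists dl : R, 0 < dl /\ forall i, forall t, t \in `[0, T] -> `|t - s| < dl ->
      `|yl t 0 i - yl s 0 i| <= e.
    have := filter_ex (filterI (nbhs_right_gt 0) H1); move=> [dl [d0 d1]].
    by exists dl.
  have dl10 : 0 < Num.min dl (T - s) by rewrite lt_min dl0 subr_gt0.
  apply: (is_derive_right_le dF dl10) => h h0; rewrite lt_min => /andP[hdl' hT].
  have shT : s + h <= T by rewrite ltW// -ltrBrDl.
  have ssh : s <= s + h by rewrite lerDl ltW.
  have -> : F (s + h) - F s = \sum_i v 0 i * nu i `[s, s + h].
    rewrite /F -sumrB; apply: eq_bigr => i _; rewrite -mulrBr; congr (_ * _).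
    rewrite (nug i _ (measurable_itv _)) itvD//; exact: (kconv1_itv (bg i)).
  have cv : (fun x => \sum_i v 0 i * int_dn i `[s, s + h] x) @ U --> \sum_i v 0 i * nu i `[s, s + h].
    have -> : (fun x => \sum_i v 0 i * int_dn i `[s, s + h] x) =
      \sum_(i < n) (fun x => v 0 i * int_dn i `[s, s + h] x) by apply/funext => x; rewrite fct_sumE.
    apply: (big_ind2 (fun (a : AC -> R) (b : R) => a @ U --> b)).
    - exact: cvg_cst.
    - by move=> a a' b b'; exact: cvgD.
    - move=> i _; exact: (cvgM (cvg_cst (v 0 i)) (@nu_cvg i `[s, s + h]%classic (measurable_itv _))).
  apply: (cvg_le_bound _ cv); apply: filterS2 UK (yl_unif e0) => x xk hx.
  have [[bf _] fC] := dnP xk.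
  have -> : \sum_i v 0 i * int_dn i `[s, s + h] x = \int[mu]_(t in `[s, s + h]) dotv v (dn x t).
    by rewrite (Rintegral_dotv _ _ _ bf); apply: eq_bigr => i _; rewrite /int_dn itvD.
  apply: (le_trans (ler_norm _)).
  have hE : h = (s + h) - s by rewrite addrC addKr.
  rewrite [X in _ <= _ * X]hE.
  apply: Rintegral_bound => //.
    apply: measurable_funTS; rewrite /dotv; apply: measurable_sum => i.
    by apply: measurable_funM; [exact: measurable_cst|case: (bf i)].
  move=> t; rewrite in_itv/= => /andP[st tsh].
  have tT : t \in `[0, T] by rewrite in_itv/= (le_trans s0' st) (le_trans tsh).
  have cs : `|dotv v (dn x t)| <= enorm v * enorm (dn x t).
    rewrite ler_norml dotv_cauchy_schwarz andbT lerNl -(enormN v).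
    have -> : - dotv v (dn x t) = dotv (- v) (dn x t).
      by rewrite /dotv -sumrN; apply: eq_bigr => i _; rewrite mxE mulNr.
    exact: dotv_cauchy_schwarz.
  apply: (le_trans cs); rewrite ler_wpM2l ?enorm_ge0//.
  apply: (le_trans (fC t)); rewrite ler_wpM2l// lerD2l.
  rewrite -(subrK (yl s) (x t)) addrC; apply: (le_trans (enormD _ _)); rewrite lerD2l.
  apply: enorm_le_const => i.
  have -> : (x t - yl s) 0 i = (x t 0 i - yl t 0 i) + (yl t 0 i - yl s 0 i).
    by rewrite !mxE; ring.
  apply: (le_trans (ler_normD _ _)); have -> : 2 * e = e + e by ring.
  apply: lerD; first exact: hx.
  apply: hdl => //; rewrite ger0_norm ?subr_ge0//; lra.
have [v0|v0] := eqVneq (enorm v) 0.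
  by rewrite -/v v0 mulr_ge0// addr_ge0// enorm_ge0.
have vp : 0 < enorm v by rewrite lt_neqAle eq_sym v0 enorm_ge0.
have key2 (e : R) : 0 < e -> enorm v <= C * (1 + (enorm (yl s) + n%:R * (2 * e))).
  move=> /key; have -> : dotv v v = enorm v * enorm v.
    by rewrite -expr2 sqr_sqrtr// dotvv_ge0.
  by rewrite ler_pM2l.
apply/ler_addgt0Pr => e e0.
have q0 : 0 < C * n%:R * 2 + 1 by rewrite ltr_wpDl// !mulr_ge0.
apply: (le_trans (key2 _ (divr_gt0 e0 q0))).
have -> : C * (1 + (enorm (yl s) + n%:R * (2 * (e / (C * n%:R * 2 + 1))))) =
  C * (1 + enorm (yl s)) + e * (C * n%:R * 2 / (C * n%:R * 2 + 1)) by field; rewrite gt_eqF.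
by rewrite lerD2l; apply: ger_ratio; rewrite ?mulr_ge0// ltW.
Unshelve. all: by end_near. Qed.

(** By [yl_repr], the path built from the limit density is the pointwise limit; by [yl_unif]
    it is the limit in the uniform metric. *)
Lemma Xset_ultra_limit : exists2 y : AC, Xset c k y & U --> y.
Proof.
have [g bg nug] := dens_lim.
have [y [_ yE] y0] := ACa_of_dens T_gt0 alpha01 (yl 0) bg.
have yy tau : tau \in `[0, T] -> y tau = yl tau.
  by move=> tauT; apply/rowP => i; rewrite yE// y0; exact: (esym (@yl_repr g bg nug tau i tauT)).
exists y; last first.
  move=> O /nbhs_ballP[e /= e0 eO].
  have d0 : 0 < e / (n%:R + 1) by rewrite divr_gt0// ltr_wpDl.
  apply: filterS (yl_unif d0) => x hx; apply: eO.
  apply: (@ball_unif _ _ _ _ _ _ e (e / (n%:R + 1))) => [tau i tauT|].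
    by rewrite yy// distrC hx.
  have n1 : 0 < n%:R + 1 :> R by rewrite ltr_wpDl.
  by rewrite mulrCA gtr_pMr// ltr_pdivrMr// mul1r ltrDl.
split.
  apply/ler_addgt0Pr => e e0.
  have d0 : 0 < e / (n%:R + 1) by rewrite divr_gt0// ltr_wpDl.
  have [x [xk hx]] := filter_ex (filterI UK (yl_unif d0)).
  rewrite y0 -(subrK (x 0) (yl 0)) addrC; apply: (le_trans (enormD _ _)).
  apply: lerD; first by case: xk.
  apply: (@le_trans _ _ (n%:R * (e / (n%:R + 1)))).
    by apply: enorm_le_const => i; rewrite !mxE distrC hx// in0.
  by rewrite mulrCA; apply: ger_ratio => //; exact: ltW.
have dy : dens M g y by split.
apply: aeS (aeI (dens_lim_le bg nug) (dens_caputo T_gt0 alpha01 dy)) => s [h1 h2] sT.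
by rewrite (h2 sT) yy//; exact: h1.
Qed.

End closure.

Lemma compact_Xset c k : 0 <= c -> compact (Xset c k : set AC).
Proof.
move=> c0; have [M M0 hM] := Xset_density k c0.
rewrite compact_ultra => U UU UK.
have [y yk Uy] := Xset_ultra_limit c0 M0 hM UU UK.
by exists y.
Qed.

End compactness.

(** * Doubling of variables *)

Section doubling.
Context {R : realType} {n : nat} {T alpha : R}.
Hypotheses (T_gt0 : 0 < T) (alpha01 : 0 < alpha < 1).
Local Notation mu := (@lebesgue_measure R).
Local Notation V := 'rV[R]_n.
Local Notation AC := (ACa n T alpha).
Local Notation D := `[0, T]%classic.
Local Notation kconv := (@kconv R T).
Local Notation wker := (@wker R T alpha).
Local Notation slope := (@slope R T alpha).
Local Notation pairing := (@pairing R T alpha).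
Local Notation penalty := (@penalty R n T alpha).
Implicit Types (x y A : AC) (f g z : R -> V).

Let T0 : 0 <= T. Proof. exact: ltW. Qed.
Let a0 : 0 < alpha. Proof. by case/andP: alpha01. Qed.
Let a1 : alpha < 1. Proof. by case/andP: alpha01. Qed.
Let a01 : 0 < alpha <= 1. Proof. by rewrite a0 ltW. Qed.
Let G0 : 0 < Gamma alpha. Proof. exact: Gamma_gt0. Qed.
Let Gi : 0 <= (Gamma alpha)^-1. Proof. by rewrite invr_ge0 ltW. Qed.
Let iw := integrable_wker T alpha01.

Lemma pairing_ge0 M (f : R -> R) : bm M f -> (forall s, D s -> 0 <= f s) -> 0 <= pairing f.
Proof.
move=> bf f0; have b0 : bm 0 (cst 0 : R -> R) by split=> // s; rewrite normr0.
by apply: le_trans (pairing_mono T_gt0 alpha01 b0 bf _) => // s Ds; rewrite normr0 f0.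
Qed.

(** If |u| exceeds r at some time, it exceeds r / 2 on an interval whose length depends only
    on the common modulus, and the weight is at least its value at time zero. *)
Lemma pairing_small (Q r : R) : 0 <= Q -> 0 < r -> exists2 kap : R, 0 < kap &
  forall e N (u : R -> R), 0 < e -> bm N u ->
  (forall s s', s \in `[0, T] -> s' \in `[0, T] -> `|u s' - u s| <= Q * kerprim alpha `|s' - s|) ->
  pairing (fun s => sm e (u s)) <= kap -> forall s, s \in `[0, T] -> `|u s| <= r.
Proof.
move=> Q0 r0.
have [dl' dl'0 h] := kerprim_small_mul a0 Q0 (divr_gt0 r0 (ltr0n R 2)).
pose dl := Num.min dl' (T / 2).
have dl0 : 0 < dl by rewrite lt_min dl'0 divr_gt0.
have dldl' : dl <= dl' by rewrite ge_min lexx.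
have dlT : dl <= T / 2 by rewrite ge_min lexx orbT.
pose w0 := ker alpha T.
have w00 : 0 < w0 by rewrite /w0 ker_gt0// powR_gt0.
exists (r / 2 * (w0 * (dl / 8))); first by rewrite !mulr_gt0// divr_gt0.
move=> e N u e0 bu uQ pu s sT; rewrite leNgt; apply/negP => rs.
have [s0 sT'] : 0 <= s /\ s <= T by move: sT; rewrite in_itv/= => /andP[].
(* the interval is taken to the left of s, unless s is close to zero *)
have [a [b [a0' [bT [ab near_s]]]]] : exists a b : R, 0 <= a /\ (b < T /\ (b - a = dl / 4 /\
    forall t, a <= t -> t <= b -> `|t - s| < dl)).
  have [sd|sd] := leP (dl / 2) s.
    exists (s - dl / 2), (s - dl / 4); do 3 (split; first lra).
    by move=> t at_ tb; rewrite ltr_norml; apply/andP; split; lra.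
  exists s, (s + dl / 4); do 3 (split; first lra).
  by move=> t at_ tb; rewrite ltr_norml; apply/andP; split; lra.
have ab' : a <= b by lra.
have tr t : t \in `[0, T] -> a <= t -> t <= b -> r / 2 <= `|u t|.
  move=> tT at_ tb; have ts := near_s t at_ tb.
  have h1 := h _ (lt_le_trans ts dldl'); rewrite distrC in h1.
  have h2 := le_trans (uQ _ _ tT sT) h1.
  have := ler_normD (u t) (u s - u t); rewrite addrC subrK; lra.
pose I (t : R) : R := upto b (fun _ => 1 : R) t - upto a (fun _ => 1 : R) t.
have bI : bm (1 + 1) I by apply: bmB; apply: bm_upto; exact: bm_cst1.
have I01 t : I t = if a <= t < b then 1 else 0.
  rewrite /I /upto; case: (leP a t) => at_ /=; first by rewrite subr0.
  by rewrite (lt_le_trans at_ ab') subrr.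
have bf := bmZ (r / 2) bI; have bs := bm_sm e0 bu.
have m1 : `|pairing (fun t => r / 2 * I t)| <= pairing (fun t => sm e (u t)).
  apply: (pairing_mono T_gt0 alpha01 bf bs) => t tD; rewrite I01.
  case: ifPn => [/andP[at_ tb]|_]; last by rewrite mulr0 normr0 sm_ge0.
  rewrite mulr1 ger0_norm; last by rewrite divr_ge0// ltW.
  by apply: le_trans (le_sm _ _); apply: tr => //; exact: ltW.
have m2 : r / 2 * (w0 * (dl / 4)) <= pairing (fun t => r / 2 * I t).
  rewrite (pairingZ T alpha01 _ bI) ler_wpM2l ?divr_ge0 ?(ltW r0)//.
  rewrite /pairing I01 (ltNge T b) (ltW bT) andbF addr0 -ab.
  have -> : w0 * (b - a) = \int[mu]_(t in D) (I t * w0).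
    rewrite (Rintegral_window (fun _ => 1) (fun _ => w0) a0' ab' (ltW bT)).
    by rewrite Rintegral_cst//= mul1r lebesgue_measure_itv/= lte_fin; case: ltP => // ba; lra.
  apply: le_Rintegral => //.
  - apply: (@eq_integrable _ _ _ mu D _ (fun t => (w0 * I t)%:E)) => //.
      by move=> t _; rewrite mulrC.
    exact: (integrable_bm 0 T (bmZ w0 bI)).
  - exact: (integrable_bmM _ iw bI).
  move=> t; rewrite /= in_itv/= => /andP[t0 tT]; rewrite I01 mulrC.
  case: ifPn => [/andP[at_ tb]|_]; last by rewrite !mulr0.
  rewrite !mulr1; apply: ker_le; rewrite ?(ltW a1)//; lra.
have := le_trans m2 (le_trans (ler_norm _) (le_trans m1 pu)).
rewrite ler_pM2l ?divr_gt0// ler_pM2l// leNgt => /negP; apply; lra.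
Qed.

Lemma bm_enorm M z : bmv M z -> exists N, bm N (fun s => enorm (z s)).
Proof.
move=> bz; exists (n%:R * M); split.
  by apply: measurable_enorm => i; case: (bz i).
move=> s; rewrite ger0_norm ?enorm_ge0//; apply: enorm_le_const => i.
by have [_ h] := bz i; exact: (h s).
Qed.

(** The Euclidean norm is at most the sum of the absolute values of the entries. *)
Lemma le_penalty M e z : 0 < e -> bmv M z ->
  enorm (z T) + \int[mu]_(tau in D) (enorm (z tau) / (T - tau) `^ (1 - alpha)) <= penalty e z.
Proof.
move=> e0 bz; have [N bN] := bm_enorm bz.
have -> : \int[mu]_(tau in D) (enorm (z tau) / (T - tau) `^ (1 - alpha)) =
    \int[mu]_(tau in D) (wker tau * enorm (z tau)).
  apply: eq_Rintegral => s; rewrite inE/= in_itv/= => /andP[s0 sT].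
  by rewrite ker_inv ?subr_ge0 ?lt_eqF// mulrC.
rewrite addrC -[X in X <= _]/(pairing (fun s => enorm (z s))).
suff [K bK <-] : exists2 K, bm K (fun s => \sum_i sm e (z s 0 i)) &
    pairing (fun s => \sum_i sm e (z s 0 i)) = penalty e z.
  apply: (le_trans (ler_norm _)); apply: (pairing_mono T_gt0 alpha01 bN bK) => s _.
  rewrite ger0_norm ?enorm_ge0//; apply: (le_trans (enorm_le_sum _)).
  by apply: ler_sum => i _; exact: le_sm.
rewrite /penalty; elim: (index_enum _) => [|i s [K bK IH]].
  exists 0; first by under eq_fun do rewrite big_nil; split=> // t; rewrite normr0.
  rewrite big_nil; under eq_fun do rewrite big_nil.
  by rewrite /pairing addr0 /Rintegral integral0_eq// => t _; rewrite mulr0.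
have bi := bm_sm e0 (bz i).
exists (M + e + K); first by under eq_fun do rewrite big_cons; exact: bmD bi bK.
rewrite big_cons -IH; under eq_fun do rewrite big_cons.
have := pairingB T alpha01 (bmD bi bK) bK.
under eq_fun do rewrite addrK.
by move=> ->; rewrite subrK.
Qed.

Lemma penalty0 e : 0 < e -> penalty e (fun=> 0) = n%:R * (e * pairing (cst 1)).
Proof.
move=> e0; rewrite /penalty -[n in n%:R]card_ord mulr_natl -sumr_const.
apply: eq_bigr => i _; rewrite -(pairingZ T alpha01 e (@bm_cst1 R)); congr pairing.
by apply/funext => s; rewrite mxE sm0// mulr1.
Qed.

Lemma penaltyN e z : penalty e (fun s => - z s) = penalty e z.
Proof.
by apply: eq_bigr => i _; congr pairing; apply/funext => s; rewrite mxE smN.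
Qed.

Lemma penalty_ge_pairing M e z i : 0 < e -> bmv M z ->
  pairing (fun s => sm e (z s 0 i)) <= penalty e z.
Proof.
move=> e0 bz; rewrite /penalty (bigD1 i)//= lerDl; apply: sumr_ge0 => j _.
by apply: (pairing_ge0 (bm_sm e0 (bz j))) => s _; exact: sm_ge0.
Qed.

Section condition_L.
Variables (phi : R -> AC -> R) (K : set AC) (Lam : R).
Hypothesis Kstop : forall t x, K x -> K (stop t x).
Hypothesis philip : forall t x y, t \in `[0, T] -> K x -> K y ->
  `|phi t x - phi t y| <= Lam *
    (enorm (afun t x T - afun t y T)
     + \int[mu]_(tau in `[0, T]) (enorm (afun t x tau - afun t y tau) / (T - tau) `^ (1 - alpha))).
Hypothesis Lam0 : 0 < Lam.

(** Condition (L) compares paths only through their stopped versions, so functionals that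
    satisfy it are non-anticipative. *)
Lemma condL_stop t x : t \in `[0, T] -> K x -> phi t (stop t x) = phi t x.
Proof.
move=> tT Kx; apply/eqP; rewrite -subr_eq0 -normr_le0.
have TT : T \in `[0, T] by rewrite in_itv/= T0 lexx.
have aE s : s \in `[0, T] -> afun t (stop t x) s = afun t x s.
  by move=> sT; rewrite -!(stopE T_gt0 alpha01)// (stop_stop T_gt0 alpha01)// lexx.
apply: (le_trans (philip tT (Kstop t Kx) Kx)).
have I0 : \int[mu]_(tau in `[0, T]) (enorm (afun t (stop t x) tau - afun t x tau)
    / (T - tau) `^ (1 - alpha)) = 0.
  rewrite /Rintegral integral0_eq// => s sT.
  by rewrite (aE s sT) subrr enorm0 mul0r.
by rewrite I0 (aE T TT) subrr enorm0 add0r mulr0.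
Qed.

(** At a time s later than both stopping times, the paths compared by condition (L) are the
    stopped paths themselves. *)
Lemma condL_penalty e s t tau x y : 0 < e -> s \in `[0, T] -> t <= s -> tau <= s -> K x -> K y ->
  `|phi s (stop t x) - phi s (stop tau y)| <=
    Lam * penalty e (fun r => stop t x r - stop tau y r).
Proof.
move=> e0 sT ts taus Kx Ky.
have TT : T \in `[0, T] by rewrite in_itv/= T0 lexx.
have [N bz] := bmv_pathB T_gt0 alpha01 (stop t x) (stop tau y).
apply: (le_trans (philip sT (Kstop t Kx) (Kstop tau Ky))).
rewrite ler_pM2l//; apply: le_trans (le_penalty e0 bz).
rewrite !(afun_stop T_gt0 alpha01)// lerD2l le_eqVlt; apply/orP; left; apply/eqP.
by apply: eq_Rintegral => r /set_mem rT; rewrite !(afun_stop T_gt0 alpha01).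
Qed.

End condition_L.

(** The constant factor in the definition of X_k absorbs any bound of the density. *)
Lemma mem_Xset c x : 0 < c -> exists2 k, (0 < k)%N & Xset c k x.
Proof.
move=> c0; have [M [f df]] := dens_exists alpha01 x; have [bf _] := df.
pose B := Num.max (enorm (x 0)) ((n%:R * M) / c).
have B0 : 0 <= B by rewrite le_max enorm_ge0.
exists (Num.truncn B).+1 => //; split.
  apply: (@le_trans _ _ B); first by rewrite le_max lexx.
  by apply/ltW; exact: truncnS_gt.
apply: aeS (dens_caputo T_gt0 alpha01 df) => s h sT; rewrite h//.
apply: (@le_trans _ _ (n%:R * M)).
  by apply: enorm_le_const => i; have [_ g] := bf i; exact: (g s).
apply: (@le_trans _ _ ((Num.truncn B).+1%:R * c)).
  rewrite -ler_pdivrMr//; apply: (@le_trans _ _ B); first by rewrite le_max lexx orbT.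
  by apply/ltW; exact: truncnS_gt.
by rewrite ler_peMr ?mulr_ge0 ?(ltW c0)// lerDl enorm_ge0.
Qed.

Lemma penalty_cont e : 0 < e ->
  {within (D `*` [set: AC]) `*` (D `*` [set: AC]), continuous
    (fun p : (R * AC) * (R * AC) => penalty e (fun r => stop p.1.1 p.1.2 r - stop p.2.1 p.2.2 r))}.
Proof.
move=> e0; apply/within_contP => -[[t x] [tau y]] [/= [tT _] [tauT _]] d d0.
have m0 := mass_gt0 T alpha.
pose Q := n%:R * pairing (cst 1) + 1.
have Q0 : 0 < Q by rewrite ltr_wpDl// mulr_ge0// ltW.
have d4 : 0 < d / 4 / Q by rewrite !divr_gt0.
have [d1 d10 h1] := stop_cont T_gt0 alpha01 x tT d4.
have [d2 d20 h2] := stop_cont T_gt0 alpha01 y tauT d4.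
exists (Num.min d1 d2); first by rewrite lt_min d10.
move=> [[t' x'] [tau' y']] [/= [t'T _] [tau'T _]] [[/= tt xx] [/= tautau yy]].
have [N bz] := bmv_pathB T_gt0 alpha01 (stop t x) (stop tau y).
have [N' bz'] := bmv_pathB T_gt0 alpha01 (stop t' x') (stop tau' y').
rewrite /ball/=; apply: (@le_lt_trans _ _ (n%:R * ((d / 4 / Q + d / 4 / Q) * pairing (cst 1)))).
  apply: (penalty_lip T_gt0 alpha01 e0 bz bz') => s i Ds; rewrite !mxE.
  have -> : stop t x s 0 i - stop tau y s 0 i - (stop t' x' s 0 i - stop tau' y' s 0 i) =
    (stop t x s 0 i - stop t' x' s 0 i) - (stop tau y s 0 i - stop tau' y' s 0 i) by ring.
  apply: (le_trans (ler_normB _ _)); apply: lerD.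
    apply: h1 => //; first by apply: (lt_le_trans tt); rewrite ge_min lexx.
    by apply: le_ball xx; rewrite ge_min lexx.
  apply: h2 => //; first by apply: (lt_le_trans tautau); rewrite ge_min lexx orbT.
  by apply: le_ball yy; rewrite ge_min lexx orbT.
have -> : n%:R * ((d / 4 / Q + d / 4 / Q) * pairing (cst 1)) =
  d / 2 * ((n%:R * pairing (cst 1)) / Q) by field; rewrite gt_eqF.
apply: (@le_lt_trans _ _ (d / 2)); last by rewrite ltr_pdivrMr// ltr_pMr// ltr1n.
by apply: ger_ratio; [rewrite divr_ge0// ltW|rewrite mulr_ge0// ltW].
Qed.

(** The doubled functional is continuous on a compact set. *)
Lemma doubling_max (K : set AC) (phi1 phi2 : R -> AC -> R) (e L lam rho : R) : 0 < e ->
  compact K -> K !=set0 -> continuous_upto `[0, T] phi1 -> continuous_upto `[0, T] phi2 ->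
  let Phi t x tau y := phi1 t x - phi2 tau y
    - (L * penalty e (fun r => stop t x r - stop tau y r) + (t - tau) ^+ 2 / rho + lam * (T - t)) in
  exists t x tau y, [/\ t \in `[0, T], K x, tau \in `[0, T], K y &
    forall t' x' tau' y', t' \in `[0, T] -> K x' -> tau' \in `[0, T] -> K y' ->
      Phi t' x' tau' y' <= Phi t x tau y].
Proof.
move=> e0 cK [x0 Kx0] c1 c2 Phi.
pose P : set ((R * AC) * (R * AC)) := (D `*` K) `*` (D `*` K).
have cP : compact P by apply: compact_setX; apply: compact_setX => //; exact: segment_compact.
have P0 : P !=set0 by exists ((0, x0), (0, x0)); split; split => //=; rewrite in_itv/= lexx.
pose S : set ((R * AC) * (R * AC)) := (D `*` setT) `*` (D `*` setT).
have PS : P `<=` S by move=> p [[? ?] [? ?]].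
have f1 : {within P, continuous (fun p : (R * AC) * (R * AC) => phi1 p.1.1 p.1.2)}.
  apply/within_contP => p [p1 p2] d d0; have /within_contP h := c1.
  have [dl dl0 hdl] := h p.1 (conj p1.1 I) d d0.
  by exists dl => // q [q1 q2] [pq1 pq2]; apply: hdl => //; split=> //; case: q1.
have f2 : {within P, continuous (fun p : (R * AC) * (R * AC) => - phi2 p.2.1 p.2.2)}.
  apply/within_contP => p [p1 p2] d d0; have /within_contP h := c2.
  have [dl dl0 hdl] := h p.2 (conj p2.1 I) d d0.
  exists dl => // q [q1 q2] [pq1 pq2]; rewrite /ball/= -opprD normrN.
  by apply: hdl => //; split=> //; case: q2.
have f3 := continuous_subspaceW PS (penalty_cont e0).
have pj1 : continuous (fun p : (R * AC) * (R * AC) => p.1.1).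
  by move=> p; apply: (@continuous_comp _ _ _ fst fst); exact: cvg_fst.
have pj2 : continuous (fun p : (R * AC) * (R * AC) => p.2.1).
  by move=> p; apply: (@continuous_comp _ _ _ snd fst); [exact: cvg_snd|exact: cvg_fst].
have f4 : {within P, continuous (fun p : (R * AC) * (R * AC) =>
    - ((p.1.1 - p.2.1) ^+ 2 / rho + lam * (T - p.1.1)))}.
  apply: continuous_subspaceT => p; apply: cvgN; apply: cvgD.
    apply: cvgM; last exact: cvg_cst.
    apply: (@continuous_comp _ _ _ (fun p : (R * AC) * (R * AC) => p.1.1 - p.2.1) (fun v : R => v ^+ 2)).
      by apply: cvgB; [exact: pj1|exact: pj2].
    exact: exprn_continuous.
  apply: cvgM; first exact: cvg_cst.
  by apply: cvgB; [exact: cvg_cst|exact: pj1].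
have f5 : {within P, continuous (fun p : (R * AC) * (R * AC) =>
    - L * penalty e (fun r => stop p.1.1 p.1.2 r - stop p.2.1 p.2.2 r))}.
  by move=> p; apply: cvgM; [exact: cvg_cst|exact: f3].
have cf := within_continuousD (within_continuousD f1 f2) (within_continuousD f5 f4).
have [[[t x] [tau y]] /set_mem[[/= tT Kx] [/= tauT Ky]] hmax] := compact_EVT_max P0 cP cf.
exists t, x, tau, y; split=> // t' x' tau' y' t'T Kx' tau'T Ky'.
have := hmax ((t', x'), (tau', y')); rewrite inE /= => /(_ (conj (conj t'T Kx') (conj tau'T Ky'))).
rewrite /GRing.add /= => h; rewrite /Phi.
have E (p q r a b : R) : p - q - (L * r + a + b) = p - q + (- L * r - (a + b)) by ring.
by rewrite !E.
Qed.

End doubling.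

(** * Concentration on the diagonal and comparison *)

Section comparison.
Context {R : realType} {n : nat} {T alpha c : R}.
Hypotheses (T_gt0 : 0 < T) (alpha01 : 0 < alpha < 1) (c_gt0 : 0 < c).
Local Notation mu := (@lebesgue_measure R).
Local Notation V := 'rV[R]_n.
Local Notation AC := (ACa n T alpha).
Local Notation D := `[0, T]%classic.
Local Notation slope := (@slope R T alpha).
Local Notation pairing := (@pairing R T alpha).
Local Notation penalty := (@penalty R n T alpha).
Implicit Types (x y z A : AC).

Let T0 : 0 <= T. Proof. exact: ltW. Qed.
Let a0 : 0 < alpha. Proof. by case/andP: alpha01. Qed.
Let G0 : 0 < Gamma alpha. Proof. exact: Gamma_gt0. Qed.
Let Gi : 0 <= (Gamma alpha)^-1. Proof. by rewrite invr_ge0 ltW. Qed.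

Variables (sigma : AC -> R) (H : R -> V -> V -> R).
Hypothesis H_cont : {within [set p : R * V * V | p.1.1 \in `[0, T]],
      continuous (fun p => H p.1.1 p.1.2 p.2)}.

(** A form of uniform continuity adapted to the argument: the arguments only have to be
    close and to stay in a fixed box. *)
Lemma H_unif (B P lam : R) : 0 < lam -> exists2 dl : R, 0 < dl &
  forall t (x p : V) t' (x' p' : V), t \in `[0, T] -> t' \in `[0, T] ->
    (forall i, `|x 0 i| <= B) -> (forall i, `|x' 0 i| <= B) ->
    (forall i, `|p 0 i| <= P) -> (forall i, `|p' 0 i| <= P) ->
    `|t - t'| < dl -> (forall i, `|x 0 i - x' 0 i| < dl) -> (forall i, `|p 0 i - p' 0 i| < dl) ->
    `|H t x p - H t' x' p'| < lam.
Proof.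
move=> lam0.
pose box (b : R) : set V := [set v | forall i, `[- b, b]%classic (v 0 i)].
pose KH : set (R * V * V) := (D `*` box B) `*` box P.
have cbox b : compact (box b) by apply: (@rV_compact R n (fun=> `[- b, b]%classic)) => i; exact: segment_compact.
have cKH : compact KH.
  by apply: compact_setX => //; apply: compact_setX => //; exact: segment_compact.
have sub : KH `<=` [set p : R * V * V | p.1.1 \in `[0, T]] by move=> p [[]].
have [dl dl0 h] := compact_unif_cont cKH (continuous_subspaceW sub H_cont) lam0.
exists dl => // t x p t' x' p' tT t'T xB x'B pP p'P tt xx pp.
have bx b (v : V) : (forall i, `|v 0 i| <= b) -> box b v.
  by move=> vb i; rewrite /= in_itv/= -ler_norml.
apply: (h ((t, x), p) ((t', x'), p')).
- by split; [split => //|]; exact: bx.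
- by split; [split => //|]; exact: bx.
- split; [split => //=|]; split=> // i j; rewrite (ord1 i); [exact: xx|exact: pp].
Qed.

Section concentration.
Variables (phi1 phi2 : R -> AC -> R) (K : set AC) (Lam M lam t0 : R) (x0 : AC).
Hypotheses (c1 : continuous_upto `[0, T] phi1) (c2 : continuous_upto `[0, T] phi2).
Hypotheses (cK : compact K) (Kstop : forall t x, K x -> K (stop t x)).
Hypotheses (M0 : 0 <= M) (hM : forall x, K x -> exists f, dens M f x).
Hypothesis Lam0 : 0 < Lam.
Hypothesis philip : forall t x y, t \in `[0, T] -> K x -> K y ->
  `|phi2 t x - phi2 t y| <= Lam *
    (enorm (afun t x T - afun t y T)
     + \int[mu]_(tau in `[0, T]) (enorm (afun t x tau - afun t y tau) / (T - tau) `^ (1 - alpha))).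
Hypothesis terminal : forall x, phi1 T x = phi2 T x.
Hypotheses (t0T : t0 \in `[0, T]) (Kx0 : K x0) (lam0 : 0 < lam).
Hypothesis gap : lam * (2 * T) <= phi1 t0 x0 - phi2 t0 x0.

Let L : R := Lam + 1.
Let L1 : 1 <= L. Proof. by rewrite lerDr ltW. Qed.
Let L0 : 0 < L. Proof. by rewrite (lt_le_trans ltr01). Qed.

Definition doubled (e rho t : R) x (tau : R) y : R := phi1 t x - phi2 tau y
  - (L * penalty e (fun r => stop t x r - stop tau y r) + (t - tau) ^+ 2 / rho + lam * (T - t)).

Let DKsub : D `*` K `<=` D `*` setT. Proof. by move=> p []. Qed.

Let cDK : compact (D `*` K).
Proof. by apply: compact_setX => //; exact: segment_compact. Qed.

Let DK0 : D `*` K !=set0.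
Proof. by exists (0, x0); split => //=; rewrite in_itv/= lexx. Qed.

Let time_unif (phi : R -> AC -> R) (d : R) : continuous_upto `[0, T] phi -> 0 < d ->
  exists2 r : R, 0 < r & forall s s' z, s \in `[0, T] -> s' \in `[0, T] -> K z ->
    `|s - s'| < r -> `|phi s z - phi s' z| < d.
Proof.
move=> cphi d0.
have [r r0 h] := compact_unif_cont cDK (continuous_subspaceW DKsub cphi) d0.
exists r => // s s' z sT s'T Kz ss'; apply: (h (s, z) (s', z)) => //.
by split => //; exact: ballxx.
Qed.

Let difference_bounded : exists2 B : R, 0 <= B & forall t x tau y, t \in `[0, T] -> K x ->
  tau \in `[0, T] -> K y -> phi1 t x - phi2 tau y <= B.
Proof.
have [p1 _ hp1] := compact_EVT_max DK0 cDK (continuous_subspaceW DKsub c1).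
have [p2 _ hp2] := compact_EVT_min DK0 cDK (continuous_subspaceW DKsub c2).
exists `|phi1 p1.1 p1.2 - phi2 p2.1 p2.2| => // t x tau y tT Kx tauT Ky.
apply: le_trans (ler_norm _); apply: lerB.
  by apply: (hp1 (t, x)); rewrite inE; split.
by apply: (hp2 (tau, y)); rewrite inE; split.
Qed.

(** At a maximum, comparison with the diagonal point (t, x, t, x) shows that the penalty,
    with coefficient Lam + 1, is at most phi2 (t, x) - phi2 (tau, y) up to small terms.
    Condition (L) bounds this difference by Lam times the same penalty. So the penalty
    itself is small. The quadratic term makes |t - tau| small, and since the functionals
    agree at time T while the maximum is at least half the gap, t stays away from T. *)
Lemma doubling_concentration : exists d : R, [/\ 0 < d, d <= T & forall del : R, 0 < del ->
  exists e rho t x tau y, [/\ 0 < e, 0 < rho,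
    [/\ t \in `[0, T - d], K x, tau \in `[0, T - d] & K y],
    `|t - tau| < del /\ (forall s i, s \in `[0, T] -> `|(stop t x s - stop tau y s) 0 i| <= del) &
    forall t' x' tau' y', t' \in `[0, T] -> K x' -> tau' \in `[0, T] -> K y' ->
      doubled e rho t' x' tau' y' <= doubled e rho t x tau y]].
Proof.
pose eta := phi1 t0 x0 - phi2 t0 x0.
have lam2T : 0 < lam * (2 * T) by rewrite !mulr_gt0.
have eta0 : 0 < eta by exact: lt_le_trans gap.
have [B B0 hB] := difference_bounded.
have e10 : 0 < eta / 32 by rewrite divr_gt0.
have [r1 r10 h1] := time_unif c1 e10.
have [r2 r20 h2] := time_unif c2 e10.
pose d := Num.min (Num.min r1 r2) T.
have d0 : 0 < d by rewrite !lt_min r10 r20.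
have dr1 : d <= r1 by rewrite !ge_min lexx.
have dr2 : d <= r2 by rewrite !ge_min lexx orbT.
have dT : d <= T by rewrite !ge_min lexx orbT.
pose d' := d / 2; have d'0 : 0 < d' by rewrite divr_gt0.
have d'd : d = d' + d' by rewrite /d' -splitr.
exists d'; split => // [|del del0]; first by lra.
pose q := (Gamma alpha)^-1 * (3 * M); have q0 : 0 <= q by rewrite !mulr_ge0.
have [kap kap0 hkap] := pairing_small T_gt0 alpha01 (addr_ge0 q0 q0) del0.
pose om := Num.min (kap / 4) (eta / 32 / L).
have om0 : 0 < om by rewrite lt_min !divr_gt0.
have [r3 r30 h3] := time_unif c2 om0.
pose m := Num.min (kap / 2) (Num.min (eta / 16 / L) 1).
have m0 : 0 < m by rewrite !lt_min !divr_gt0//=.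
have mass0 := mass_gt0 T alpha.
pose P := L * (n%:R * pairing (cst 1)).
have P0 : 0 <= P by rewrite mulr_ge0 ?(ltW L0)// mulr_ge0// ltW.
have P1 : 0 < P + 1 by rewrite ltr_wpDl.
pose e := m / (P + 1); have e0 : 0 < e by rewrite divr_gt0.
have eP : L * penalty e (fun=> 0) <= m.
  rewrite (penalty0 alpha01 e0).
  have -> : L * (n%:R * (e * pairing (cst 1))) = e * P by rewrite /P; ring.
  by rewrite /e mulrAC -mulrA; apply: ger_ratio => //; exact: ltW.
pose rho0 := Num.min d' (Num.min del r3).
have rho00 : 0 < rho0 by rewrite !lt_min d'0 del0.
have B2 : 0 < B + 2 by rewrite ltr_wpDl.
pose rho := rho0 ^+ 2 / (B + 2).
have rho_gt0 : 0 < rho by rewrite divr_gt0// exprn_gt0.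
have [t [x [tau [y [tT Kx tauT Ky hmax]]]]] :=
  doubling_max T_gt0 alpha01 L lam rho e0 cK (ex_intro _ x0 Kx0) c1 c2.
have [t0' tT'] : 0 <= t /\ t <= T by move: tT; rewrite in_itv/= => /andP[].
have [tau0' tauT'] : 0 <= tau /\ tau <= T by move: tauT; rewrite in_itv/= => /andP[].
pose Dl s := stop t x s - stop tau y s.
have [N bDl] := bmv_pathB T_gt0 alpha01 (stop t x) (stop tau y).
pose pen := penalty e Dl.
have pen0 : 0 <= pen.
  by apply: sumr_ge0 => i _; apply: (pairing_ge0 T_gt0 alpha01 (bm_sm e0 (bDl i))) => s _; exact: sm_ge0.
have diag s z : penalty e (fun r => stop s z r - stop s z r) = penalty e (fun=> 0).
  by congr penalty; apply/funext => u; rewrite subrr.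
pose sq := (t - tau) ^+ 2 / rho.
have sq0 : 0 <= sq by rewrite divr_ge0 ?sqr_ge0// ltW.
have Lpen0 : 0 <= L * pen by rewrite mulr_ge0// ltW.
(* compare the maximum with the value at (t0, x0, t0, x0) *)
have F0 : eta / 2 - m <= phi1 t x - phi2 tau y - (L * pen + sq + lam * (T - t)).
  apply: le_trans (hmax t0 x0 t0 x0 t0T Kx0 t0T Kx0).
  rewrite diag subrr expr0n mul0r addr0 -/eta.
  have lT : lam * (T - t0) <= eta / 2.
    apply: (@le_trans _ _ (lam * T)).
      by rewrite ler_pM2l// lerBlDr lerDl; move: t0T; rewrite in_itv/= => /andP[].
    by rewrite ler_pdivlMr// -mulrA (mulrC T).
  move: lT eP; set u := _ * (T - t0); set v := L * _; set w := eta; lra.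
have lt' : 0 <= lam * (T - t) by rewrite mulr_ge0 ?subr_ge0// ltW.
have m1 : m <= 1 by rewrite !ge_min lexx !orbT.
have Bt := hB t x tau y tT Kx tauT Ky.
have [F1 F1'] : sq <= B + 1 /\ eta / 2 - m <= phi1 t x - phi2 tau y.
  by split; lra.
have ttau : `|t - tau| < rho0.
  rewrite -(ltr_pXn2r (n:=2)) ?nnegrE ?(ltW rho00)// real_normK ?num_real//.
  move: F1; rewrite /sq ler_pdivrMr// => F1; apply: (le_lt_trans F1).
  rewrite /rho mulrCA gtr_pMr ?exprn_gt0// ltr_pdivrMr// mul1r ltrD2l.
  by rewrite ltr1n.
have := ttau; rewrite !lt_min => /and3P[tt1 tt2 tt3].
(* compare the maximum with the value at (t, x, t, x) *)
have F2 : L * pen <= phi2 t x - phi2 tau y + m.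
  have := hmax t x t x tT Kx tT Kx; rewrite diag subrr expr0n mul0r addr0 -/pen -/sq.
  lra.
(* move both times to the later one, where (L) compares the stopped paths *)
have F3 : phi2 t x - phi2 tau y <= om + om + Lam * pen.
  pose s := Num.max t tau.
  have ts : t <= s by rewrite le_max lexx.
  have taus : tau <= s by rewrite le_max lexx orbT.
  have sT : s \in `[0, T] by rewrite in_itv/= (le_trans t0' ts) ge_max tT' tauT'.
  have st : `|s - t| < r3 /\ `|s - tau| < r3.
    rewrite /s; case: (leP t tau) => _; rewrite subrr normr0 r30; split=> //.
    by rewrite distrC.
  have g1 := condL_stop T_gt0 alpha01 Kstop philip tT Kx.
  have g2 := condL_stop T_gt0 alpha01 Kstop philip tauT Ky.
  have g3 := h3 s t (stop t x) sT tT (Kstop _ Kx) st.1.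
  have g4 := h3 s tau (stop tau y) sT tauT (Kstop _ Ky) st.2.
  have g5 := condL_penalty T_gt0 alpha01 Kstop philip Lam0 e0 sT ts taus Kx Ky.
  move: g3 g4 g5; rewrite g1 g2 -/pen !ltr_norml ler_norml => /andP[g31 g32] /andP[g41 g42] /andP[g51 g52].
  lra.
have F4 : pen <= om + om + m.
  by move: F2 F3; rewrite /L mulrDl mul1r; lra.
have omL : L * om <= eta / 32.
  by rewrite mulrC -ler_pdivlMr// ge_min lexx orbT.
have mL : L * m <= eta / 16.
  by rewrite mulrC -ler_pdivlMr// !ge_min lexx !orbT.
have om1 : om <= L * om by rewrite ler_peMl// ltW.
have mm1 : m <= L * m by rewrite ler_peMl// ltW.
have Lampen : Lam * pen <= L * om + L * om + L * m.
  apply: (@le_trans _ _ (L * pen)); first by rewrite ler_wpM2r// lerDl.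
  by rewrite -!mulrDr ler_pM2l.
(* near T the difference of phi1 and phi2 at (t, x) is too small *)
have tTd : t <= T - d.
  rewrite leNgt; apply/negP => Td.
  have TT : T \in `[0, T] by rewrite in_itv/= T0 lexx.
  have near0 : `|T - t| < d by rewrite ger0_norm ?subr_ge0// ltrBlDr -ltrBlDl.
  have g1 := h1 T t x TT tT Kx (lt_le_trans near0 dr1).
  have g2 := h2 T t x TT tT Kx (lt_le_trans near0 dr2).
  move: g1 g2; rewrite terminal !ltr_norml => /andP[g11 g12] /andP[g21 g22].
  lra.
have tI : t \in `[0, T - d'].
  by rewrite in_itv/= t0'/=; lra.
have tauI : tau \in `[0, T - d'].
  rewrite in_itv/= tau0'/=; move: tt1; rewrite ltr_norml => /andP[]; lra.
exists e, rho, t, x, tau, y; split => //; split=> // s i sT.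
apply: (hkap e N _ e0 (bDl i)) => // [s1 s2 s1T s2T|].
  have [f df] := hM (Kstop t Kx); have [g dg] := hM (Kstop tau Ky).
  rewrite /entry !mxE.
  have -> : stop t x s2 0 i - stop tau y s2 0 i - (stop t x s1 0 i - stop tau y s1 0 i) =
    (stop t x s2 0 i - stop t x s1 0 i) - (stop tau y s2 0 i - stop tau y s1 0 i) by ring.
  apply: (le_trans (ler_normB _ _)); rewrite mulrDl; apply: lerD.
    exact: (dens_hoelder T_gt0 alpha01 _ df).
  exact: (dens_hoelder T_gt0 alpha01 _ dg).
apply: (le_trans (penalty_ge_pairing T_gt0 alpha01 i e0 bDl)); apply: (le_trans F4).
have omk : om <= kap / 4 by rewrite ge_min lexx.
have mk : m <= kap / 2 by rewrite ge_min lexx.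
lra.
Qed.

(** The common form of the two test gradients at the point of maximum: they differ only in
    the time s at which the slope is taken. *)
Definition penalty_grad (e t : R) x (tau : R) y (s : R) : V :=
  \row_i (L * slope s (fun r => dsm e ((stop t x r - stop tau y r) 0 i))).

Section viscosity_inequalities.
Variables (k : nat) (e rho t tau : R) (x y : AC).
Hypotheses (k0 : (0 < k)%N) (KE : K = Xset c k) (e0 : 0 < e).
Hypotheses (tT : t \in `[0, T[) (tauT : tau \in `[0, T[) (Kx : K x) (Ky : K y).
Hypothesis hmax : forall t' x' tau' y', t' \in `[0, T] -> K x' -> tau' \in `[0, T] -> K y' ->
  doubled e rho t' x' tau' y' <= doubled e rho t x tau y.

Let itv_cc s : s \in `[0, T[ -> s \in `[0, T].
Proof. by rewrite !in_itv/= => /andP[-> /ltW]. Qed.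

(** With tau and y frozen, the doubled functional is phi1 minus a test functional, whose
    time derivative at t is 2 (t - tau) / rho - lam. *)
Lemma sub_inequality : viscosity_solution c H sigma phi1 ->
  lam <= 2 * (t - tau) / rho + H t (x t) (penalty_grad e t x tau y t).
Proof.
move=> [_ _ _ v1].
have sm1 := ci_smooth_test T_gt0 alpha01 L (tau ^+ 2 / rho + lam * T) (- (2 * tau / rho) - lam) rho^-1
  (stop tau y) e0.
have [_ vm] := v1 _ _ _ sm1 k k0 t x tT.
have : attains_max (fun s z => phi1 s z - test_fun e L (tau ^+ 2 / rho + lam * T)
    (- (2 * tau / rho) - lam) rho^-1 (stop tau y) s z) (Xset c k) t x.
  split; [exact: itv_cc|by rewrite -KE|] => s z sT; rewrite -KE => Kz.
  have := hmax sT Kz (itv_cc tauT) Ky.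
  rewrite /doubled /test_fun /test_dev.
  have -> : (s - tau) ^+ 2 / rho = tau ^+ 2 / rho - 2 * tau / rho * s + rho^-1 * s ^+ 2 by ring.
  have -> : (t - tau) ^+ 2 / rho = tau ^+ 2 / rho - 2 * tau / rho * t + rho^-1 * t ^+ 2 by ring.
  rewrite !mulrBr !mulrDl !mulNr.
  by lra.
move/vm; rewrite /test_dt -[test_grad _ _ _ _ _]/(penalty_grad e t x tau y t).
have -> : 2 * (t - tau) / rho = - (2 * tau / rho) + 2 * rho^-1 * t by ring.
lra.
Qed.

(** With t and x frozen, phi2 minus the test functional is the opposite of the doubled
    functional, up to a constant. The penalty now enters with a minus sign and through the
    opposite difference of paths; as it is even, the two signs cancel in its gradient. *)
Lemma super_inequality : viscosity_solution c H sigma phi2 ->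
  2 * (t - tau) / rho + H tau (y tau) (penalty_grad e t x tau y tau) <= 0.
Proof.
move=> [_ _ _ v2].
have sm2 := ci_smooth_test T_gt0 alpha01 (- L) (- (t ^+ 2 / rho)) (2 * t / rho) (- rho^-1)
  (stop t x) e0.
have [vm _] := v2 _ _ _ sm2 k k0 tau y tauT.
have : attains_min (fun s z => phi2 s z - test_fun e (- L) (- (t ^+ 2 / rho)) (2 * t / rho)
    (- rho^-1) (stop t x) s z) (Xset c k) tau y.
  split; [exact: itv_cc|by rewrite -KE|] => s z sT; rewrite -KE => Kz.
  have := hmax (itv_cc tT) Kx sT Kz.
  rewrite /doubled /test_fun /test_dev.
  have sw s' z' : penalty e (fun r => stop t x r - stop s' z' r) =
      penalty e (fun r => stop s' z' r - stop t x r).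
    by rewrite -penaltyN; congr penalty; apply/funext => u; rewrite opprB.
  rewrite !sw.
  have -> : (t - s) ^+ 2 / rho = t ^+ 2 / rho - 2 * t / rho * s + rho^-1 * s ^+ 2 by ring.
  have -> : (t - tau) ^+ 2 / rho = t ^+ 2 / rho - 2 * t / rho * tau + rho^-1 * tau ^+ 2 by ring.
  rewrite !mulNr.
  by lra.
move/vm; rewrite /test_dt.
have tau0 : 0 <= tau by move: tauT; rewrite in_itv/= => /andP[].
have [N bDl] := bmv_pathB T_gt0 alpha01 (stop t x) (stop tau y).
have -> : test_grad e (- L) (stop t x) tau y = penalty_grad e t x tau y tau.
  apply/rowP => i; rewrite !mxE.
  have -> : (fun s => dsm e (test_dev (stop t x) tau y s 0 i)) =
      (fun s => - dsm e ((stop t x s - stop tau y s) 0 i)).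
    by apply/funext => s; rewrite /test_dev -dsmN; congr dsm; rewrite !mxE opprB.
  by rewrite (slopeN T alpha01 tau0 (bm_dsm e0 (proj1 (bDl i)))) mulrNN.
have -> : 2 * (t - tau) / rho = 2 * t / rho + 2 * - rho^-1 * tau by ring.
by [].
Qed.

End viscosity_inequalities.
End concentration.

(** Subtracting the two viscosity inequalities cancels the quadratic time term and leaves
    lam at most a difference of values of H. The arguments of H stay in a fixed box and are
    as close as desired: the paths by concentration, the gradients by [slope_unif]. So this
    difference is less than lam, a contradiction. *)
Lemma comparison phi1 phi2 t0 x0 :
  viscosity_solution c H sigma phi1 -> viscosity_solution c H sigma phi2 ->
  t0 \in `[0, T] -> phi1 t0 x0 <= phi2 t0 x0.
Proof.
move=> v1 v2 t0T; rewrite leNgt; apply/negP => lt0.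
have [c1 _ b1 _] := v1; have [c2 L2 b2 _] := v2.
have [k k0 Kx0] := mem_Xset T_gt0 alpha01 x0 c_gt0.
pose K : set AC := Xset c k.
have cK : compact K := compact_Xset T_gt0 alpha01 (ltW c_gt0).
have [Lam Lam0 philip] := L2 K cK.
have Kstop t x : K x -> K (stop t x) by move=> Kx; exact: (stop_Xset T_gt0 alpha01).
have [M M0 hM'] := Xset_density T_gt0 alpha01 k (ltW c_gt0) (n:=n).
have hM x : K x -> exists f, dens M f x by move=> /hM'[f [df _]]; exists f.
have [Bx hBx] := Xset_bound T_gt0 alpha01 k (ltW c_gt0) (n:=n).
pose lam := (phi1 t0 x0 - phi2 t0 x0) / (2 * T).
have T2 : 0 < 2 * T by rewrite mulr_gt0.
have lam0 : 0 < lam by rewrite divr_gt0// subr_gt0.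
have gap : lam * (2 * T) <= phi1 t0 x0 - phi2 t0 x0 by rewrite /lam divfK// gt_eqF.
have terminal x : phi1 T x = phi2 T x by rewrite b1 b2.
have [d [d0 dT conc]] :=
  doubling_concentration c1 c2 cK Kstop M0 hM Lam0 philip terminal t0T Kx0 lam0 gap.
have L0 : 0 < Lam + 1 by rewrite addr_gt0.
have [Ks Ks0 hKs] := slope_bounded alpha01 d0 dT.
have [dH dH0 hH] := H_unif Bx ((Lam + 1) * Ks) lam0.
have e30 : 0 < dH / 2 / (Lam + 1) by rewrite !divr_gt0.
have [dls dls0 hdls] := slope_unif T alpha01 d0 e30.
pose r := dH / 4; have r0 : 0 < r by rewrite divr_gt0.
pose q := (Gamma alpha)^-1 * (3 * M); have q0 : 0 <= q by rewrite !mulr_ge0.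
have [rh rh0 hrh] := kerprim_small_mul a0 q0 r0.
have del0 : 0 < Num.min (Num.min dls rh) (Num.min dH r) by rewrite !lt_min dls0 rh0 dH0.
have [e [rho [t [x [tau [y [e0 rho0 [tI Kx tauI Ky] [ttau small] hmax]]]]]]] := conc _ del0.
move: ttau; rewrite !lt_min => /andP[/andP[tt1 tt2] /andP[tt3 _]].
have Td s : s \in `[0, T - d] -> (s \in `[0, T[) /\ (s \in `[0, T]).
  by rewrite !in_itv/= => /andP[-> sT]; split; lra.
have [tTo tT] := Td _ tI; have [tauTo tauT] := Td _ tauI.
have V1 := sub_inequality k0 erefl e0 tTo tauTo Kx Ky hmax v1.
have V2 := super_inequality k0 erefl e0 tTo tauTo Kx Ky hmax v2.
set p := penalty_grad Lam e t x tau y in V1 V2.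
have [N bDl] := bmv_pathB T_gt0 alpha01 (stop t x) (stop tau y).
have bG i := bm_dsm e0 (proj1 (bDl i)).
have xy i : `|x t 0 i - y tau 0 i| < dH.
  have [g dg] := hM _ (Kstop tau y Ky).
  have xE : x t = stop t x t by rewrite (stop_past T_gt0 alpha01).
  have yE : y tau = stop tau y tau by rewrite (stop_past T_gt0 alpha01).
  have -> : x t 0 i - y tau 0 i =
      (stop t x t - stop tau y t) 0 i + (stop tau y t 0 i - stop tau y tau 0 i).
    by rewrite xE yE !mxE; ring.
  have g1 : `|(stop t x t - stop tau y t) 0 i| <= r.
    by apply: (le_trans (small t i tT)); rewrite !ge_min lexx !orbT.
  have g2 : `|stop tau y t 0 i - stop tau y tau 0 i| <= r.
    exact: le_trans (dens_hoelder T_gt0 alpha01 i dg tauT tT) (hrh _ tt2).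
  apply: (le_lt_trans (ler_normD _ _)); apply: (le_lt_trans (lerD g1 g2)).
  by rewrite /r; lra.
have pb s i : s \in `[0, T - d] -> `|p s 0 i| <= (Lam + 1) * Ks.
  move=> sI; rewrite mxE normrM (gtr0_norm L0) ler_pM2l//.
  have s0 : 0 <= s by move: sI; rewrite in_itv/= => /andP[].
  by apply: (le_trans (slope_le T alpha01 s0 (bG i))); rewrite mul1r; exact: hKs.
have pp i : `|p t 0 i - p tau 0 i| < dH.
  rewrite !mxE -mulrBr normrM (gtr0_norm L0).
  have := hdls tau t tauI tI tt1 _ (bG i); rewrite ler_pdivlMr// => g.
  rewrite mulrC; apply: (le_lt_trans g).
  by rewrite ltr_pdivrMr// ltr_pMr// ltr1n.
have xb z s i : K z -> s \in `[0, T] -> `|z s 0 i| <= Bx by move=> Kz sT; exact: hBx.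
have := hH t (x t) (p t) tau (y tau) (p tau) tT tauT (fun i => xb _ _ i Kx tT)
  (fun i => xb _ _ i Ky tauT) (fun i => pb _ i tI) (fun i => pb _ i tauI) tt3 xy pp.
rewrite ltr_norml => /andP[_]; move: V1 V2.
lra.
Qed.

End comparison.

Theorem theorem5p1 (R : realType) (n : nat) (T alpha c : R)
    (sigma : ACa n T alpha -> R)
    (H : R -> 'rV[R]_n -> 'rV[R]_n -> R)
    (n_gt0 : (0 < n)%N) (T_gt0 : 0 < T) (alpha01 : 0 < alpha < 1)
    (H_cont : {within [set p : R * 'rV[R]_n * 'rV[R]_n | p.1.1 \in `[0, T]],
      continuous (fun p => H p.1.1 p.1.2 p.2)})
    (c_gt0 : 0 < c)
    (H_lip : forall (t : R) (x s r : 'rV[R]_n), t \in `[0, T] ->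
      `|H t x s - H t x r| <= c * (1 + enorm x) * enorm (s - r)) :
  forall phi1 phi2 : R -> ACa n T alpha -> R,
    viscosity_solution c H sigma phi1 -> viscosity_solution c H sigma phi2 ->
    forall t x, t \in `[0, T] -> phi1 t x = phi2 t x.
Proof.
move=> phi1 phi2 v1 v2 t x tT; apply/eqP; rewrite eq_le.
apply/andP; split; first exact: (comparison T_gt0 alpha01 c_gt0 H_cont x v1 v2 tT).
exact: (comparison T_gt0 alpha01 c_gt0 H_cont x v2 v1 tT).
Qed.
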